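(* The problem $\mathit{Sat}(\mathcal{B}c^\circ,\mathrm{RC}(\mathbb{R}^3))$ is NP-complete.
   Context: For a topological space $T$ and $X\subseteq T$, $\overline{X}$ is the closure and $X^\circ$ the interior of $X$; $X$ is regular closed if $X=\overline{X^\circ}$. $\mathrm{RC}(T)$ is the Boolean algebra of regular closed subsets of $T$ with $X+Y=X\cup Y$, $X\cdot Y=\overline{(X\cap Y)^\circ}$, $-X=\overline{T\setminus X}$, $0=\emptyset$, $1=T$. Terms are built from countably many variables and the constants $0,1$ using $+,\cdot,-$. $\mathcal{B}c^\circ$-formulas are built from atoms $\tau_1=\tau_2$ and $c^\circ(\tau)$ using $\wedge,\neg$. An interpretation $\mathfrak I$ over $\mathrm{RC}(T)$ maps variables to elements of $\mathrm{RC}(T)$, extended to terms via the Boolean operations; $\mathfrak I\models\tau_1=\tau_2$ iff $\tau_1^{\mathfrak I}=\tau_2^{\mathfrak I}$, and $\mathfrak I\models c^\circ(\tau)$ iff $(\tau^{\mathfrak I})^\circ$ is connected. $\mathit{Sat}(\mathcal{B}c^\circ,\mathrm{RC}(\mathbb{R}^3))$ is the problem of deciding, given a $\mathcal{B}c^\circ$-formula, whether some interpretation over $\mathrm{RC}(\mathbb{R}^3)$ satisfies it. *)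

(* Defs.v *)
From HB Require Import structures.
From Corelib Require Import PosDef.
From mathcomp Require Import all_boot all_order all_algebra.
From mathcomp Require Import all_classical all_reals all_analysis.
Import numFieldNormedType.Exports.

Set Implicit Arguments.
Unset Strict Implicit.
Unset Printing Implicit Defensive.

Local Open Scope classical_set_scope.

Section RegularClosed.
Variable T : topologicalType.
Implicit Types X Y : set T.

Definition regular_closed X : Prop := X = closure (interior X).

Definition rc_add X Y : set T := X `|` Y.
Definition rc_mul X Y : set T := closure (interior (X `&` Y)).
Definition rc_opp X : set T := closure (~` X).

End RegularClosed.

Inductive term : Type :=
| Var of nat
| Zero
| One
| Add of term & term
| Mul of term & term
| Opp of term.

Inductive formula : Type :=
| Equal of term & term
| IntConn of term
| And of formula & formula
| Not of formula.

Section Semantics.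
Variable T : topologicalType.

Record interpretation := Interpretation {
  val_var :> nat -> set T;
  val_varP : forall v, regular_closed (val_var v) }.

Fixpoint eval (I : interpretation) (t : term) : set T :=
  match t with
  | Var v => I v
  | Zero => set0
  | One => setT
  | Add t1 t2 => rc_add (eval I t1) (eval I t2)
  | Mul t1 t2 => rc_mul (eval I t1) (eval I t2)
  | Opp t1 => rc_opp (eval I t1)
  end.

(* The library's [connected] holds of the empty set, so c°(0) is true. *)
Fixpoint models (I : interpretation) (phi : formula) : Prop :=
  match phi with
  | Equal t1 t2 => eval I t1 = eval I t2
  | IntConn t => connected (interior (eval I t))
  | And phi1 phi2 => models I phi1 /\ models I phi2
  | Not phi1 => ~ models I phi1
  end.

Definition satisfiable (phi : formula) : Prop :=
  exists I : interpretation, models I phi.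

End Semantics.

(* [TVar] is followed by the binary expansion of the variable's index, written
   with the digits [TBit]; these differ from the constants [TZero], [TOne]. *)
Inductive token : Type :=
| TVar | TBit of bool | TZero | TOne | TAdd | TMul | TOpp
| TEqual | TIntConn | TAnd | TNot.

Definition nat_of_token (a : token) : nat :=
  match a with
  | TVar => 0 | TBit b => b.+1 | TZero => 3 | TOne => 4 | TAdd => 5
  | TMul => 6 | TOpp => 7 | TEqual => 8 | TIntConn => 9 | TAnd => 10
  | TNot => 11
  end.

Definition ord_of_token (a : token) : 'I_12 := inord (nat_of_token a).

Definition token_of_ord (i : 'I_12) : token :=
  nth TVar [:: TVar; TBit false; TBit true; TZero; TOne; TAdd; TMul; TOpp;
               TEqual; TIntConn; TAnd; TNot] i.

Lemma ord_of_tokenK : cancel ord_of_token token_of_ord.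
Proof.
by case=> [|[]|||||||||]; rewrite /token_of_ord /ord_of_token inordK.
Qed.

HB.instance Definition _ := Finite.copy token (can_type ord_of_tokenK).

(* Least significant digit first; 0 is the empty string of digits. *)
Fixpoint bits_of_positive (p : positive) : seq bool :=
  match p with
  | xH => [:: true]
  | xO q => false :: bits_of_positive q
  | xI q => true :: bits_of_positive q
  end.

Definition bits_of_nat (n : nat) : seq bool :=
  if bin_of_nat n is Npos p then bits_of_positive p else [::].

Fixpoint encode_term (t : term) : seq token :=
  match t with
  | Var v => TVar :: map TBit (bits_of_nat v)
  | Zero => [:: TZero]
  | One => [:: TOne]
  | Add t1 t2 => TAdd :: encode_term t1 ++ encode_term t2
  | Mul t1 t2 => TMul :: encode_term t1 ++ encode_term t2
  | Opp t1 => TOpp :: encode_term t1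
  end.

Fixpoint encode (phi : formula) : seq token :=
  match phi with
  | Equal t1 t2 => TEqual :: encode_term t1 ++ encode_term t2
  | IntConn t => TIntConn :: encode_term t
  | And phi1 phi2 => TAnd :: encode phi1 ++ encode phi2
  | Not phi1 => TNot :: encode phi1
  end.

Lemma bits_of_positive_inj : injective bits_of_positive.
Proof.
have ne p : bits_of_positive p <> [::] by case: p.
elim=> [p IH|p IH|] [q|q|] //= [].
- by move/IH->.
- by move/ne.
- by move/IH->.
- by move/esym/ne.
Qed.

Lemma bits_of_nat_inj : injective bits_of_nat.
Proof.
move=> m n; rewrite /bits_of_nat -{2}(bin_of_natK m) -{2}(bin_of_natK n).
case: (bin_of_nat m) (bin_of_nat n) => [|p] [|q] //.
- by case: q.
- by case: p.
- by move/bits_of_positive_inj->.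
Qed.

Definition bit_free (s : seq token) : bool :=
  if s is TBit _ :: _ then false else true.

Lemma encode_term_cat_inj t1 t2 s1 s2 : bit_free s1 -> bit_free s2 ->
  encode_term t1 ++ s1 = encode_term t2 ++ s2 -> t1 = t2 /\ s1 = s2.
Proof.
have bfe t s : bit_free (encode_term t ++ s) by case: t.
elim: t1 t2 s1 s2 => [v|||t IHt u IHu|t IHt u IHu|t IHt]
  [v'|||t' u'|t' u'|t'] s1 s2 b1 b2 //=.
- case=> E; have : bits_of_nat v = bits_of_nat v' /\ s1 = s2.
    elim: (bits_of_nat v) (bits_of_nat v') E => [|x l IH] [|x' l'] //=.
    + by move=> E; move: b1; rewrite E.
    + by move=> E; move: b2; rewrite -E.
    + by case=> -> /IH [-> ->].
  by case=> /bits_of_nat_inj -> ->.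
- by case.
- by case.
- by case; rewrite -!catA => /IHt [] // -> /IHu [] // -> ->.
- by case; rewrite -!catA => /IHt [] // -> /IHu [] // -> ->.
- by case=> /IHt [] // -> ->.
Qed.

Lemma encode_inj : injective encode.
Proof.
have bfe t s : bit_free (encode_term t ++ s) by case: t.
have bff f s : bit_free (encode f ++ s) by case: f.
have key f1 f2 s1 s2 : bit_free s1 -> bit_free s2 ->
    encode f1 ++ s1 = encode f2 ++ s2 -> f1 = f2 /\ s1 = s2.
  elim: f1 f2 s1 s2 => [t u|t|f IHf g IHg|f IHf] [t' u'|t'|f' g'|f'] s1 s2 b1 b2
    //= [].
  - rewrite -!catA => /encode_term_cat_inj [] // -> /encode_term_cat_inj [] //.
    by move=> -> ->.
  - by move=> /encode_term_cat_inj [] // -> ->.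
  - by rewrite -!catA => /IHf [] // -> /IHg [] // -> ->.
  - by move=> /IHf [] // -> ->.
by move=> f1 f2 E; have [] := key f1 f2 [::] [::] isT isT; rewrite ?cats0.
Qed.

Definition language (Sigma : Type) : Type := set (seq Sigma).

Definition Sat_Bc (T : topologicalType) : language token :=
  [set w | exists2 phi : formula, w = encode phi & satisfiable T phi].

Inductive direction : Type := Left | Stay | Right.

Definition option_of_direction (d : direction) : option bool :=
  match d with Left => Some false | Stay => None | Right => Some true end.

Definition direction_of_option (o : option bool) : direction :=
  match o with Some false => Left | None => Stay | Some true => Right end.

Lemma option_of_directionK : cancel option_of_direction direction_of_option.
Proof. by case. Qed.

HB.instance Definition _ :=
  Finite.copy direction (can_type option_of_directionK).

Section Tapes.
Variable A : Type.

(* A two-way infinite tape over [option A], [None] being the blank symbol.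
   [tleft] lists the cells to the left of the head, the nearest one first; all
   cells not listed are blank. *)
Record tape := Tape {
  tleft : seq (option A);
  thead : option A;
  tright : seq (option A) }.

Definition blank_tape : tape := Tape [::] None [::].

Definition tape_of_word (w : seq A) : tape :=
  if w is a :: w' then Tape [::] (Some a) (map Some w') else blank_tape.

Definition write (b : option A) (t : tape) : tape :=
  Tape (tleft t) b (tright t).

Definition shift (d : direction) (t : tape) : tape :=
  match d with
  | Left =>
      Tape (behead (tleft t)) (head None (tleft t)) (thead t :: tright t)
  | Stay => t
  | Right =>
      Tape (thead t :: tleft t) (head None (tright t)) (behead (tright t))
  end.

Fixpoint nonblank_prefix (s : seq (option A)) : seq A :=
  if s is Some a :: s' then a :: nonblank_prefix s' else [::].

(* The word read from the head rightwards up to the first blank. *)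
Definition word_of_tape (t : tape) : seq A :=
  nonblank_prefix (thead t :: tright t).

End Tapes.

Record machine (A : finType) := Machine {
  tapes : nat;  (* there are [tapes.+1] tapes *)
  state : finType;
  start : state;
  accepting : pred state;
  trans : state -> {ffun 'I_tapes.+1 -> option A} ->
    {set state * {ffun 'I_tapes.+1 -> option A * direction}} }.

Section Computations.
Variables (A : finType) (M : machine A).

Definition config : Type :=
  (state M * {ffun 'I_(tapes M).+1 -> tape A})%type.

Definition enabled (c : config) :
    {set state M * {ffun 'I_(tapes M).+1 -> option A * direction}} :=
  trans c.1 [ffun i => thead (c.2 i)].

Definition step (c c' : config) : Prop :=
  exists2 a, a \in enabled c &
    c' = (a.1, [ffun i => shift (a.2 i).2 (write (a.2 i).1 (c.2 i))]).

Fixpoint steps (k : nat) (c c' : config) : Prop :=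
  if k is k'.+1 then exists2 c1, step c c1 & steps k' c1 c' else c = c'.

Definition halted (c : config) : Prop := enabled c = finset.set0.

Definition initial (w : seq A) : config :=
  (start M,
   [ffun i => if i == ord0 then tape_of_word w else blank_tape A]).

Definition output (c : config) : seq A := word_of_tape (c.2 ord0).

Definition deterministic : Prop := forall q s, #|trans (m := M) q s| <= 1.

Definition accepts (w : seq A) : Prop :=
  exists k c, [/\ steps k (initial w) c, halted c & accepting c.1].

End Computations.

(* Every computation of [M] on (the image under [i] of) an input [w] makes at
   most [p (size w)] steps. *)
Definition runs_in_time (Sigma A : finType) (M : machine A) (i : Sigma -> A)
    (p : {poly nat}) : Prop :=
  forall (w : seq Sigma) k (c : config M),
    steps k (initial M (map i w)) c -> k <= p.[size w]%R.

(* The injection [i] presents the input alphabet [Sigma] as a part of the tape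
   alphabet; it never hits the blank symbol. *)
Definition NP (Sigma : finType) (L : language Sigma) : Prop :=
  exists (A : finType) (i : Sigma -> A) (M : machine A) (p : {poly nat}),
    [/\ injective i, runs_in_time M i p &
        forall w, L w <-> accepts M (map i w)].

Definition poly_time_computable (Sigma Sigma' : finType)
    (f : seq Sigma -> seq Sigma') : Prop :=
  exists (A : finType) (i : Sigma -> A) (o : Sigma' -> A) (M : machine A)
         (p : {poly nat}),
    [/\ injective i, injective o, deterministic M, runs_in_time M i p &
        forall w, exists k c,
          [/\ steps k (initial M (map i w)) c, halted c &
              output c = map o (f w)]].

Definition poly_reducible (Sigma Sigma' : finType)
    (L : language Sigma) (L' : language Sigma') : Prop :=
  exists2 f : seq Sigma -> seq Sigma',
    poly_time_computable f & forall w, L w <-> L' (f w).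

Definition NP_hard (Sigma : finType) (L : language Sigma) : Prop :=
  forall (Sigma' : finType) (L' : language Sigma'),
    NP L' -> poly_reducible L' L.

Definition NP_complete (Sigma : finType) (L : language Sigma) : Prop :=
  NP L /\ NP_hard L.

(* Main.v *)
(** Membership.  An interpretation is sampled at points in general position: a
    point for each failing equation and, for each term whose interior splits
    into two parts, points of both parts, a point outside the term, and points
    showing that every region with connected interior either leaves the term or
    meets only one of the parts.  Quadratically many points suffice.

    Conversely, a finite sample with these properties is realized by a variant
    of the lakes of Wada: disjoint connected open sets [U p], one for each
    sample point [p], such that every other point of the space is adherent
    either to all of them or exactly to those belonging to one of the regions
    required to be connected, the latter case occurring for every such region.
    A region of the second kind gets a connected interior, because all its [U p]
    meet at a point that is adherent to no other.  A region missing some sample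
    point is disconnected by any splitting of its sample points that splits no
    required region contained in it, because no other point of its interior
    joins the two parts.  A nondeterministic machine guesses the sample.

    Hardness.  A conjunction of equations is satisfiable over a nonempty space
    iff it is satisfiable in the two-element Boolean algebra, and the tableau of
    a nondeterministic computation can be written as such a conjunction.  Tape
    positions are taken relative to the heads, so that a cell depends only on
    the action performed and on three cells at the previous time.

    Polynomial-time functions are obtained from closure properties: programs act
    on serialized trees with four stacks, which are the tapes of a machine. *)

(* The domains come from subdividing the cubes of the integer lattice again and again into
   [(2n+1)^3] subcubes, [n] being the number of sample points. In each undecided cube, colour [p]
   receives axis-parallel lines through the [p]-th odd diagonal position. Dimension three is
   essential here: two such lines of different colours have a common transverse coordinate, in which
   they differ by at least two, so differently coloured cubes never touch; in the plane the lines
   would cross. A required region is realized by barring all other colours from one cube of the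
   initial lattice.

   On the machine side, membership in NP includes a time bound on every computation, whatever is
   guessed. Programs are therefore verified for all runs and for some run simultaneously, and
   guessing is confined to the Boolean leaves of a template tree, so that each guess is a genuine
   certificate to which the time bound of the verifier applies. *)
From Corelib Require Import PosDef.
From mathcomp Require Import all_boot all_order all_algebra.
From mathcomp Require Import all_classical all_reals all_analysis.
Import numFieldNormedType.Exports.
From mathcomp Require Import zify ring lra.
Require Import Defs.

Set Implicit Arguments.
Unset Strict Implicit.
Unset Printing Implicit Defensive.

(** * Nondeterministic programs on four stacks *)

Section Fragments.
Variable L : finType.
Notation sym := (option L).

(* [None] keeps a stack, [Some None] pops it, [Some (Some (true, a))] pushes
   [a] and [Some (Some (false, a))] replaces the top symbol by [a]. *)
Notation op := (option (option (bool * sym))).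

Definition quad (X : Type) : Type := (X * X * X * X)%type.

Definition proj4 X (s : quad X) (i : 'I_4) : X :=
  let: (a, b, c, d) := s in nth a [:: a; b; c; d] i.

Definition app_op (o : op) (s : seq sym) : seq sym :=
  match o with
  | None => s
  | Some None => behead s
  | Some (Some (true, a)) => a :: s
  | Some (Some (false, a)) => a :: behead s
  end.

Definition store := quad (seq sym).

Definition act (o : quad op) (s : store) : store :=
  let: (p0, p1, p2, p3) := o in let: (s0, s1, s2, s3) := s in
  (app_op p0 s0, app_op p1 s1, app_op p2 s2, app_op p3 s3).

Definition tops (s : store) : quad (option sym) :=
  let: (s0, s1, s2, s3) := s in (ohead s0, ohead s1, ohead s2, ohead s3).

(* A program fragment acting on four stacks; the Boolean argument of [delta] is
   a nondeterministic bit, and the next control state [None] is the exit. *)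
Record frag := Frag {
  ctrl : finType;
  entry : ctrl;
  delta : ctrl -> quad (option sym) -> bool -> quad op * option ctrl }.

Definition det (F : frag) : Prop :=
  forall (q : ctrl F) t, delta q t true = delta q t false.

(** Both readings of nondeterminism are kept in one predicate, so that every program is verified
    only once: the universal reading bounds all computations of the machine, the existential one
    produces a halting computation. *)
Definition qf (d : bool) (P : bool -> Prop) : Prop :=
  if d then forall b, P b else exists b, P b.

Lemma qf_mono d (P P' : bool -> Prop) :
  (forall b, P b -> P' b) -> qf d P -> qf d P'.
Proof. by case: d => /= h; [move=> H b; exact/h|case=> b /h; exists b]. Qed.

Lemma qf_const d (X : Prop) : X -> qf d (fun=> X).
Proof. by case: d => x //; exists true. Qed.

(* Within [n] steps all runs ([d = true]), or some run ([d = false]), from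
   control [q] and store [s] exit in a store satisfying [P]. *)
Fixpoint wp (F : frag) (d : bool) n (q : option (ctrl F)) (s : store)
    (P : store -> Prop) {struct n} : Prop :=
  if q is Some q0 then
    if n is n'.+1 then
      qf d (fun b => let r := delta q0 (tops s) b in wp d n' r.2 (act r.1 s) P)
    else False
  else P s.

Definition runs F d s n P := @wp F d n (Some (entry F)) s P.

Lemma wp_mono F d n m q s (P P' : store -> Prop) : n <= m ->
  (forall s', P s' -> P' s') -> @wp F d n q s P -> wp d m q s P'.
Proof.
move=> + PP'; elim: n m q s => [|n IH] [|m] [q|] s //= nm; try exact: PP'.
by apply: qf_mono => b; apply: IH.
Qed.

Lemma runs_le F d n m s P : n <= m -> @runs F d s n P -> runs F d s m P.
Proof. by move=> nm; apply: wp_mono. Qed.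

Lemma runs_weaken F d n s (P P' : store -> Prop) :
  (forall s', P s' -> P' s') -> @runs F d s n P -> runs F d s n P'.
Proof. by move=> PP'; apply: wp_mono. Qed.

Definition keep4 : quad op := (None, None, None, None).

Lemma act_keep4 s : act keep4 s = s.
Proof. by case: s => -[[]]. Qed.

Definition fdo (f : quad (option sym) -> bool -> quad op) : frag :=
  @Frag unit tt (fun _ t b => (f t b, None)).

Definition fseq (F G : frag) : frag :=
  @Frag (ctrl F + ctrl G)%type (inl (entry F)) (fun q t b =>
    match q with
    | inl q => let r := delta q t b in
        (r.1, Some (if r.2 is Some q' then inl q' else inr (entry G)))
    | inr q => let r := delta q t b in (r.1, omap inr r.2)
    end).

Definition fif (c : quad (option sym) -> bool) (F G : frag) : frag :=
  @Frag (option (ctrl F + ctrl G)) None (fun q t b =>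
    match q with
    | None => (keep4, Some (Some (if c t then inl (entry F)
                                 else inr (entry G))))
    | Some (inl q) => let r := delta q t b in (r.1, omap (Some \o inl) r.2)
    | Some (inr q) => let r := delta q t b in (r.1, omap (Some \o inr) r.2)
    end).

Definition fwhile (c : quad (option sym) -> bool) (F : frag) : frag :=
  @Frag (option (ctrl F)) None (fun q t b =>
    match q with
    | None => (keep4, if c t then Some (Some (entry F)) else None)
    | Some q => let r := delta q t b in (r.1, Some r.2)
    end).

Lemma det_do f : (forall t, f t true = f t false) -> det (fdo f).
Proof. by move=> h q t /=; rewrite h. Qed.

Lemma det_seq F G : det F -> det G -> det (fseq F G).
Proof. by move=> dF dG [q|q] t /=; rewrite ?dF ?dG. Qed.

Lemma det_if c F G : det F -> det G -> det (fif c F G).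
Proof. by move=> dF dG [[q|q]|] t //=; rewrite ?dF ?dG. Qed.

Lemma det_while c F : det F -> det (fwhile c F).
Proof. by move=> dF [q|] t //=; rewrite dF. Qed.

Lemma runs_do f d s P :
  qf d (fun b => P (act (f (tops s) b) s)) -> runs (fdo f) d s 1 P.
Proof. by []. Qed.

Lemma runs_seq F G d s n m P :
  runs F d s n (fun s' => runs G d s' m P) -> runs (fseq F G) d s (n + m) P.
Proof.
have lift k q s' : wp d k q s' P ->
    @wp (fseq F G) d k (omap inr q) s' P.
  elim: k q s' => [|k IH] [q|] s' //=.
  by apply: qf_mono => b; apply: IH.
have liftS k q s' : wp d k (Some q) s' P ->
    @wp (fseq F G) d k (Some (inr q)) s' P by exact: lift.
have key k q s' : wp d k q s' (fun s' => runs G d s' m P) ->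
    @wp (fseq F G) d (k + m)
      (Some (if q is Some q' then inl q' else inr (entry G))) s' P.
  elim: k q s' => [|k IH] [q|] s' //=.
  - exact: liftS.
  - by apply: qf_mono => b; apply: IH.
  - by move/liftS; apply: (@wp_mono _ d m (k.+1 + m)) => //; rewrite leq_addl.
exact: (key n (Some (entry F))).
Qed.

Lemma runs_if (c : quad (option sym) -> bool) F G d s n P :
  (if c (tops s) then runs F d s n P else runs G d s n P) ->
  runs (fif c F G) d s n.+1 P.
Proof.
have liftl k q s' : wp d k q s' P -> @wp (fif c F G) d k (omap (Some \o inl) q) s' P.
  by elim: k q s' => [|k IH] [q|] s' //=; apply: qf_mono => b; apply: IH.
have liftr k q s' : wp d k q s' P -> @wp (fif c F G) d k (omap (Some \o inr) q) s' P.
  by elim: k q s' => [|k IH] [q|] s' //=; apply: qf_mono => b; apply: IH.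
move=> H; change (qf d (fun=> @wp (fif c F G) d n (Some (Some (if c (tops s)
  then inl (entry F) else inr (entry G)))) (act keep4 s) P)).
rewrite act_keep4; apply: qf_const.
by case: ifP H => _ H; [apply: (liftl n (Some (entry F)))|apply: (liftr n (Some (entry G)))].
Qed.

Lemma runs_while0 (c : quad (option sym) -> bool) F d s P :
  c (tops s) = false -> P s -> runs (fwhile c F) d s 1 P.
Proof.
move=> cs Ps; change (qf d (fun=> @wp (fwhile c F) d 0 (if c (tops s)
  then Some (Some (entry F)) else None) (act keep4 s) P)).
by rewrite cs act_keep4; exact: qf_const.
Qed.

Lemma runs_while1 (c : quad (option sym) -> bool) F d s n m P :
  c (tops s) -> runs F d s n (fun s' => runs (fwhile c F) d s' m P) ->
  runs (fwhile c F) d s (n + m).+1 P.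
Proof.
have lift k q s' : wp d k q s' (fun s' => runs (fwhile c F) d s' m P) ->
    @wp (fwhile c F) d (k + m) (Some q) s' P.
  elim: k q s' => [|k IH] [q|] s' //.
    by apply: qf_mono => b; apply: IH.
  exact: (@runs_le (fwhile c F) d m (k.+1 + m) s' P (leq_addl _ _)).
move=> cs H; change (qf d (fun=> @wp (fwhile c F) d (n + m) (if c (tops s)
  then Some (Some (entry F)) else None) (act keep4 s) P)).
rewrite cs act_keep4; apply: qf_const; exact: (lift n (Some (entry F))).
Qed.

Lemma size_app_op o s : size (app_op o s) <= (size s).+1.
Proof. by case: o => [[[[] a]|]|] //=; rewrite size_behead; lia. Qed.

(** A step lengthens a stack by at most one symbol. Through this lemma a running time also bounds
    the size of the value computed. *)
Lemma wp_main_size F d n q s P : @wp F d n q s P ->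
  exists2 s', P s' & size s'.1.1.1 <= size s.1.1.1 + n.
Proof.
elim: n q s => [|n IH] [q|] s //=; try by exists s; rewrite ?addn0 ?leq_addr.
move=> H; have {H} [b H] : exists b, wp d n (delta q (tops s) b).2
    (act (delta q (tops s) b).1 s) P.
  by case: d H {IH} => [H|[b H]]; [exists true|exists b].
case/IH: H => s' Ps' le; exists s' => //; apply: leq_trans le _.
case: s => [[[s0 s1] s2] s3]; case: (delta _ _ _).1 => [[[p0 p1] p2] p3] /=.
by rewrite addnS -addSn leq_add2r size_app_op.
Qed.

(** * Simulation of the stacks by a machine with four tapes *)

Definition tm_cell (o : op) (a : option sym) : option sym * direction :=
  match o with
  | None => (a, Stay)
  | Some None => (None, Right)
  | Some (Some (true, _)) => (a, Left)
  | Some (Some (false, b)) => (Some b, Stay)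
  end.

Definition tm_push (o : op) (a : option sym) : option sym * direction :=
  (if o is Some (Some (true, b)) then Some b else a, Stay).

(* A pushing step takes two machine steps, the head being moved first and the
   symbol written afterwards.  The control [None] is entered from the exit when
   the main stack shows [acc]. *)
Definition tm_trans (F : frag) (acc : sym)
    (q : option (option (ctrl F) * option (quad op)))
    (t : {ffun 'I_4 -> option sym}) :
    {set option (option (ctrl F) * option (quad op)) *
         {ffun 'I_4 -> option sym * direction}} :=
  if q is Some q then
    if q.2 is Some o then
      finset.set1 (Some (q.1, None), [ffun i => tm_push (proj4 o i) (t i)])
    else if q.1 is Some q0 then
      [set (let r := delta q0
         (t (inord 0), t (inord 1), t (inord 2), t (inord 3)) b in
         (Some (r.2, Some r.1), [ffun i => tm_cell (proj4 r.1 i) (t i)]))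
       | b : bool]%SET
    else if t ord0 == Some acc then
      finset.set1 (None, [ffun i => (t i, Stay)]) else finset.set0
  else finset.set0.

Definition tm (F : frag) (acc : sym) : machine (option L) :=
  @Machine (option L) 3 (option (option (ctrl F) * option (quad op)))
    (Some (Some (entry F), None)) (pred1 None) (@tm_trans F acc).

(** The top of the stack is under the head and the rest lies to its right, followed by listed
    blanks. The cells on the left are unconstrained: a push overwrites the cell into which it
    moves. *)
Definition tape_rep (t : tape sym) (s : seq sym) : Prop :=
  exists k, thead t :: tright t = map Some s ++ nseq k None.

Lemma thead_rep t s : tape_rep t s -> thead t = ohead s.
Proof. by case: s => [|a s] [[|k]] //= [->]. Qed.

Lemma rep_app_op t s o : tape_rep t s ->
  let m := tm_cell o (thead t) in let t' := shift m.2 (write m.1 t) in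
  let m' := tm_push o (thead t') in
  tape_rep (shift m'.2 (write m'.1 t')) (app_op o s).
Proof.
case: t => l h r [k] /= E; case: o => [[[[] a]|]|] /=.
- by exists k; rewrite /= E.
- case: s E => [|b s]; last by case=> _ ->; exists k.
  by case: k => [|k] // [_ ->]; exists k.
- case: s E => [|b s]; last first.
    by case=> _ ->; case: s => [|c s]; [exists k.-1.+1|exists k]; case: k.
  by case: k => [|k] // [_ ->]; exists k.-1.+1; case: k.
- by exists k.
Qed.

Definition cfg_rep F acc (c : config (tm F acc)) q (s : store) : Prop :=
  c.1 = Some (q, None) /\ forall i : 'I_4, tape_rep (c.2 i) (proj4 s i).

Lemma proj4_act o s i : proj4 (act o s) i = app_op (proj4 o i) (proj4 s i).
Proof.
by case: o s => -[[p0 p1] p2] p3 [[[s0 s1] s2] s3]; case: i => -[|[|[|[|]]]].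
Qed.

Lemma tops_rep F acc (c : config (tm F acc)) q s : cfg_rep c q s ->
  (thead (c.2 (inord 0)), thead (c.2 (inord 1)), thead (c.2 (inord 2)),
   thead (c.2 (inord 3))) = tops s.
Proof.
case=> _ h; rewrite !(thead_rep (h _)).
by case: s {h} => -[[s0 s1] s2] s3; rewrite /proj4 !inordK.
Qed.

(** The nondeterministic bit is consumed in the first of the two machine steps; the second one only
    writes the pushed symbols and is forced. *)
Lemma tm_step2 F acc (c : config (tm F acc)) q s b : cfg_rep c (Some q) s ->
  let r := delta q (tops s) b in
  let c1 : config (tm F acc) := (Some (r.2, Some r.1), [ffun i =>
      let m := tm_cell (proj4 r.1 i) (thead (c.2 i)) in
      shift m.2 (write m.1 (c.2 i))]) in
  let c2 : config (tm F acc) := (Some (r.2, None), [ffun i =>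
      let m := tm_push (proj4 r.1 i) (thead (c1.2 i)) in
      shift m.2 (write m.1 (c1.2 i))]) in
  [/\ step c c1, forall c', step c1 c' <-> c' = c2 & cfg_rep c2 r.2 (act r.1 s)].
Proof.
move=> h r c1 c2; have [h1 h2] := h; have ht := tops_rep h; split.
- exists (Some (r.2, Some r.1), [ffun i => tm_cell (proj4 r.1 i) (thead (c.2 i))]).
    rewrite /enabled h1 /=; apply/imsetP; exists b => //=.
    rewrite !ffunE ht -/r; congr pair; apply/ffunP => i; by rewrite !ffunE.
  by rewrite /c1; congr pair; apply/ffunP => i; rewrite !ffunE.
- have E : enabled c1 = finset.set1 (Some (r.2, None),
      [ffun i => tm_push (proj4 r.1 i) (thead (c1.2 i))]).
    rewrite /enabled /=; congr (finset.set1 _); congr pair.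
    by apply/ffunP => i; rewrite !ffunE.
  move=> c'; split.
    case=> a; rewrite E inE => /eqP -> ->; rewrite /c2; congr pair.
    by apply/ffunP => i; rewrite !ffunE.
  move=> ->; exists (Some (r.2, None),
      [ffun i => tm_push (proj4 r.1 i) (thead (c1.2 i))]); first by rewrite E inE.
  by rewrite /c2; congr pair; apply/ffunP => i; rewrite !ffunE.
- split=> // i; rewrite proj4_act; have := rep_app_op (proj4 r.1 i) (h2 i).
  by rewrite /c2 /c1 /= !ffunE.
Qed.

Lemma step_inv F acc (c c1 : config (tm F acc)) q s : cfg_rep c (Some q) s ->
  step c c1 -> exists b, let r := delta q (tops s) b in
    c1 = (Some (r.2, Some r.1), [ffun i =>
      let m := tm_cell (proj4 r.1 i) (thead (c.2 i)) in
      shift m.2 (write m.1 (c.2 i))]).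
Proof.
move=> h [a]; have ht := tops_rep h; case: (h) => h1 h2.
rewrite /enabled h1 /= => /imsetP [b _ ->] ->; exists b => /=.
by rewrite !ffunE ht; congr pair; apply/ffunP => i; rewrite !ffunE.
Qed.

(** The verdict is read off the main stack after the exit: the machine makes one more step, into its
    accepting control, exactly when the top symbol is [acc]. *)
Lemma exit_cases F acc (c : config (tm F acc)) s : cfg_rep c None s ->
  let c1 : config (tm F acc) := (None, c.2) in
  halted c1 /\
  if ohead s.1.1.1 == Some acc then forall c', step c c' <-> c' = c1
  else halted c.
Proof.
move=> h c1; split; first by [].
have [h1 h2] := h.
have E : [ffun i => thead (c.2 i)] ord0 = ohead s.1.1.1 :> option sym.
  by rewrite ffunE (thead_rep (h2 _)); case: s {h h2} => -[[]].
have F' : [ffun i => shift ([ffun i => (thead (c.2 i), Stay)] i).2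
    (write ([ffun i => (thead (c.2 i), Stay)] i).1 (c.2 i))] = c.2.
  by apply/ffunP => i; rewrite !ffunE /=; case: (c.2 i).
have G : [ffun i => ([ffun i => thead (c.2 i)] i, Stay)] =
    [ffun i => (thead (c.2 i), Stay)] :> {ffun 'I_4 -> option sym * direction}.
  by apply/ffunP => i; rewrite !ffunE.
case: ifP => ha; last by rewrite /halted /enabled h1 /= E ha.
move=> c'; rewrite /step /enabled h1 /= E ha G; split.
  by case=> a; rewrite inE => /eqP -> ->; rewrite /= F'.
move=> ->; eexists; first by rewrite inE; apply/eqP; reflexivity.
by rewrite /= F'.
Qed.

(** The bound [n.*2.+1] counts two machine steps for each program step and the last one into the
    accepting control. *)
Lemma tm_demonic F acc n (c : config (tm F acc)) q s P :
  wp true n q s P -> cfg_rep c q s -> forall k c', steps k c c' ->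
  k <= n.*2.+1 /\ (halted c' -> accepting c'.1 ->
    exists2 s', P s' & ohead s'.1.1.1 = Some acc).
Proof.
have base c0 s0 : P s0 -> cfg_rep c0 None s0 -> forall k (c' : config (tm F acc)),
    steps k c0 c' -> k <= 1 /\ (halted c' -> accepting c'.1 ->
    exists2 s', P s' & ohead s'.1.1.1 = Some acc).
  move=> Ps h [|k] c' /=.
    by move<-; split=> // _; rewrite (h.1).
  have [h1] := exit_cases h; case: eqP => [ha h2|_ h2] [c1 st] H.
    split; last by exists s0.
    move/h2: st H => ->; case: k => // k [c2 [a]].
    by rewrite (h1 : enabled _ = _) inE.
  by case: st => a; rewrite (h2 : enabled _ = _) inE.
elim: n c q s => [|n IH] c [q|] s //.
- by move=> Ps h k c'; apply: base Ps h k c'.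
- move=> /= H h [|k] c' /=; first by move<-; split=> //; rewrite (h.1).
  case=> c1 st; have [b E] := step_inv h st.
  have [_ st2 h2] := tm_step2 b h; move: st2 h2; rewrite -E => st2 h2.
  case: k => [|k] /=; first by move<-; split=> //; rewrite E.
  case=> c2 /st2 -> /(IH _ _ _ (H b) h2) [le ac]; split=> //.
- move=> Ps h k c' /(base _ _ Ps h) [le ?]; split=> //.
  by apply: leq_trans le _.
Qed.

(** The conclusion records both the first tape and the verdict, to serve machines that compute
    functions as well as machines that decide. *)
Lemma tm_angelic F acc n (c : config (tm F acc)) q s P :
  wp false n q s P -> cfg_rep c q s -> exists k c' s',
  [/\ steps k c c', halted c', P s', tape_rep (c'.2 ord0) s'.1.1.1 &
      accepting c'.1 = (ohead s'.1.1.1 == Some acc)].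
Proof.
have base c0 s0 : P s0 -> cfg_rep c0 None s0 -> exists k (c' : config (tm F acc)) s',
    [/\ steps k c0 c', halted c', P s', tape_rep (c'.2 ord0) s'.1.1.1 &
      accepting c'.1 = (ohead s'.1.1.1 == Some acc)].
  move=> Ps h; have [h1] := exit_cases h; case: eqP => [ha h2|ha h2].
    exists 1, (None, c0.2), s0; split=> //; last by rewrite ha eqxx.
      by exists (None, c0.2) => //; apply/h2.
    by have := (h.2 ord0); case: (s0) => -[[]].
  exists 0, c0, s0; split=> //; last by rewrite (h.1) /=; apply/esym/eqP.
  by have := (h.2 ord0); case: (s0) => -[[]].
elim: n c q s => [|n IH] c [q|] s //.
- exact: base.
- case=> b H h; have [st1 st2 h2] := tm_step2 b h.
  have [k [c' [s' [stk hc Ps tr ac]]]] := IH _ _ _ H h2.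
  exists k.+2, c', s'; split=> //; eexists; first exact: st1.
  by eexists; first exact/st2.
- exact: base.
Qed.

Lemma initial_rep F acc (w : seq sym) :
  cfg_rep (initial (tm F acc) w) (Some (entry F)) (w, [::], [::], [::]).
Proof.
split=> // i; rewrite ffunE; case: eqP => [->|/eqP].
  by case: w => [|a w] /=; [exists 1|exists 0; rewrite cats0].
by case: i => -[|[|[|[|]]]] // *; exists 1.
Qed.

Lemma det_deterministic F acc : det F -> deterministic (tm F acc).
Proof.
move=> dF [[[q|] [p|]]|] t //=; rewrite ?cards1 ?cards0 //.
  apply: leq_trans (_ : #|finset.set1 _| <= _); last by rewrite cards1.
  apply/subset_leq_card/fintype.subsetP => x /imsetP [b _ ->]; rewrite inE.
  by apply/eqP; case: b => /=; [rewrite dF; reflexivity|reflexivity].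
by case: ifP; rewrite ?cards1 ?cards0.
Qed.

End Fragments.

(** * Computations on trees *)

(** The base [n.+2] is at least two even for [n = 0], so constants and sums can be absorbed into the
    exponent. *)
Definition pbounded (q : nat -> nat) : Prop := exists c, forall n, q n <= n.+2 ^ c.

Lemma leq_exp2rW m n c : m <= n -> m ^ c <= n ^ c.
Proof. by move=> mn; elim: c => // c IH; rewrite !expnS leq_mul. Qed.

Lemma pbounded_id : pbounded id.
Proof. by exists 1 => n; rewrite expn1; lia. Qed.

Lemma pbounded_const k : pbounded (fun=> k).
Proof.
exists k => n; apply: leq_trans (ltnW (ltn_expl k (isT : 1 < 2))) _.
by rewrite leq_exp2rW.
Qed.

Lemma pbounded_mul q r : pbounded q -> pbounded r -> pbounded (fun n => q n * r n).
Proof. by case=> c hc [e he]; exists (c + e) => n; rewrite expnD leq_mul. Qed.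

Lemma pbounded_add q r : pbounded q -> pbounded r -> pbounded (fun n => q n + r n).
Proof.
case=> c hc [e he]; exists (c + e).+1 => n.
have hC : n.+2 ^ c <= n.+2 ^ (c + e) by rewrite leq_pexp2l // leq_addr.
have hE : n.+2 ^ e <= n.+2 ^ (c + e) by rewrite leq_pexp2l // leq_addl.
rewrite expnS; have := hc n; have := he n; nia.
Qed.

(** As [q] need not be monotone, the composite is bounded at all arguments up to [r n] rather than
    at [r n] alone. *)
Lemma pbounded_comp q r : pbounded q -> pbounded r ->
  exists2 q', pbounded q' & forall n m, m <= r n -> q m <= q' n.
Proof.
(* From [m <= n.+2 ^ e] follows [m.+2 <= n.+2 ^ e.+2], whence the exponent. *)
case=> c hc [e he]; exists (fun n => n.+2 ^ (e.+2 * c)); first by eexists.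
move=> n m mr; apply: leq_trans (hc m) _; rewrite expnM leq_exp2rW //.
have : m <= n.+2 ^ e by apply: leq_trans (he n).
have : 0 < n.+2 ^ e by rewrite expn_gt0.
by rewrite !expnS; nia.
Qed.

Ltac pbd := repeat first [assumption | exact: pbounded_const | exact: pbounded_id |
  apply: pbounded_add | apply: pbounded_mul].

Section Trees.
Variable L : finType.
Notation sym := (option L).

Inductive tree : Type := Leaf of L | Node of tree & tree.

(** In this prefix code [None] marks an inner node. A serialized tree thus delimits itself and can
    be recognized on top of arbitrary further stack contents. *)
Fixpoint ser (x : tree) : seq sym :=
  match x with
  | Leaf l => [:: Some l]
  | Node a b => None :: ser a ++ ser b
  end.

Definition sz x := size (ser x).

Definition main (s : seq sym) : store L := (s, [::], [::], [::]).

(* [h] transforms the leaves under the control of the nondeterministic bits. *)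
Fixpoint qtree (d : bool) (h : bool -> L -> L) (x : tree) (K : tree -> Prop) : Prop :=
  match x with
  | Leaf l => qf d (fun b => K (Leaf (h b l)))
  | Node a b => qtree d h a (fun a' => qtree d h b (fun b' => K (Node a' b')))
  end.

Lemma qtree_mono d h x (K1 K2 : tree -> Prop) : (forall z, K1 z -> K2 z) ->
  qtree d h x K1 -> qtree d h x K2.
Proof.
elim: x K1 K2 => [l|x1 IH1 x2 IH2] K1 K2 KK /=.
  by apply: qf_mono => e; apply: KK.
by apply: IH1 => z1; apply: IH2 => z2; apply: KK.
Qed.

Lemma qtree_id d x (K : tree -> Prop) : K x -> qtree d (fun=> id) x K.
Proof.
elim: x K => [l|a IHa b IHb] K /= H; first exact: qf_const.
exact/IHa/IHb.
Qed.

(** The last stack counts, in [None] symbols, the trees still to be read: a leaf completes one, and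
    a node replaces one by two. When the count is exhausted, exactly the top tree has been moved, in
    reverse, to the second stack. *)
Definition ftake (h : bool -> L -> L) : frag L :=
  fseq (fdo (fun _ _ => (None, None, None, Some (Some (true, None)))))
    (fwhile (fun t => isSome t.2) (fdo (fun t b =>
      match t.1.1.1 with
      | Some None => (Some None, Some (Some (true, None)), None,
                      Some (Some (true, None)))
      | Some (Some l) => (Some None, Some (Some (true, Some (h b l))), None,
                      Some None)
      | None => (None, None, None, Some None)
      end))).

Lemma runs_take h d x S r1 r2 P :
  qtree d h x (fun x' => P (S, rev (ser x') ++ r1, r2, [::])) ->
  runs (ftake h) d (ser x ++ S, r1, r2, [::]) (2 * sz x + 2) P.
Proof.
rewrite /ftake; set W := fwhile _ _ => H.
have key y S' r1' c m : qtree d h y (fun y' => runs W d (S', rev (ser y') ++ r1', r2, c) m P) ->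
    runs W d (ser y ++ S', r1', r2, None :: c) (2 * sz y + m) P.
  elim: y S' r1' c m => [l|a IHa b IHb] S' r1' c m /= K.
    exact: (@runs_while1 _ _ _ _ _ 1 m).
  have -> : 2 * sz (Node a b) + m = (1 + (2 * sz a + (2 * sz b + m))).+1.
    by rewrite /sz /= size_cat; lia.
  rewrite -catA; apply: runs_while1 => //; apply: runs_do.
  apply: (@qf_mono d (fun=> runs W d (ser a ++ ser b ++ S', None :: r1', r2,
    None :: None :: c) (2 * sz a + (2 * sz b + m)) P)); first by [].
  apply: qf_const; apply: IHa; move: K.
  apply: qtree_mono => a' K; apply: IHb; move: K; apply: qtree_mono => b'.
  by rewrite rev_cons rev_cat cat_rcons -catA.
apply: (runs_le (n := 1 + (2 * sz x + 1))); first by lia.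
apply: runs_seq; apply: runs_do; apply: qf_const; apply: key.
by move: H; apply: qtree_mono => z' Pz; apply: runs_while0.
Qed.

Lemma det_take : det (ftake (fun=> id)).
Proof. by apply: det_seq; [exact: det_do|apply/det_while/det_do]. Qed.

(** * Rearranging trees on the stacks *)

Definition fmv (sel : quad (option sym) -> option sym)
    (f : sym -> quad (option (option (bool * sym)))) : frag L :=
  fwhile (fun t => isSome (sel t))
    (fdo (fun t _ => if sel t is Some a then f a else keep4 L)).

Lemma det_mv sel f : det (fmv sel f).
Proof. exact/det_while/det_do. Qed.

Notation psh a := (Some (Some (true, a))).
Notation pp := (Some None).

Definition mv10 := fmv (fun t => t.1.1.2) (fun a => (psh a, pp, None, None)).
Definition mv12 := fmv (fun t => t.1.1.2) (fun a => (None, pp, psh a, None)).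
Definition mv23 := fmv (fun t => t.1.2) (fun a => (None, None, pp, psh a)).
Definition mv30 := fmv (fun t => t.2) (fun a => (psh a, None, None, pp)).
Definition mv102 := fmv (fun t => t.1.1.2) (fun a => (psh a, pp, psh a, None)).
Definition clear1 := fmv (fun t => t.1.1.2) (fun a => (None, pp, None, None)).

Lemma runs_mv10 d r1 r0 r2 r3 n P : size r1 <= n -> P (rev r1 ++ r0, [::], r2, r3) ->
  runs mv10 d (r0, r1, r2, r3) (2 * n + 1) P.
Proof.
move=> rn H; apply: (runs_le (n := 2 * size r1 + 1)); first by lia.
elim: r1 r0 H {rn} => [|a r IH] r0 H; first exact: runs_while0.
rewrite /= mulnS -addnA; apply: (@runs_while1 _ _ _ _ _ 1) => //.
by apply/runs_do/qf_const; apply: IH; rewrite -?cat_rcons -?rev_cons.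
Qed.

Lemma runs_mv12 d r1 r0 r2 r3 n P : size r1 <= n -> P (r0, [::], rev r1 ++ r2, r3) ->
  runs mv12 d (r0, r1, r2, r3) (2 * n + 1) P.
Proof.
move=> rn H; apply: (runs_le (n := 2 * size r1 + 1)); first by lia.
elim: r1 r2 H {rn} => [|a r IH] r2 H; first exact: runs_while0.
rewrite /= mulnS -addnA; apply: (@runs_while1 _ _ _ _ _ 1) => //.
by apply/runs_do/qf_const; apply: IH; rewrite -?cat_rcons -?rev_cons.
Qed.

Lemma runs_mv23 d r1 r0 r2 r3 n P : size r2 <= n -> P (r0, r1, [::], rev r2 ++ r3) ->
  runs mv23 d (r0, r1, r2, r3) (2 * n + 1) P.
Proof.
move=> rn H; apply: (runs_le (n := 2 * size r2 + 1)); first by lia.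
elim: r2 r3 H {rn} => [|a r IH] r3 H; first exact: runs_while0.
rewrite /= mulnS -addnA; apply: (@runs_while1 _ _ _ _ _ 1) => //.
by apply/runs_do/qf_const; apply: IH; rewrite -?cat_rcons -?rev_cons.
Qed.

Lemma runs_mv30 d r1 r0 r2 r3 n P : size r3 <= n -> P (rev r3 ++ r0, r1, r2, [::]) ->
  runs mv30 d (r0, r1, r2, r3) (2 * n + 1) P.
Proof.
move=> rn H; apply: (runs_le (n := 2 * size r3 + 1)); first by lia.
elim: r3 r0 H {rn} => [|a r IH] r0 H; first exact: runs_while0.
rewrite /= mulnS -addnA; apply: (@runs_while1 _ _ _ _ _ 1) => //.
by apply/runs_do/qf_const; apply: IH; rewrite -?cat_rcons -?rev_cons.
Qed.

Lemma runs_mv102 d r1 r0 r2 r3 n P : size r1 <= n -> P (rev r1 ++ r0, [::], rev r1 ++ r2, r3) ->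
  runs mv102 d (r0, r1, r2, r3) (2 * n + 1) P.
Proof.
move=> rn H; apply: (runs_le (n := 2 * size r1 + 1)); first by lia.
elim: r1 r0 r2 H {rn} => [|a r IH] r0 r2 H; first exact: runs_while0.
rewrite /= mulnS -addnA; apply: (@runs_while1 _ _ _ _ _ 1) => //.
by apply/runs_do/qf_const; apply: IH; rewrite -?cat_rcons -?rev_cons.
Qed.

Lemma runs_clear1 d r1 r0 r2 r3 n P : size r1 <= n -> P (r0, [::], r2, r3) ->
  runs clear1 d (r0, r1, r2, r3) (2 * n + 1) P.
Proof.
move=> rn H; apply: (runs_le (n := 2 * size r1 + 1)); first by lia.
elim: r1  H {rn} => [|a r IH]  H; first exact: runs_while0.
rewrite /= mulnS -addnA; apply: (@runs_while1 _ _ _ _ _ 1) => //.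
by apply/runs_do/qf_const; apply: IH; rewrite -?cat_rcons -?rev_cons.
Qed.

Definition fpush (a : sym) : frag L := fdo (fun _ _ => (psh a, None, None, None)).
Definition fpop : frag L := fdo (fun _ _ => (pp, None, None, None)).
Definition fnop : frag L := fdo (fun _ _ => keep4 L).
Definition tk := ftake (fun=> id).
Definition fdup := fseq tk (fseq mv102 (fseq mv23 mv30)).
Definition fswap := fseq tk (fseq mv12 (fseq tk (fseq mv23 (fseq mv30 mv10)))).
Definition fdrop := fseq tk clear1.
Definition funder (a : sym) := fseq tk (fseq (fpush a) mv10).
Fixpoint fpushs (s : seq sym) : frag L :=
  if s is a :: s' then fseq (fpushs s') (fpush a) else fnop.

Lemma runs_push a d r0 P : P (main (a :: r0)) -> runs (fpush a) d (main r0) 1 P.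
Proof. by move=> H; apply/runs_do/qf_const. Qed.

Lemma runs_pop d r0 P : P (main (behead r0)) -> runs fpop d (main r0) 1 P.
Proof. by move=> H; apply/runs_do/qf_const. Qed.

Lemma runs_pushs s d r0 P : P (main (s ++ r0)) ->
  runs (fpushs s) d (main r0) (size s).+1 P.
Proof.
elim: s P => [|a s IH] P H; first by apply/runs_do/qf_const.
rewrite -addn1; apply: runs_seq; apply: IH; exact: runs_push.
Qed.

Lemma runs_tk d x S r1 r2 P : P (S, rev (ser x) ++ r1, r2, [::]) ->
  runs tk d (ser x ++ S, r1, r2, [::]) (2 * sz x + 2) P.
Proof. by move=> H; apply: runs_take; apply: qtree_id. Qed.

Lemma runs_dup d x S P : P (main (ser x ++ ser x ++ S)) ->
  runs fdup d (main (ser x ++ S)) (8 * sz x + 5) P.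
Proof.
move=> H; rewrite /fdup.
apply: (runs_le (n := (2 * sz x + 2) + ((2 * sz x + 1) + ((2 * sz x + 1) + (2 * sz x + 1)))));
  first by lia.
apply: runs_seq; apply: runs_tk; rewrite cats0.
apply: runs_seq; apply: runs_mv102; [by rewrite ?size_rev|rewrite revK cats0].
apply: runs_seq; apply: runs_mv23; [by rewrite ?size_rev|rewrite cats0].
by apply: runs_mv30; rewrite ?size_rev ?revK.
Qed.

Lemma runs_swap d x y S P : P (main (ser y ++ ser x ++ S)) ->
  runs fswap d (main (ser x ++ ser y ++ S)) (8 * sz x + 4 * sz y + 8) P.
Proof.
move=> H; rewrite /fswap.
apply: (runs_le (n := (2 * sz x + 2) + ((2 * sz x + 1) + ((2 * sz y + 2) +
  ((2 * sz x + 1) + ((2 * sz x + 1) + (2 * sz y + 1))))))); first by lia.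
apply: runs_seq; apply: runs_tk; rewrite cats0.
apply: runs_seq; apply: runs_mv12; [by rewrite ?size_rev|rewrite revK cats0].
apply: runs_seq; apply: runs_tk; rewrite cats0.
apply: runs_seq; apply: runs_mv23; [by rewrite ?size_rev|rewrite cats0].
apply: runs_seq; apply: runs_mv30; [by rewrite ?size_rev|rewrite revK].
by apply: runs_mv10; rewrite ?size_rev ?revK.
Qed.

Lemma runs_drop d x S P : P (main S) ->
  runs fdrop d (main (ser x ++ S)) (4 * sz x + 3) P.
Proof.
move=> H; apply: (runs_le (n := (2 * sz x + 2) + (2 * sz x + 1))); first by lia.
apply: runs_seq; apply: runs_tk; rewrite cats0 /sz.
by apply: runs_clear1; rewrite ?size_rev.
Qed.

Lemma runs_under a d x S P : P (main (ser x ++ a :: S)) ->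
  runs (funder a) d (main (ser x ++ S)) (4 * sz x + 4) P.
Proof.
move=> H; apply: (runs_le (n := (2 * sz x + 2) + (1 + (2 * sz x + 1)))); first by lia.
apply: runs_seq; apply: runs_tk; rewrite cats0.
apply: runs_seq; apply/runs_do/qf_const; apply: runs_mv10; first by rewrite ?size_rev.
by rewrite revK.
Qed.

Lemma det_push a : det (fpush a). Proof. exact: det_do. Qed.
Lemma det_pop : det fpop. Proof. exact: det_do. Qed.
Lemma det_dup : det fdup.
Proof. by repeat first [exact: det_mv|exact: det_take|apply: det_seq]. Qed.
Lemma det_swap : det fswap.
Proof. by repeat first [exact: det_mv|exact: det_take|apply: det_seq]. Qed.
Lemma det_drop : det fdrop.
Proof. by apply: det_seq; [exact: det_take|exact: det_mv]. Qed.
Lemma det_under a : det (funder a).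
Proof. by apply: det_seq; [exact: det_take|apply: det_seq; [exact: det_do|exact: det_mv]]. Qed.
Lemma det_pushs s : det (fpushs s).
Proof. by elim: s => [|a s IH]; [exact: det_do|apply: det_seq => //; exact: det_do]. Qed.

(** * Functions on trees computable in polynomial time *)

Ltac dets := repeat first [assumption | exact: det_push | exact: det_pop |
  exact: det_dup | exact: det_swap | exact: det_drop | exact: det_under |
  exact: det_pushs | apply: det_seq | apply: det_if | apply: det_while].

(** The remainder [S] of the main stack is arbitrary and survives the run, so that a program can be
    called while other data wait below its argument. *)
Definition ptime X Y (eX : X -> tree) (eY : Y -> tree) (f : X -> Y) : Prop :=
  exists F q, [/\ det F, pbounded q, {homo q : m n / m <= n} &
    forall d x S, runs F d (main (ser (eX x) ++ S)) (q (sz (eX x)))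
      (eq (main (ser (eY (f x)) ++ S)))].

Lemma ptimeI X Y (eX : X -> tree) (eY : Y -> tree) f F q : det F -> pbounded q ->
  (forall d x S P, P (main (ser (eY (f x)) ++ S)) ->
     runs F d (main (ser (eX x) ++ S)) (q (sz (eX x))) P) -> ptime eX eY f.
Proof.
move=> dF [c hc] H; exists F, (fun n => n.+2 ^ c); split=> //; first by exists c.
  by move=> m n mn; rewrite leq_exp2rW.
by move=> d x S; apply: (runs_le (hc _)); apply: H.
Qed.

(** The size bound on values, which compositions need, is extracted from the running time by letting
    the remainder of the stack be empty. *)
Lemma ptimeE X Y (eX : X -> tree) (eY : Y -> tree) f : ptime eX eY f ->
  exists F q, [/\ det F, pbounded q, {homo q : m n / m <= n},
    forall d x S P, P (main (ser (eY (f x)) ++ S)) ->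
      runs F d (main (ser (eX x) ++ S)) (q (sz (eX x))) P &
    forall x, sz (eY (f x)) <= sz (eX x) + q (sz (eX x))].
Proof.
case=> F [q [dF pq mq H]]; exists F, q; split=> // [d x S P HP|x].
  by apply: runs_weaken (H d x S) => s' <-.
have [s' <- /=] := wp_main_size (H true x [::]).
by rewrite !cats0.
Qed.

Lemma ptime_ext X Y (eX : X -> tree) (eY : Y -> tree) f g :
  f =1 g -> ptime eX eY f -> ptime eX eY g.
Proof. by move=> fg; have -> : g = f by apply/funext => x; rewrite fg. Qed.

Lemma ptime_idE X Y (eX : X -> tree) (eY : Y -> tree) f :
  (forall x, eY (f x) = eX x) -> ptime eX eY f.
Proof.
move=> E; apply: (@ptimeI _ _ _ _ _ fnop (fun=> 1)); first exact: det_do.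
  exact: pbounded_const.
by move=> d x S P; rewrite E => H; apply/runs_do/qf_const.
Qed.

Lemma ptime_comp X Y Z (eX : X -> tree) (eY : Y -> tree) (eZ : Z -> tree) f g :
  ptime eX eY f -> ptime eY eZ g -> ptime eX eZ (fun x => g (f x)).
Proof.
move=> /ptimeE [F [q [dF pq mq HF sF]]] /ptimeE [G [r [dG pr mr HG sG]]].
have [r' pr' hr'] := pbounded_comp pr (pbounded_add pbounded_id pq).
apply: (@ptimeI _ _ _ _ _ (fseq F G) (fun n => q n + r' n)).
- by dets.
- exact: pbounded_add.
- move=> d x S P H; apply: runs_seq; apply: HF.
  by apply: (runs_le (hr' _ _ (sF x))); apply: HG.
Qed.

Definition epair X Y (eX : X -> tree) (eY : Y -> tree) (p : X * Y) : tree :=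
  Node (eX p.1) (eY p.2).

(** The argument is duplicated and [g] is computed first: after the exchange, [f] turns the upper
    copy into the first component, and a node symbol on top completes the pair. *)
Lemma ptime_pair X Y Z (eX : X -> tree) (eY : Y -> tree) (eZ : Z -> tree) f g :
  ptime eX eY f -> ptime eX eZ g -> ptime eX (epair eY eZ) (fun x => (f x, g x)).
Proof.
move=> /ptimeE [F [q [dF pq mq HF sF]]] /ptimeE [G [r [dG pr mr HG sG]]].
apply: (@ptimeI _ _ _ _ _ (fseq fdup (fseq G (fseq fswap (fseq F (fpush None)))))
  (fun n => (8 * n + 5) + (r n + ((8 * (n + r n) + 4 * n + 8) + (q n + 1))))).
- by dets.
- pbd.
move=> d x S P H.
apply: runs_seq; apply: runs_dup.
apply: runs_seq; apply: HG.
apply: runs_seq; apply: (runs_le (n := 8 * sz (eZ (g x)) + 4 * sz (eX x) + 8)).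
  by have := sG x; lia.
apply: runs_swap; apply: runs_seq; apply: HF.
by apply: runs_push; move: H; rewrite /= -catA.
Qed.

Lemma ptime_fst X Y (eX : X -> tree) (eY : Y -> tree) : ptime (epair eX eY) eX fst.
Proof.
apply: (@ptimeI _ _ _ _ _ (fseq fpop (fseq fswap fdrop)) (fun n => 1 + ((12 * n + 8) + (4 * n + 3)))).
- by dets.
- pbd.
move=> d [x y] S P /= H; apply: runs_seq; apply: runs_pop => /=.
have E : sz (epair eX eY (x, y)) = (sz (eX x) + sz (eY y)).+1 by rewrite /sz /= size_cat.
rewrite -catA; apply: runs_seq; apply: (runs_le (n := 8 * sz (eX x) + 4 * sz (eY y) + 8)); first by lia.
by apply: runs_swap; apply: (runs_le (n := 4 * sz (eY y) + 3)); [lia|apply: runs_drop].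
Qed.

Lemma ptime_snd X Y (eX : X -> tree) (eY : Y -> tree) : ptime (epair eX eY) eY snd.
Proof.
apply: (@ptimeI _ _ _ _ _ (fseq fpop fdrop) (fun n => 1 + (4 * n + 3))).
- by dets.
- pbd.
move=> d [x y] S P /= H; apply: runs_seq; apply: runs_pop => /=.
have E : sz (epair eX eY (x, y)) = (sz (eX x) + sz (eY y)).+1 by rewrite /sz /= size_cat.
by rewrite -catA; apply: (runs_le (n := 4 * sz (eX x) + 3)); [lia|apply: runs_drop].
Qed.

Lemma ptime_const X Y (eX : X -> tree) (eY : Y -> tree) y : ptime eX eY (fun=> y).
Proof.
apply: (@ptimeI _ _ _ _ _ (fseq fdrop (fpushs (ser (eY y)))) (fun n => (4 * n + 3) + (sz (eY y)).+1)).
- by dets.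
- pbd.
by move=> d x S P H; apply: runs_seq; apply: runs_drop; apply: runs_pushs.
Qed.

Lemma ptime_leaf X Y (eX : X -> tree) (eY : Y -> tree) (f : X -> Y) (h : L -> L) :
  (forall x, exists2 l, eX x = Leaf l & eY (f x) = Leaf (h l)) -> ptime eX eY f.
Proof.
move=> H; apply: (@ptimeI _ _ _ _ _ (fdo (fun t _ =>
   if t.1.1.1 is Some (Some l) then (Some (Some (false, Some (h l))), None, None, None)
   else keep4 L)) (fun=> 1)); [exact: det_do|exact: pbounded_const|].
move=> d x S P; have [l -> ->] := H x => HP.
exact/runs_do/qf_const.
Qed.

Lemma ptime_branch X Y (eX : X -> tree) (eY : Y -> tree) Z (eZ : Z -> tree)
    (l : X -> Z) (c : option sym -> bool) (f : X -> Y) (F G : frag L) qF qG :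
  ptime eX eZ l -> det F -> det G -> pbounded qF -> pbounded qG ->
  {homo qF : m n / m <= n} -> {homo qG : m n / m <= n} ->
  (forall d x S P, P (main (ser (eY (f x)) ++ S)) ->
     let s := main (ser (eZ (l x)) ++ ser (eX x) ++ S) in
     let n := sz (eZ (l x)) + sz (eX x) in
     if c (ohead (ser (eZ (l x)))) then runs F d s (qF n) P else runs G d s (qG n) P) ->
  ptime eX eY f.
Proof.
move=> /ptimeE [K [q [dK pq mq HK sK]]] dF dG pF pG mF mG H.
have p2 : pbounded (fun n => (n + n) + q n).
  pbd.
have [qF' pF' hF'] := pbounded_comp pF p2.
have [qG' pG' hG'] := pbounded_comp pG p2.
apply: (@ptimeI _ _ _ _ _ (fseq fdup (fseq K (fif (fun t => c t.1.1.1) F G)))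
  (fun n => (8 * n + 5) + (q n + (1 + (qF' n + qG' n))))).
- by dets.
- pbd.
move=> d x S P HP; apply: runs_seq; apply: runs_dup; apply: runs_seq; apply: HK.
rewrite add1n; apply: runs_if.
have -> : (tops (main (ser (eZ (l x)) ++ ser (eX x) ++ S))).1.1.1 = ohead (ser (eZ (l x))).
  by case: (eZ (l x)).
have le : sz (eZ (l x)) + sz (eX x) <= (sz (eX x) + sz (eX x)) + q (sz (eX x)).
  by have := sK x; lia.
have := H d x S P HP; case: ifP => _; apply: runs_le.
  by apply: leq_trans (leq_addr _ _); apply: hF'.
by apply: leq_trans (leq_addl _ _); apply: hG'.
Qed.

Lemma ptime_ifb X Y (eX : X -> tree) (eY : Y -> tree) (eB : bool -> tree) lt lf b f g :
  eB true = Leaf lt -> eB false = Leaf lf -> lt != lf ->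
  ptime eX eB b -> ptime eX eY f -> ptime eX eY g ->
  ptime eX eY (fun x => if b x then f x else g x).
Proof.
move=> Et Ef ne Hb /ptimeE [F [q [dF pq mq HF sF]]] /ptimeE [G [r [dG pr mr HG sG]]].
apply: (@ptime_branch _ _ _ _ _ eB b (fun a => a == Some (Some lt)) _ (fseq fpop F) (fseq fpop G)
   (fun n => 1 + q n) (fun n => 1 + r n)) => //; try (by dets);
  try (by pbd);
  try (by move=> m n mn; rewrite leq_add2l; auto).
move=> d x S P H /=; case: (b x) H => H; rewrite ?Et ?Ef /= ?eqxx.
  apply: runs_seq; apply: runs_pop => /=.
  by apply: (runs_le (n := q (sz (eX x)))); [apply: mq; lia|apply: HF].
rewrite ifF; last by apply/negP => /eqP [E]; rewrite E eqxx in ne.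
apply: runs_seq; apply: runs_pop => /=.
by apply: (runs_le (n := r (sz (eX x)))); [apply: mr; lia|apply: HG].
Qed.

Fixpoint eseq (lnil : L) X (eX : X -> tree) (s : seq X) : tree :=
  if s is x :: s' then Node (eX x) (eseq lnil eX s') else Leaf lnil.

(** A nonempty list is serialized like the pair of its head and tail. With the list on top of [x],
    pushing a single node symbol yields the argument of [g]; this is why [g] takes its data in the
    shape [((z, l'), x)]. *)
Lemma ptime_listcase ln X Y Z (eX : X -> tree) (eY : Y -> tree) (eZ : Z -> tree)
   (l : X -> seq Z) (f : X -> Y) (g : (Z * seq Z) * X -> Y) :
  ptime eX (eseq ln eZ) l -> ptime eX eY f ->
  ptime (epair (epair eZ (eseq ln eZ)) eX) eY g ->
  ptime eX eY (fun x => if l x is z :: l' then g ((z, l'), x) else f x).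
Proof.
move=> Hl /ptimeE [F [q [dF pq mq HF sF]]] /ptimeE [G [r [dG pr mr HG sG]]].
apply: (@ptime_branch _ _ _ _ _ (eseq ln eZ) l (fun a => a == Some None) _
   (fseq (fpush None) G) (fseq fpop F) (fun n => 1 + r n.+1) (fun n => 1 + q n)) => //.
- by dets.
- by dets.
- apply: pbounded_add; first exact: pbounded_const.
  have [r' [c hc] hr'] := pbounded_comp pr (pbounded_add pbounded_id (pbounded_const 1)).
  by exists c => n; apply: leq_trans (hc n); apply: hr'; rewrite addn1.
- by pbd.
- by move=> m n mn; rewrite leq_add2l; apply: mr.
move=> d x S P H; move: H; case E: (l x) => [|z l'] H s n /=.
  rewrite /s /=; apply: runs_seq; apply: runs_pop => /=.
  by apply: (runs_le (n := q (sz (eX x)))); [apply: mq; rewrite /n; lia|apply: HF].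
rewrite /s; apply: runs_seq; apply: runs_push.
have -> : None :: ser (eseq ln eZ (z :: l')) ++ ser (eX x) ++ S =
  ser (epair (epair eZ (eseq ln eZ)) eX ((z, l'), x)) ++ S by rewrite /= -!catA.
apply: (runs_le (n := r (sz (epair (epair eZ (eseq ln eZ)) eX ((z, l'), x))))); last exact: HG.
by apply: mr; rewrite /n /sz /= !size_cat; lia.
Qed.

Lemma sz_gt0 x : 0 < sz x. Proof. by case: x. Qed.

Lemma eseq_size ln X (eX : X -> tree) s : size s < sz (eseq ln eX s).
Proof. by elim: s => [|x s IH] //=; rewrite /sz /= size_cat; move: IH (sz_gt0 (eX x)); rewrite /sz; lia. Qed.

(** Iterating a polynomial-time step can produce values of exponential size, so a polynomial bound
    on the accumulators has to be assumed. Being assumed for all lists, it applies to the prefixes,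
    that is, to every intermediate accumulator. *)
Lemma ptime_foldl ln Y S (eY : Y -> tree) (eS : S -> tree) (h : Y * S -> S) (B : nat -> nat) :
  pbounded B ->
  (forall s l, sz (eS (foldl (fun s y => h (y, s)) s l)) <= B (sz (eS s) + sz (eseq ln eY l))) ->
  ptime (epair eY eS) eS h ->
  ptime (epair eS (eseq ln eY)) eS (fun p => foldl (fun s y => h (y, s)) p.1 p.2).
Proof.
case=> c hB0 hB1 /ptimeE [H [q [dH pq mq HH sH]]].
pose C n := n.+2 ^ c.
have mC m n : m <= n -> C m <= C n by move=> mn; rewrite leq_exp2rW.
have hB s l : sz (eS (foldl (fun s y => h (y, s)) s l)) <= C (sz (eS s) + sz (eseq ln eY l)).
  by apply: leq_trans (hB0 _).
have pC : pbounded C by exists c.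
have [q' pq' hq'] := pbounded_comp pq (pbounded_add (pbounded_add pbounded_id pC) (pbounded_const 1)).
pose K n := 1 + ((12 * n + 8) + ((4 * n + 4) + ((8 * n + 4 * (n + C n + 1) + 8) + (q' n + (8 * C n + 4 * n + 8))))).
(* From top to bottom, the stack starts as the list [y :: l'] above the accumulator [s]. It becomes
   [y], [l'], [s], then [l'], [y], [s], then [l'], [(y, s)], then [(y, s)], [l'], and finally [l']
   above the new accumulator. *)
pose body := fseq fpop (fseq fswap (fseq (funder None) (fseq fswap (fseq H fswap)))).
pose W := fwhile (fun t => t.1.1.1 == Some None) body.
apply: (@ptimeI _ _ _ _ _ (fseq fpop (fseq fswap (fseq W fpop)))
  (fun n => 1 + ((12 * n + 8) + ((n * (K n).+1 + 1) + 1)))).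
- by rewrite /W /body; dets.
- have pK : pbounded (fun n => (K n).+1).
    have [e he] : pbounded (fun n => K n + 1).
      by rewrite /K; pbd.
    by exists e => n; rewrite -addn1.
  pbd.
move=> d [s l] T P /= HP; apply: runs_seq; apply: runs_pop => /=.
set n := sz _.
have En : n = (sz (eS s) + sz (eseq ln eY l)).+1 by rewrite /n /sz /= size_cat.
rewrite -catA; apply: runs_seq; apply: (runs_le (n := 8 * sz (eS s) + 4 * sz (eseq ln eY l) + 8)).
  by lia.
apply: runs_swap; apply: runs_seq.
have key l' s' m : sz (eseq ln eY l') <= n ->
    (forall k, sz (eS (foldl (fun s y => h (y, s)) s' (take k l'))) <= C n) ->
    forall P, P (main (Some ln :: ser (eS (foldl (fun s y => h (y, s)) s' l')) ++ T)) ->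
    size l' <= m ->
    runs W d (main (ser (eseq ln eY l') ++ ser (eS s') ++ T)) (m * (K n).+1 + 1) P.
  elim: l' s' m => [|y l' IH] s' m ln' Hk Q HQ lm.
    by apply: (runs_le (n := 1)); [lia|apply: runs_while0].
  case: m lm => // m lm.
  have -> : m.+1 * (K n).+1 + 1 = (K n + (m * (K n).+1 + 1)).+1 by rewrite mulSn; lia.
  have e1 : sz (eseq ln eY (y :: l')) = (sz (eY y) + sz (eseq ln eY l')).+1 by rewrite /sz /= size_cat.
  apply: runs_while1 => //; apply: runs_seq; apply: runs_pop; rewrite /behead /= -!catA.
  apply: runs_seq; apply: (runs_le (n := 8 * sz (eY y) + 4 * sz (eseq ln eY l') + 8)); first by lia.
  apply: runs_swap; apply: runs_seq.
  apply: (runs_le (n := 4 * sz (eseq ln eY l') + 4)); first by lia.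
  apply: runs_under.
  have e2 : sz (epair eY eS (y, s')) = (sz (eY y) + sz (eS s')).+1 by rewrite /sz /= size_cat.
  have e3 : sz (eS s') <= C n by have := Hk 0; rewrite take0.
  have -> : None :: ser (eY y) ++ ser (eS s') ++ T = ser (epair eY eS (y, s')) ++ T by rewrite /= catA.
  apply: runs_seq; apply: (runs_le (n := 8 * sz (eseq ln eY l') + 4 * sz (epair eY eS (y, s')) + 8)).
    by lia.
  apply: runs_swap; apply: runs_seq.
  apply: (runs_le (n := q (sz (epair eY eS (y, s'))))); first by apply: hq'; lia.
  apply: HH; have e4 : sz (eS (h (y, s'))) <= C n by have := Hk 1; rewrite /= take0.
  apply: (runs_le (n := 8 * sz (eS (h (y, s'))) + 4 * sz (eseq ln eY l') + 8)); first by lia.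
  apply: runs_swap; apply: IH => //; first by lia.
  by move=> k; have := Hk k.+1.
apply: key; [by lia| |by apply: runs_pop|by have := eseq_size ln eY l; lia].
move=> k; apply: leq_trans (hB _ _) _; apply: mC; rewrite En.
have tk_le l' k' : sz (eseq ln eY (take k' l')) <= sz (eseq ln eY l').
  elim: l' k' => [|y l' IH] [|k']; rewrite ?take0 //.
  by rewrite /sz /= !size_cat !ltnS leq_add2l; apply: IH.
by have := tk_le l k; lia.
Qed.

End Trees.

(** * Polynomial-time functions *)

Section Encodings.
Variable Sigma : finType.

(** Booleans have labels of their own, since these are the leaves that a guessing machine
    overwrites. *)
Definition lab : finType := ((unit + bool) + (Sigma + token))%type.
Definition nil_lab : lab := inl (inl tt).
Definition bool_lab (b : bool) : lab := inl (inr b).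

Class enc (X : Type) := toT : X -> tree lab.

#[global] Instance enc_unit : enc unit := fun _ => Leaf nil_lab.
#[global] Instance enc_bool : enc bool := fun b => Leaf (bool_lab b).
#[global] Instance enc_input : enc Sigma := fun a => Leaf (inr (inl a) : lab).
#[global] Instance enc_token : enc token := fun a => Leaf (inr (inr a) : lab).
#[global] Instance enc_pair X Y (eX : enc X) (eY : enc Y) : enc (X * Y) := epair eX eY.
#[global] Instance enc_seq X (eX : enc X) : enc (seq X) := eseq nil_lab eX.
(** Unary notation turns arithmetic into list operations; the numbers that occur are positions and
    lengths, polynomial in the input. *)
#[global] Instance enc_nat : enc nat := fun n => toT (nseq n tt).
(** Terms are stored as token strings, so that [encode_term] is the identity on trees. *)
#[global] Instance enc_term : enc term := fun t => toT (encode_term t).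

Definition esz X (eX : enc X) (x : X) := sz (toT x).

Definition ptm X Y (eX : enc X) (eY : enc Y) (f : X -> Y) : Prop := ptime eX eY f.

End Encodings.
Arguments ptm {Sigma X Y eX eY} f.
Arguments esz {Sigma X eX} x.
Arguments toT {Sigma X enc} x.

Section Closure.
Variable Sigma : finType.
Local Notation enc := (enc Sigma).
Local Notation ptm := (@ptm Sigma _ _ _ _).
Local Notation esz := (@esz Sigma _ _).

Lemma esz_seq X {eX : enc X} (x : X) s : esz (x :: s) = (esz x + esz s).+1.
Proof. by rewrite /esz /sz /= size_cat. Qed.

Lemma esz_nil X {eX : enc X} : esz ([::] : seq X) = 1. Proof. by []. Qed.

Lemma esz_pair X Y {eX : enc X} {eY : enc Y} (x : X) (y : Y) :
  esz (x, y) = (esz x + esz y).+1.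
Proof. by rewrite /esz /sz /= size_cat. Qed.

Lemma esz_size X {eX : enc X} (s : seq X) : size s < esz s.
Proof. exact: eseq_size. Qed.

Lemma esz_bool (b : bool) : esz b = 1. Proof. by []. Qed.

Section Basic.
Variables (X Y Z : Type) (eX : enc X) (eY : enc Y) (eZ : enc Z).

Lemma pt_id : ptm (fun x : X => x). Proof. exact: ptime_idE. Qed.
Lemma pt_const (y : Y) : ptm (fun _ : X => y). Proof. exact: ptime_const. Qed.
Lemma pt_comp (g : Y -> Z) (f : X -> Y) : ptm g -> ptm f -> ptm (fun x => g (f x)).
Proof. by move=> hg hf; apply: ptime_comp hf hg. Qed.
Lemma pt_pair (f : X -> Y) (g : X -> Z) : ptm f -> ptm g -> ptm (fun x => (f x, g x)).
Proof. exact: ptime_pair. Qed.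
Lemma pt_fst (f : X -> Y * Z) : ptm f -> ptm (fun x => (f x).1).
Proof. by move=> hf; apply: ptime_comp hf (ptime_fst eY eZ). Qed.
Lemma pt_snd (f : X -> Y * Z) : ptm f -> ptm (fun x => (f x).2).
Proof. by move=> hf; apply: ptime_comp hf (ptime_snd eY eZ). Qed.
Lemma pt_ext (f g : X -> Y) : f =1 g -> ptm f -> ptm g.
Proof. exact: ptime_ext. Qed.
Lemma pt_same (f : X -> Y) (g : X -> Z) : (forall x, toT (f x) = toT (g x)) -> ptm g -> ptm f.
Proof.
move=> E [F [q [dF pq mq H]]]; exists F, q; split=> // d x S.
by have := H d x S; rewrite -(E x : eY (f x) = eZ (g x)).
Qed.
Lemma pt_if b (f g : X -> Y) : ptm b -> ptm f -> ptm g -> ptm (fun x => if b x then f x else g x).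
Proof. exact: (@ptime_ifb _ _ _ _ _ _ (bool_lab Sigma true) (bool_lab Sigma false)). Qed.
End Basic.

(** A pair of an element and a list is the same tree as the extended list. *)
Lemma pt_cons X Y (eX : enc X) (eY : enc Y) (a : X -> Y) (l : X -> seq Y) :
  ptm a -> ptm l -> ptm (fun x => a x :: l x).
Proof.
move=> ha hl; apply: (pt_comp (g := fun p : Y * seq Y => p.1 :: p.2)
  (f := fun x => (a x, l x))); last exact: pt_pair.
exact: ptime_idE.
Qed.

Lemma pt_comp2 X Y Z W (eX : enc X) (eY : enc Y) (eZ : enc Z) (eW : enc W)
    (g : Y -> Z -> W) (a : X -> Y) (b : X -> Z) :
  ptm (fun p => g p.1 p.2) -> ptm a -> ptm b -> ptm (fun x => g (a x) (b x)).
Proof. by move=> hg ha hb; apply: (pt_comp (g := fun p => g p.1 p.2)) (pt_pair ha hb). Qed.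

Lemma pt_listcase X Y Z (eX : enc X) (eY : enc Y) (eZ : enc Z) (l : X -> seq Z)
    (f : X -> Y) (g : Z -> seq Z -> X -> Y) :
  ptm l -> ptm f -> ptm (fun p => g p.1.1 p.1.2 p.2) ->
  ptm (fun x => if l x is z :: l' then g z l' x else f x).
Proof. by move=> hl hf hg; apply: (ptime_listcase hl hf hg). Qed.

(** A function on a finite type of leaves is a finite cascade of tests, whatever its values. *)
Lemma pt_fin_gen (X : finType) Y (eX : enc X) (eY : enc Y) (lx : X -> lab Sigma) (h : X -> Y) :
  injective lx -> (forall x, toT x = Leaf (lx x)) -> ptm h.
Proof.
move=> inj hx; case E: (enum X) => [|x0 s].
  by apply: ptime_idE => x; have := mem_enum X x; rewrite E.
apply: (pt_ext (f := fun x => foldr (fun y r => if x == y then h y else r) (h x0) (enum X))).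
  move=> x; have : x \in enum X by rewrite mem_enum.
  elim: (enum X) => //= y l IH; rewrite inE; case: eqP => [->|_] //=.
elim: (enum X) => [|y l IH] /=; first exact: pt_const.
apply: pt_if => //; last exact: pt_const.
apply: (ptime_leaf (h := fun l => bool_lab Sigma (l == lx y))) => x.
by exists (lx x); [exact: hx|rewrite (inj_eq inj)].
Qed.

Lemma pt_bool Y (eY : enc Y) (h : bool -> Y) : ptm h.
Proof. by apply: (@pt_fin_gen _ _ _ _ (bool_lab Sigma)) => // a b []. Qed.

Lemma pt_input Y (eY : enc Y) (h : Sigma -> Y) : ptm h.
Proof. by apply: (@pt_fin_gen _ _ _ _ (fun a => inr (inl a) : lab Sigma)) => // a b []. Qed.

Lemma pt_token Y (eY : enc Y) (h : token -> Y) : ptm h.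
Proof. by apply: (@pt_fin_gen _ _ _ _ (fun a => inr (inr a) : lab Sigma)) => // a b []. Qed.

Lemma pt_negb X (eX : enc X) (f : X -> bool) : ptm f -> ptm (fun x => ~~ f x).
Proof. by move=> hf; apply: (pt_comp (g := negb)) hf; apply: pt_bool. Qed.
Lemma pt_andb X (eX : enc X) (f g : X -> bool) : ptm f -> ptm g -> ptm (fun x => f x && g x).
Proof. by move=> hf hg; apply: pt_if => //; apply: pt_const. Qed.
Lemma pt_orb X (eX : enc X) (f g : X -> bool) : ptm f -> ptm g -> ptm (fun x => f x || g x).
Proof. by move=> hf hg; apply: pt_if => //; apply: pt_const. Qed.
Lemma pt_implb X (eX : enc X) (f g : X -> bool) : ptm f -> ptm g -> ptm (fun x => f x ==> g x).
Proof. by move=> hf hg; apply: pt_if => //; apply: pt_const. Qed.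
Lemma pt_eqb X (eX : enc X) (f g : X -> bool) : ptm f -> ptm g -> ptm (fun x => f x == g x).
Proof.
move=> hf hg; apply: (pt_ext (f := fun x => if f x then g x else ~~ g x)).
  by move=> x; case: (f x) (g x) => [] [].
by apply: pt_if => //; apply: pt_negb.
Qed.

Lemma ptm_size X Y (eX : enc X) (eY : enc Y) (f : X -> Y) : ptm f ->
  exists q, [/\ pbounded q, {homo q : m n / m <= n} & forall x, esz (f x) <= q (esz x)].
Proof.
case/ptimeE=> F [q [_ pq mq _ sF]]; exists (fun n => n + q n); split.
- by pbd.
- by move=> m n mn; apply: leq_add => //; apply: mq.
- exact: sF.
Qed.

(** * Folds, and the list functions derived from them *)

Section Fold.
Variables (X Y S : Type) (eX : enc X) (eY : enc Y) (eS : enc S).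
Variable h : X -> Y -> S -> S.

(** The step of [ptime_foldl] sees only the item and the accumulator, so the parameter [x] travels
    inside the accumulator. *)
Lemma pt_foldl (i : X -> S) (l : X -> seq Y) (B : nat -> nat) :
  pbounded B -> {homo B : m n / m <= n} ->
  (forall x s l, esz (foldl (fun s y => h x y s) s l) <= B (esz x + esz s + esz l)) ->
  ptm (fun p : Y * (X * S) => h p.2.1 p.1 p.2.2) -> ptm i -> ptm l ->
  ptm (fun x => foldl (fun s y => h x y s) (i x) (l x)).
Proof.
move=> pB mB hB hh hi hl.
have E x s r : foldl (fun s y => (s.1, h s.1 y s.2)) (x, s) r =
    (x, foldl (fun s y => h x y s) s r) by elim: r s => //= y r IH s; rewrite IH.
apply: (pt_ext (f := fun x => (foldl (fun s y => (s.1, h s.1 y s.2)) (x, i x) (l x)).2)).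
  by move=> x; rewrite E.
apply: pt_snd; pose H := fun p : Y * (X * S) => (p.2.1, h p.2.1 p.1 p.2.2).
apply: (pt_comp (g := fun p : (X * S) * seq Y => foldl (fun s y => H (y, s)) p.1 p.2)
   (f := fun x => ((x, i x), l x))); last by do !apply: pt_pair => //; exact: pt_id.
apply: (@ptime_foldl _ _ _ _ _ _ H (fun n => n + B n + 1)); first by pbd.
  case=> x s r; rewrite /H E /=.
  have := hB x s r; have := esz_pair x s; have := esz_pair x (foldl (fun s y => h x y s) s r).
  move=> E1 E2; change (sz (enc_pair eX eS (x, s))) with (esz (x, s)).
  change (sz (enc_pair eX eS (x, foldl (fun s => (h x)^~ s) s r))) with
    (esz (x, foldl (fun s => (h x)^~ s) s r)).
  change (sz (eseq (nil_lab Sigma) eY r)) with (esz r); rewrite E1 E2.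
  have := mB (esz x + esz s + esz r) ((esz x + esz s).+1 + esz r) ltac:(lia); lia.
apply: pt_pair; last exact: hh.
by apply: pt_fst; apply: pt_snd; apply: pt_id.
Qed.

(** If each step adds an amount independent of the accumulator, the accumulators stay polynomial
    automatically. *)
Lemma pt_foldl_add (i : X -> S) (l : X -> seq Y) (r : nat -> nat) :
  pbounded r -> {homo r : m n / m <= n} ->
  (forall x y s, esz (h x y s) <= esz s + r (esz x + esz y)) ->
  ptm (fun p : Y * (X * S) => h p.2.1 p.1 p.2.2) -> ptm i -> ptm l ->
  ptm (fun x => foldl (fun s y => h x y s) (i x) (l x)).
Proof.
move=> pr mr hr; apply: (pt_foldl (B := fun n => n + n * r n)); first by pbd.
  by move=> m n mn; apply: leq_add => //; apply: leq_mul => //; apply: mr.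
move=> x s t; set n := esz x + esz s + esz t.
have key t' s' : esz t' <= esz t -> esz (foldl (fun s y => h x y s) s' t') <= esz s' + esz t' * r n.
  elim: t' s' => [|y t' IH] s' le /=; first by lia.
  move: le; rewrite esz_seq => le; apply: leq_trans (IH _ _) _; first by lia.
  have rn : r (esz x + esz y) <= r n by apply: mr; rewrite /n; lia.
  by have := hr x y s'; rewrite mulSn mulnDl; lia.
apply: leq_trans (key t s (leqnn _)) _; rewrite leq_add //; first by rewrite /n; lia.
by rewrite leq_mul2r; apply/orP; right; rewrite /n; lia.
Qed.
End Fold.

Lemma pt_rev X Y (eX : enc X) (eY : enc Y) (l : X -> seq Y) : ptm l -> ptm (fun x => rev (l x)).
Proof.
move=> hl; apply: (pt_ext (f := fun x => foldl (fun s y => y :: s) [::] (l x))).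
  by move=> x; rewrite /rev; elim: (l x) [::] => //=.
apply: (@pt_foldl_add _ _ _ _ _ _ (fun _ y s => y :: s) _ _ (fun n => n + 1)) => //; try by pbd.
- by move=> m n; lia.
- by move=> x y s; rewrite esz_seq; lia.
- by apply: pt_cons; [apply: pt_fst; apply: pt_id|apply: pt_snd; apply: pt_snd; apply: pt_id].
- exact: pt_const.
Qed.

Lemma pt_foldr X Y S (eX : enc X) (eY : enc Y) (eS : enc S) (h : X -> Y -> S -> S)
   (i : X -> S) (l : X -> seq Y) (r : nat -> nat) :
  pbounded r -> {homo r : m n / m <= n} ->
  (forall x y s, esz (h x y s) <= esz s + r (esz x + esz y)) ->
  ptm (fun p : Y * (X * S) => h p.2.1 p.1 p.2.2) -> ptm i -> ptm l ->
  ptm (fun x => foldr (fun y s => h x y s) (i x) (l x)).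
Proof.
move=> pr mr hr hh hi hl.
apply: (pt_ext (f := fun x => foldl (fun s y => h x y s) (i x) (rev (l x)))).
  by move=> x; rewrite foldl_rev.
by apply: (pt_foldl_add pr mr hr hh hi); apply: pt_rev.
Qed.

Lemma esz_cat X {eX : enc X} (s t : seq X) : esz (s ++ t) <= esz s + esz t.
Proof. by elim: s => [|x s IH]; rewrite ?cat0s ?cat_cons ?esz_seq ?leq_addl //; lia. Qed.

Lemma pt_cat X Y (eX : enc X) (eY : enc Y) (a b : X -> seq Y) : ptm a -> ptm b ->
  ptm (fun x => a x ++ b x).
Proof.
move=> ha hb; apply: (pt_ext (f := fun x => foldr (fun y s => y :: s) (b x) (a x))).
  by move=> x; elim: (a x) => //= y s ->.
apply: (@pt_foldr _ _ _ _ _ _ (fun _ y s => y :: s) _ _ (fun n => n + 1)) => //; try by pbd.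
- by move=> m n; lia.
- by move=> x y s; rewrite esz_seq; lia.
- by apply: pt_cons; [apply: pt_fst; apply: pt_id|apply: pt_snd; apply: pt_snd; apply: pt_id].
Qed.

Lemma pt_map X Y Z (eX : enc X) (eY : enc Y) (eZ : enc Z) (F : X -> Y -> Z) (l : X -> seq Y) :
  ptm (fun p => F p.1 p.2) -> ptm l -> ptm (fun x => [seq F x y | y <- l x]).
Proof.
move=> hF hl; have [q [pq mq sq]] := ptm_size hF.
apply: (pt_ext (f := fun x => foldr (fun y s => F x y :: s) [::] (l x))).
  by move=> x; elim: (l x) => //= y s ->.
apply: (@pt_foldr _ _ _ _ _ _ (fun x y s => F x y :: s) _ _ (fun n => q n.+1 + 1)) => //.
- have [q' [c hc] hq'] := pbounded_comp pq (pbounded_add pbounded_id (pbounded_const 1)).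
  apply: pbounded_add; last by pbd.
  by exists c => n; apply: leq_trans (hc n); apply: hq'; rewrite addn1.
- by move=> m n mn; rewrite leq_add2r; apply: mq.
- by move=> x y s; rewrite esz_seq; have := sq (x, y); rewrite esz_pair /=; lia.
- apply: pt_cons; last by apply: pt_snd; apply: pt_snd; apply: pt_id.
  apply: (pt_comp2 hF); last by apply: pt_fst; apply: pt_id.
  by apply: pt_fst; apply: pt_snd; apply: pt_id.
- exact: pt_const.
Qed.

Lemma pt_flatten X Y (eX : enc X) (eY : enc Y) (l : X -> seq (seq Y)) : ptm l ->
  ptm (fun x => flatten (l x)).
Proof.
move=> hl; rewrite /flatten.
apply: (@pt_foldr _ _ _ _ _ _ (fun _ y s => y ++ s) _ _ (fun n => n)) => //; try by pbd.
- by move=> x y s; apply: leq_trans (esz_cat _ _) _; lia.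
- by apply: pt_cat; [apply: pt_fst; apply: pt_id|apply: pt_snd; apply: pt_snd; apply: pt_id].
- exact: pt_const.
Qed.

Lemma pt_foldl_bool X Y (eX : enc X) (eY : enc Y) (h : X -> Y -> bool -> bool) (i : X -> bool) (l : X -> seq Y) :
  ptm (fun p : Y * (X * bool) => h p.2.1 p.1 p.2.2) -> ptm i -> ptm l ->
  ptm (fun x => foldl (fun s y => h x y s) (i x) (l x)).
Proof. by apply: (@pt_foldl_add _ _ _ _ _ _ h i l (fun=> 0)) => //; pbd. Qed.

Lemma pt_has X Y (eX : enc X) (eY : enc Y) (a : X -> Y -> bool) (l : X -> seq Y) :
  ptm (fun p => a p.1 p.2) -> ptm l -> ptm (fun x => has (a x) (l x)).
Proof.
move=> ha hl; apply: (pt_ext (f := fun x => foldl (fun b y => a x y || b) false (l x))).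
  move=> x; rewrite -[RHS]orbF; elim: (l x) false => //= y s IH b.
  by rewrite IH orbA [_ || a x y]orbC orbAC.
apply: (@pt_foldl_bool _ _ _ _ (fun x y b => a x y || b)) => //; last exact: pt_const.
apply: pt_orb; last by apply: pt_snd; apply: pt_snd; apply: pt_id.
apply: (pt_comp2 ha); last by apply: pt_fst; apply: pt_id.
by apply: pt_fst; apply: pt_snd; apply: pt_id.
Qed.

Lemma pt_all X Y (eX : enc X) (eY : enc Y) (a : X -> Y -> bool) (l : X -> seq Y) :
  ptm (fun p => a p.1 p.2) -> ptm l -> ptm (fun x => all (a x) (l x)).
Proof.
move=> ha hl; apply: (pt_ext (f := fun x => ~~ has (fun y => ~~ a x y) (l x))).
  by move=> x; rewrite has_predC negbK.
by apply: pt_negb; apply: (pt_has (a := fun x y => ~~ a x y)) => //; apply: pt_negb.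
Qed.

Lemma esz_nat n : esz n = n.*2.+1.
Proof.
elim: n => // n IH; have -> : esz n.+1 = esz (tt :: nseq n tt) by [].
rewrite esz_seq; have -> : esz (nseq n tt) = esz n by [].
by have -> : esz tt = 1 by []; rewrite IH; lia.
Qed.

Lemma pt_nseq X Y (eX : enc X) (eY : enc Y) (k : X -> nat) (y : X -> Y) : ptm k -> ptm y ->
  ptm (fun x => nseq (k x) (y x)).
Proof.
move=> hk hy; apply: (pt_ext (f := fun x => [seq y x | _ <- nseq (k x) tt])).
  by move=> x; rewrite map_nseq.
apply: (pt_map (F := fun x _ => y x)); first by apply: (pt_comp hy); apply: pt_fst; apply: pt_id.
exact: pt_same hk.
Qed.

Lemma pt_size X Y (eX : enc X) (eY : enc Y) (l : X -> seq Y) : ptm l -> ptm (fun x => size (l x)).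
Proof.
move=> hl; apply: (pt_same (g := fun x => [seq tt | _ <- l x])).
  by move=> x; rewrite /toT /enc_nat; congr (toT _); elim: (l x) => //= y s ->.
by apply: (pt_map (F := fun _ _ => tt)) => //; apply: pt_const.
Qed.

Lemma pt_addn X (eX : enc X) (a b : X -> nat) : ptm a -> ptm b -> ptm (fun x => a x + b x).
Proof.
move=> ha hb; apply: (pt_ext (f := fun x => size (nseq (a x) tt ++ nseq (b x) tt))).
  by move=> x; rewrite size_cat !size_nseq.
by apply: pt_size; apply: pt_cat; apply: pt_nseq => //; apply: pt_const.
Qed.

Lemma pt_muln X (eX : enc X) (a b : X -> nat) : ptm a -> ptm b -> ptm (fun x => a x * b x).
Proof.
move=> ha hb; apply: (pt_ext (f := fun x => size (flatten (nseq (a x) (nseq (b x) tt))))).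
  by move=> x; rewrite size_flatten /shape map_nseq size_nseq sumn_nseq mulnC.
by apply: pt_size; apply: pt_flatten; do !apply: pt_nseq => //; apply: pt_const.
Qed.

Lemma pt_succ X (eX : enc X) (a : X -> nat) : ptm a -> ptm (fun x => (a x).+1).
Proof.
move=> ha; apply: (pt_ext (f := fun x => a x + 1)); first by move=> x; rewrite addn1.
by apply: pt_addn => //; apply: pt_const.
Qed.

Lemma pt_iota X (eX : enc X) (m n : X -> nat) : ptm m -> ptm n -> ptm (fun x => iota (m x) (n x)).
Proof.
move=> hm hn; apply: (pt_ext (f := fun x => [seq m x + i | i <- iota 0 (n x)])).
  by move=> x; rewrite -iotaDl addn0.
apply: (pt_map (F := fun x i => m x + i)).
  by apply: pt_addn; [apply: (pt_comp hm); apply: pt_fst|apply: pt_snd]; apply: pt_id.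
have E k : rev (iota 0 k) = foldl (fun s (_ : unit) => size s :: s) [::] (nseq k tt).
  elim: k => // k IH; rewrite -addn1 iotaD rev_cat /= IH addn1.
  have -> : nseq k.+1 tt = nseq k tt ++ nseq 1 tt by rewrite -nseqD addn1.
  by rewrite foldl_cat /= -IH size_rev size_iota.
apply: (pt_ext (f := fun x => rev (foldl (fun s (_ : unit) => size s :: s) [::] (nseq (n x) tt)))).
  by move=> x; rewrite -E revK.
(* The item pushed grows with the accumulator, so additive growth fails. Instead, the length of the
   accumulator plus that of the remaining list is constant, and it bounds every item pushed. *)
apply: pt_rev; apply: (@pt_foldl _ _ _ _ _ _ (fun _ _ s => size s :: s) _ _
   (fun n => n + n * (4 * n + 4))); first by pbd.
- by move=> a b ab; apply: leq_add => //; apply: leq_mul => //; lia.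
- move=> x s l; set N := esz x + esz s + esz l.
  have ls : size s + size l <= N.
    have := @esz_size nat (enc_nat Sigma) s.
    by have := @esz_size unit (enc_unit Sigma) l; rewrite /N; lia.
  have key t s' : size s' + size t <= N ->
      esz (foldl (fun s (_ : unit) => size s :: s) s' t) <= esz s' + size t * (4 * N + 4).
    elim: t s' => [|y t IH] s' le /=; first by lia.
    apply: leq_trans (IH _ _) _; first by move: le => /=; lia.
    by rewrite esz_seq esz_nat; move: le => /=; nia.
  apply: leq_trans (key l s ls) _; apply: leq_add; first by rewrite /N; lia.
  by rewrite leq_mul2r; apply/orP; right; lia.
- by apply: pt_cons; [apply: pt_size|]; do 2!apply: pt_snd; apply: pt_id.
- exact: pt_const.
- by apply: pt_nseq => //; apply: pt_const.
Qed.

Lemma pt_behead X Y (eX : enc X) (eY : enc Y) (l : X -> seq Y) : ptm l -> ptm (fun x => behead (l x)).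
Proof.
move=> hl; apply: (pt_ext (f := fun x => if l x is y :: s then s else [::])); first by move=> x; case: (l x).
apply: (pt_listcase (g := fun _ s _ => s)) => //; first exact: pt_const.
by apply: pt_snd; apply: pt_fst; apply: pt_id.
Qed.

Lemma esz_behead X {eX : enc X} (s : seq X) : esz (behead s) <= esz s.
Proof. by case: s => // x s; rewrite esz_seq /=; lia. Qed.

Lemma pt_drop X Y (eX : enc X) (eY : enc Y) (k : X -> nat) (l : X -> seq Y) : ptm k -> ptm l ->
  ptm (fun x => drop (k x) (l x)).
Proof.
move=> hk hl; apply: (pt_ext (f := fun x => foldl (fun s (_ : unit) => behead s) (l x) (nseq (k x) tt))).
  by move=> x; elim: (k x) (l x) => [|n IH] [|y s] //=; rewrite ?drop0 ?IH //; elim: n {IH}.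
apply: (@pt_foldl_add _ _ _ _ _ _ (fun _ _ s => behead s) _ _ (fun=> 0)) => //; try by pbd.
- by move=> x y s; rewrite addn0; apply: esz_behead.
- by apply: pt_behead; do 2!apply: pt_snd; apply: pt_id.
Qed.

Lemma pt_nth X Y (eX : enc X) (eY : enc Y) (d : Y) (l : X -> seq Y) (k : X -> nat) : ptm l -> ptm k ->
  ptm (fun x => nth d (l x) (k x)).
Proof.
move=> hl hk; apply: (pt_ext (f := fun x => if drop (k x) (l x) is y :: _ then y else d)).
  by move=> x; elim: (k x) (l x) => [|n IH] [|y s] //=.
apply: (pt_listcase (g := fun y _ _ => y)); [exact: pt_drop|exact: pt_const|].
by do 2!apply: pt_fst; apply: pt_id.
Qed.

Lemma pt_eqbits X (eX : enc X) (a b : X -> seq bool) : ptm a -> ptm b -> ptm (fun x => a x == b x).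
Proof.
move=> ha hb.
(* The state holds the agreement so far and the unread rest of the second string. *)
pose st (y : bool) (s : bool * seq bool) := if s.2 is z :: r then (s.1 && (z == y), r) else (false, [::]).
apply: (pt_ext (f := fun x => (fun s => s.1 && (if s.2 is _ :: _ then false else true))
    (foldl (fun s y => st y s) (true, b x) (a x)))).
  move=> x; pose f (s : bool * seq bool) := s.1 && (if s.2 is _ :: _ then false else true).
  suff key s r c : f (foldl (fun s y => st y s) (c, r) s) = c && (s == r) by exact: (key (a x) (b x) true).
  elim: s r c => [|y s IH] [|z r] c; rewrite /= ?IH //= ?andbF //.
  by rewrite eqseq_cons andbA [y == z]eq_sym.
have h : ptm (fun x => foldl (fun s y => st y s) (true, b x) (a x)).
  apply: (@pt_foldl_add _ _ _ _ _ _ (fun _ y s => st y s) _ _ (fun=> 0)) => //; try by pbd.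
  - by move=> x y [c [|z r]]; rewrite /st /= !esz_pair ?esz_seq ?esz_bool; lia.
  - rewrite /st; apply: (pt_listcase (l := fun p : bool * (X * (bool * seq bool)) => p.2.2.2)
       (g := fun z r p => (p.2.2.1 && (z == p.1), r))).
    + by do 3!apply: pt_snd; apply: pt_id.
    + exact: pt_const.
    + apply: pt_pair; last by apply: pt_snd; apply: pt_fst; apply: pt_id.
      apply: pt_andb; first by apply: pt_fst; do 3!apply: pt_snd; apply: pt_id.
      by apply: pt_eqb; [do 2!apply: pt_fst|apply: pt_fst; apply: pt_snd]; apply: pt_id.
  - by apply: pt_pair => //; apply: pt_const.
apply: pt_andb; first exact: pt_fst h.
apply: (pt_listcase (g := fun _ _ _ => false)); [exact: pt_snd h|exact: pt_const|exact: pt_const].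
Qed.

End Closure.

(** * From programs to Turing machines *)

Section Machines.
Variable Sigma : finType.
Local Notation L := (lab Sigma).
Local Notation enc := (enc Sigma).
Local Notation ptm := (@ptm Sigma _ _ _ _).
Local Notation esz := (@esz Sigma _ _).
Notation psh a := (Some (Some (true, a))).
Notation pp := (Some None).

(** * Converting between words and serialized lists *)

Definition fdump01 : frag L := fmv (fun t => t.1.1.1) (fun a => (pp, psh a, None, None)).

Lemma runs_dump01 d r1 r0 r2 r3 n P : size r0 <= n -> P ([::], rev r0 ++ r1, r2, r3) ->
  runs fdump01 d (r0, r1, r2, r3) (2 * n + 1) P.
Proof.
move=> rn H; apply: (runs_le (n := 2 * size r0 + 1)); first by lia.
elim: r0 r1 H {rn} => [|a r IH] r1 H; first exact: runs_while0.
rewrite /= mulnS -addnA; apply: (@runs_while1 _ _ _ _ _ 1) => //.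
by apply/runs_do/qf_const; apply: IH; rewrite -?cat_rcons -?rev_cons.
Qed.

Definition fbuild : frag L := fwhile (fun t => isSome t.1.1.2)
  (fseq (fdo (fun t _ => if t.1.1.2 is Some a then (psh a, pp, None, None) else keep4 L))
    (fpush None)).

Definition finput : frag L := fseq fdump01 (fseq (fpush (Some (nil_lab Sigma))) fbuild).

Lemma runs_input X (lx : X -> L) (w : seq X) d P :
  P (main (ser (eseq (nil_lab Sigma) (fun x => Leaf (lx x)) w))) ->
  runs finput d (main [seq Some (lx x) | x <- w]) (5 * size w + 3) P.
Proof.
move=> H; apply: (runs_le (n := (2 * size w + 1) + (1 + (3 * size w + 1)))); first by lia.
apply: runs_seq; apply: runs_dump01; rewrite ?size_map //.
apply: runs_seq; apply/runs_do/qf_const; rewrite cats0.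
change ((Some (nil_lab Sigma)) :: [::]) with
  (ser (eseq (nil_lab Sigma) (fun x : X => Leaf (lx x)) [::])).
have key u v : P (main (ser (eseq (nil_lab Sigma) (fun x => Leaf (lx x)) (catrev u v)))) ->
    runs fbuild d (ser (eseq (nil_lab Sigma) (fun x => Leaf (lx x)) v),
      [seq Some (lx x) | x <- u], [::], [::]) (3 * size u + 1) P.
  elim: u v => [|x u IH] v H'; first exact: runs_while0.
  rewrite /= mulnS -addnA; apply: (@runs_while1 _ _ _ _ _ 2) => //.
  apply: (@runs_seq _ _ _ _ _ 1 1); apply/runs_do/qf_const.
  by apply/runs_do/qf_const; apply: (IH (x :: v)).
rewrite -map_rev -(size_rev w); apply: (key (rev w) [::]).
by rewrite -/(rev (rev w)) revK.
Qed.

Definition foutput : frag L := fseq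
  (fwhile (fun t => t.1.1.1 == Some None) (fseq (fpop L)
     (fdo (fun t _ => if t.1.1.1 is Some a then (pp, psh a, None, None) else keep4 L))))
  (fseq (fpop L) (mv10 L)).

Lemma runs_output X (lx : X -> L) (w : seq X) d P :
  P (main [seq Some (lx x) | x <- w]) ->
  runs foutput d (main (ser (eseq (nil_lab Sigma) (fun x => Leaf (lx x)) w)))
    (5 * size w + 3) P.
Proof.
move=> H; apply: (runs_le (n := (3 * size w + 1) + (1 + (2 * size w + 1)))); first by lia.
apply: runs_seq.
have key u v r Q : Q ([:: Some (nil_lab Sigma)], [seq Some (lx x) | x <- catrev u v], r, [::]) ->
    runs (fwhile (fun t => t.1.1.1 == Some None) (fseq (fpop L)
     (fdo (fun t _ => if t.1.1.1 is Some a then (pp, psh a, None, None) else keep4 L)))) d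
     (ser (eseq (nil_lab Sigma) (fun x => Leaf (lx x)) u), [seq Some (lx x) | x <- v], r, [::])
     (3 * size u + 1) Q.
  elim: u v => [|x u IH] v H'; first exact: runs_while0.
  rewrite /= mulnS -addnA; apply: (@runs_while1 _ _ _ _ _ 2) => //.
  apply: (@runs_seq _ _ _ _ _ 1 1); apply/runs_do/qf_const.
  by apply/runs_do/qf_const; apply: (IH (x :: v)).
apply: (key w [::]); apply: runs_seq; apply/runs_do/qf_const.
apply: runs_mv10; first by rewrite size_map size_rev.
by rewrite cats0 -map_rev -/(rev w) revK.
Qed.

Lemma det_input : det finput.
Proof. by do !apply: det_seq; first [exact: det_mv|exact: det_push|apply: det_while; apply: det_seq; exact: det_do]. Qed.

Lemma det_output : det foutput.
Proof.
apply: det_seq; first by apply: det_while; apply: det_seq; exact: det_do.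
by apply: det_seq; [exact: det_pop|exact: det_mv].
Qed.

Lemma eseq_leaf_size X (lx : X -> L) w :
  sz (eseq (nil_lab Sigma) (fun x => Leaf (lx x)) w) = (size w).*2.+1.
Proof. by elim: w => //= x w IH; rewrite /sz /= -/(sz _) IH; lia. Qed.

Lemma pbounded_time (q : nat -> nat) : pbounded q ->
  exists p : {poly nat}, forall n, (q n).*2.+1 <= p.[n]%R.
Proof.
move=> pq; have [c hc] : pbounded (fun n => 2 * q n + 1) by pbd.
exists (('X + (2%N : nat)%:P) ^+ c)%R => n; rewrite horner_exp hornerD hornerX hornerC.
have -> : (n + (2%N : nat))%R = n.+2 by exact: addn2.
have -> : ((n.+2 : nat) ^+ c)%R = n.+2 ^ c by elim: c {hc} => // c IH; rewrite GRing.exprS expnS IH.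
by apply: leq_trans (hc n); lia.
Qed.

Lemma ptm_computable (f : seq Sigma -> seq token) : ptm f -> poly_time_computable f.
Proof.
case/ptimeE => F [q [dF pq mq HF sF]].
pose G := fseq finput (fseq F foutput).
pose acc : option L := None.
pose i (a : Sigma) : option L := Some (inr (inl a)).
pose o (a : token) : option L := Some (inr (inr a)).
have pq2 : pbounded (fun n => n * 2 + 1) by pbd.
have [q' pq' hq'] := pbounded_comp pq pq2.
have sw (w : seq Sigma) : sz (enc_seq (@enc_input Sigma) w) = (size w).*2.+1.
  exact: (eseq_leaf_size (fun a => inr (inl a) : L) w).
have [q3 pq3 hq3] := pbounded_comp (q := fun n => n) pbounded_id (pbounded_add pq2 pq').
pose N n := (5 * n + 3) + (q' n + (5 * q3 n + 3)).
have run d w P : P (main [seq o x | x <- f w]) -> runs G d (main (map i w)) (N (size w)) P.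
  move=> H; apply: runs_seq.
  apply: (@runs_input _ (fun a => inr (inl a) : L)); apply: runs_seq.
  apply: (runs_le (n := q (sz (enc_seq (@enc_input Sigma) w)))).
    by apply: hq'; rewrite sw; lia.
  have := HF d w [::] (fun s => runs foutput d s (5 * q3 (size w) + 3) P).
  rewrite !cats0; apply.
  apply: (runs_le (n := 5 * size (f w) + 3)).
    have := sF w; rewrite sw (eseq_leaf_size (fun a => inr (inr a) : L) (f w) : sz (enc_seq (enc_token Sigma) (f w)) = _) => le.
    have le2 : q (size w).*2.+1 <= q' (size w) by apply: hq'; lia.
    have h3 : size (f w) <= q3 (size w).
      by apply: hq3; move: le le2; set b := size w; set a := size (f w); set c := q _; lia.
    by rewrite leq_add2r leq_mul2l h3 orbT.
  exact: (@runs_output _ (fun a => inr (inr a) : L)).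
have pN : pbounded N by pbd.
have [p hp] := pbounded_time pN.
exists (option L), i, o, (tm G acc), p; split.
- by move=> a b [].
- by move=> a b [].
- apply: det_deterministic; apply: det_seq; first exact: det_input.
  by apply: det_seq => //; exact: det_output.
- move=> w k c st; have [le _] := tm_demonic (run true w xpredT isT) (initial_rep _ _ _) st.
  exact: leq_trans le (hp _).
- move=> w.
  have [k [c [s [st hc Ps tr _]]]] := tm_angelic (run false w (eq (main [seq o x | x <- f w])) erefl)
    (initial_rep G acc _).
  exists k, c; split=> //; move: tr; rewrite /output -Ps /word_of_tape => -[m ->] /=.
  by elim: (f w) => [|a l IH] /=; [case: m|rewrite IH].
Qed.

(** * Guessing the Boolean leaves of a template *)

Fixpoint variant (x y : tree L) : Prop :=
  match x, y with
  | Leaf (inl (inr _)), Leaf (inl (inr _)) => True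
  | Leaf l, Leaf l' => l = l'
  | Node a b, Node a' b' => variant a a' /\ variant b b'
  | _, _ => False
  end.

Definition flip (b : bool) (l : L) : L := if l is inl (inr _) then bool_lab Sigma b else l.

Lemma qtree_demonic x (K : tree L -> Prop) :
  (forall y, variant x y -> K y) -> qtree true flip x K.
Proof.
elim: x K => [[[u|b]|l]|a IHa b IHb] K H /=.
- by move=> e; apply: H.
- by move=> e; apply: H.
- by move=> e; apply: H.
- by apply: IHa => a' va; apply: IHb => b' vb; apply: H.
Qed.

Lemma qtree_angelic x y (K : tree L -> Prop) :
  variant x y -> K y -> qtree false flip x K.
Proof.
elim: x y K => [[[u|b]|l]|a IHa b IHb] [l'|a' b'] K //=; try by move=> <- ?; exists true.
- by case: l' => [[|e]|] // _ ?; exists e.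
- by case=> va vb Ky; apply: (IHa a' _ va); apply: (IHb b' _ vb).
Qed.

(** A certificate is any variant of the template [T w]. The template fixes its shape and size in
    advance, and the closure hypothesis makes every variant the code of some [c : C], so the
    verifier meets its specification on every guess, as the time bound on all computations
    demands. *)
Lemma ptm_NP (A : language token) (C : Type) (eC : enc C) (T : seq token -> C)
    (V : C * seq token -> bool) :
  ptm T -> ptm V ->
  (forall w t, variant (toT (T w)) t -> exists c : C, t = toT c) ->
  (forall w, A w <-> exists2 c : C, variant (toT (T w)) (toT c) & V (c, w)) ->
  NP A.
Proof.
move=> hT hV clos HA.
have hT2 : ptm (fun w : seq token => (T w, w)) by apply: pt_pair => //; exact: pt_id.
case/ptimeE: hT2 => F [q [dF pq mq HF sF]].
case/ptimeE: hV => G [r [dG pr mr HG sG]].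
pose i (a : token) : option L := Some (inr (inr a)).
pose acc : option L := Some (bool_lab Sigma true).
(* [F] leaves the pair of template and word. Its node symbol is removed, the template is guessed
   while being moved away and back, and the symbol is restored for the verifier [G], which leaves
   its Boolean answer on top. *)
pose M := fseq finput (fseq F (fseq (fpop L) (fseq (ftake flip) (fseq (mv10 L) (fseq (fpush None) G))))).
have sw (w : seq token) : sz (enc_seq (enc_token Sigma) w) = (size w).*2.+1.
  exact: (eseq_leaf_size (fun a => inr (inr a) : L) w).
have pq2 : pbounded (fun n => n * 2 + 1) by pbd.
have [q' pq' hq'] := pbounded_comp pq pq2.
pose B n := (n * 2 + 1) + q' n.
have pB : pbounded B by pbd.
have [r' pr' hr'] := pbounded_comp pr pB.
pose N n := (5 * n + 3) + (q' n + (1 + ((2 * B n + 2) + ((2 * B n + 1) + (1 + r' n))))).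
have pN : pbounded N by pbd.
have vsz x y : variant x y -> sz x = sz y.
  elim: x y => [l|a IHa b IHb] [l'|a' b'] //=; first by case: l => [[]|].
  by case=> /IHa ea /IHb eb; rewrite /sz /= !size_cat -!/(sz _) ea eb.
have run d w (P : store L -> Prop) :
    qtree d flip (toT (T w)) (fun t => variant (toT (T w)) t /\ exists2 c : C, t = toT c &
      P (main (ser (toT (V (c, w)))))) ->
    runs M d (main (map i w)) (N (size w)) P.
  move=> H; apply: runs_seq.
  apply: (@runs_input _ (fun a => inr (inr a) : L)); apply: runs_seq.
  have qw : q (sz (enc_seq (enc_token Sigma) w)) <= q' (size w) by apply: hq'; rewrite sw; lia.
  apply: (runs_le qw).
  have := HF d w [::] (fun s => runs _ d s _ P); rewrite !cats0; apply.
  apply: runs_seq; apply: runs_pop; rewrite [behead _]/=.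
  have sT : sz (enc_pair eC (enc_seq (enc_token Sigma)) (T w, w)) =
     (sz (toT (T w)) + sz (enc_seq (enc_token Sigma) w)).+1 by rewrite /sz /= size_cat.
  have le1 : sz (enc_pair eC (enc_seq (enc_token Sigma)) (T w, w)) <= B (size w).
    by have := sF w; rewrite sw /B; move: qw; rewrite sw; lia.
  apply: runs_seq; apply: (runs_le (n := 2 * sz (toT (T w)) + 2)); first by lia.
  apply: runs_take; move: H; apply: qtree_mono => t [vt [c tc HP]]; rewrite !cats0.
  apply: runs_seq; apply: runs_mv10.
    by rewrite size_rev -/(sz _) -(vsz _ _ vt); lia.
  rewrite revK; apply: runs_seq; apply: runs_push.
  have sc : sz (enc_pair eC (enc_seq (enc_token Sigma)) (c, w)) =
      sz (enc_pair eC (enc_seq (enc_token Sigma)) (T w, w)).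
    by rewrite sT /sz /= size_cat -!/(sz _) (vsz _ _ vt) tc.
  apply: (runs_le (n := r (sz (enc_pair eC (enc_seq (enc_token Sigma)) (c, w))))).
    by apply: hr'; rewrite sc.
  have := HG d (c, w) [::] P; rewrite !cats0 => HG'.
  by rewrite tc; apply: HG'.
have [p hp] := pbounded_time pN.
exists (option L), i, (tm M acc), p; split.
- by move=> a b [].
- move=> w k c st; have H : runs M true (main (map i w)) (N (size w)) xpredT.
    apply: run; apply: qtree_demonic => y vy; split=> //.
    by have [e ->] := clos _ _ vy; exists e.
  have [le _] := tm_demonic H (initial_rep _ _ _) st.
  exact: leq_trans le (hp _).
- move=> w; rewrite HA; split.
    case=> c vc Vc; have H : runs M false (main (map i w)) (N (size w)) (eq (main [:: acc])).
      by apply: run; apply: (qtree_angelic vc); split=> //; exists c => //; rewrite Vc.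
    have [k [e [s [st hc Ps _ ac]]]] := tm_angelic H (initial_rep M acc _).
    by exists k, e; split=> //; rewrite ac -Ps /=.
  case=> k [e [st hc ac]].
  have H : runs M true (main (map i w)) (N (size w)) (fun s => exists2 c : C,
      variant (toT (T w)) (toT c) & s = main (ser (toT (V (c, w))))).
    apply: run; apply: qtree_demonic => y vy; split=> //.
    by have [c E] := clos _ _ vy; exists c => //; exists c => //; rewrite -E.
  have [_ /(_ hc ac) [s [c vc ->]]] := tm_demonic H (initial_rep _ _ _) st.
  by move=> /= -[Vc]; exists c.
Qed.

End Machines.

(** * Sampling an interpretation at finitely many points *)

Section Sampling.

Local Open Scope classical_set_scope.

Fixpoint bev (v : nat -> bool) (t : term) : bool :=
  match t with
  | Var i => v i
  | Zero => false
  | One => true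
  | Add t1 t2 => bev v t1 || bev v t2
  | Mul t1 t2 => bev v t1 && bev v t2
  | Opp t1 => ~~ bev v t1
  end.

Fixpoint tbound (t : term) : nat :=
  match t with
  | Var i => i.+1
  | Zero | One => 0
  | Add t1 t2 | Mul t1 t2 => maxn (tbound t1) (tbound t2)
  | Opp t1 => tbound t1
  end.

Fixpoint atoms (phi : formula) : seq formula :=
  match phi with
  | Equal _ _ | IntConn _ => [:: phi]
  | And f1 f2 => atoms f1 ++ atoms f2
  | Not f1 => atoms f1
  end.

Fixpoint feval (c : formula -> bool) (phi : formula) : bool :=
  match phi with
  | Equal _ _ | IntConn _ => c phi
  | And f1 f2 => feval c f1 && feval c f2
  | Not f1 => ~~ feval c f1
  end.

Definition isconn (a : formula) : bool := if a is IntConn _ then true else false.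

Definition abound (a : formula) : nat :=
  match a with
  | Equal t u => maxn (tbound t) (tbound u)
  | IntConn t => tbound t
  | _ => 0
  end.

(* A sample point: the truth values of the variables at a generic point of the
   space, and the side of the splitting of the [k]-th atom on which it lies. *)
Definition point := ((nat -> bool) * (nat -> bool))%type.

Definition aval (p : point) (a : formula) : bool :=
  match a with
  | Equal t u => bev p.1 t == bev p.1 u
  | IntConn t => bev p.1 t
  | _ => false
  end.

Definition anth (A : seq formula) k := nth (Equal Zero Zero) A k.

(** A connectedness atom with [g k] true is subject to no condition of its own. It acts through the
    last clause of the failing ones: a connected region contained in a disconnected one cannot be
    cut by the splitting of the latter. *)
Definition good (A : seq formula) (P : seq point) (g : nat -> bool) : Prop :=
  forall k, k < size A -> let a := anth A k in
  if isconn a then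
    g k \/ [/\ has (fun p => aval p a && p.2 k) P, has (fun p => aval p a && ~~ p.2 k) P,
      has (fun p => ~~ aval p a) P &
      forall i, i < size A -> isconn (anth A i) -> g i ->
        [\/ has (fun p => aval p (anth A i) && ~~ aval p a) P,
            all (fun p => aval p (anth A i) ==> p.2 k) P |
            all (fun p => aval p (anth A i) ==> ~~ p.2 k) P]]
  else g k = all (fun p => aval p a) P.

Lemma atoms_atomic phi k : k < size (atoms phi) ->
  (exists t u, anth (atoms phi) k = Equal t u) \/ (exists t, anth (atoms phi) k = IntConn t).
Proof.
rewrite /anth; elim: phi k => [t u|t|f IHf f' IHf'|f IHf] k //=.
- by case: k => // _; left; exists t, u.
- by case: k => // _; right; exists t.
- rewrite size_cat nth_cat; case: (ltnP k (size (atoms f))) => [lt _|le lt]; first exact: IHf.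
  by apply: IHf'; lia.
- exact: IHf.
Qed.

Lemma models_feval (T : topologicalType) (I : interpretation T) phi (c : formula -> bool) :
  (forall k, k < size (atoms phi) -> models I (anth (atoms phi) k) <-> c (anth (atoms phi) k)) ->
  models I phi <-> feval c phi.
Proof.
rewrite /anth; elim: phi => [t u|t|f IHf f' IHf'|f IHf] H /=.
- exact: (H 0).
- exact: (H 0).
- have [h1 h2] : (models I f <-> feval c f) /\ (models I f' <-> feval c f').
    split; [apply: IHf => k lt|apply: IHf' => k lt].
      by have := H k; rewrite /= size_cat nth_cat lt => /(_ ltac:(lia)).
    have E : (size (atoms f) + k < size (atoms f)) = false by lia.
    by have := H (size (atoms f) + k); rewrite /= size_cat nth_cat E addKn ltn_add2l; apply.
  by rewrite h1 h2; split=> [[-> ->]|/andP].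
- have -> := IHf H; split=> [/negP|/negP]; done.
Qed.

(** * Generic points of an interpretation *)

Section Generic.
Variables (T : topologicalType) (I : interpretation T).

Lemma regular_closure (O : set T) : open O -> regular_closed (closure O).
Proof. by move=> oO; apply/esym/closure_open_regclosed. Qed.

Lemma eval_regular t : regular_closed (eval I t).
Proof.
elim: t => [v|||t1 IH1 t2 IH2|t1 IH1 t2 IH2|t1 IH1] /=.
- exact: val_varP.
- by rewrite /regular_closed interior0 closure0.
- by rewrite /regular_closed interiorT closureT.
- rewrite /regular_closed /rc_add; apply/seteqP; split.
    rewrite {1}IH1 {1}IH2 -closureU; apply: closureS.
    by move=> z [] h; apply: interiorS h => y ?; [left|right].
  have cl : closed (eval I t1 `|` eval I t2).
    by apply: closedU; [rewrite IH1|rewrite IH2]; exact: closed_closure.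
  rewrite [X in _ `<=` X](closure_id _).1 //; apply: closureS; exact: interior_subset.
- by apply: regular_closure; exact: open_interior.
- apply: regular_closure; apply: closed_openC; rewrite IH1; exact: closed_closure.
Qed.

Lemma eval_closed t : closed (eval I t).
Proof. by rewrite eval_regular; exact: closed_closure. Qed.

Definition generic N (z : T) : Prop := forall v, v < N -> (I v)° z \/ ~ I v z.

Lemma open_in_closure (O : set T) z : open O -> O z -> (closure O)° z.
Proof.
move=> oO Oz; apply: (@interiorS _ O); first exact: subset_closure.
by rewrite /interior; apply: open_nbhs_nbhs; split.
Qed.

Lemma genericP N z t : generic N z -> tbound t <= N ->
  if bev (fun v => `[< I v z >]) t then (eval I t)° z else ~ eval I t z.
Proof.
move=> G; elim: t => [v|||t1 IH1 t2 IH2|t1 IH1 t2 IH2|t1 IH1] /=.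
- move=> vN; case: asboolP => [h|//]; by case: (G v vN).
- by move=> _ [].
- by move=> _; rewrite interiorT.
- rewrite geq_max => /andP [/IH1 {}IH1 /IH2 {}IH2].
  case: (bev _ t1) IH1 => /= h1; first by apply: interiorS h1 => y; left.
  case: (bev _ t2) IH2 => /= h2; first by apply: interiorS h2 => y; right.
  by case.
- rewrite geq_max => /andP [/IH1 {}IH1 /IH2 {}IH2].
  have sub : rc_mul (eval I t1) (eval I t2) `<=` eval I t1 `&` eval I t2.
    rewrite [X in _ `<=` X](closure_id _).1.
      by apply: closureS; exact: interior_subset.
    by apply: closedI; exact: eval_closed.
  case: (bev _ t1) IH1 => /= h1; last by move=> /sub [].
  case: (bev _ t2) IH2 => /= h2; last by move=> /sub [].
  by apply: open_in_closure; [exact: open_interior|rewrite interiorI].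
- move=> /IH1 {}IH1; case: (bev _ t1) IH1 => /= h1.
    by rewrite /rc_opp closure_setC => /(_ h1).
  by apply: open_in_closure => //; apply: closed_openC; exact: eval_closed.
Qed.

(** The boundary of a closed set is nowhere dense: for each variable in turn, the open set is shrunk
    into its interior or, if they are disjoint, out of it. *)
Lemma generic_exists N (O : set T) : open O -> O !=set0 -> exists2 z, O z & generic N z.
Proof.
move=> oO O0; have [W [oW [z Wz] sW g]] : exists W : set T, [/\ open W, W !=set0, W `<=` O &
    forall z, W z -> generic N z]; last by exists z; [exact: sW|exact: g].
elim: N => [|N [W [oW W0 sW g]]]; first by exists O; split=> //.
have [h|h] := pselect (W `&` (I N)° !=set0).
  exists (W `&` (I N)°); split=> //; first by apply: openI => //; exact: open_interior.
    by move=> z [/sW].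
  move=> z [Oz Iz] v; rewrite ltnS leq_eqVlt => /orP [/eqP ->|]; first by left.
  exact: g.
exists (W `\` I N); split.
- by apply: openI => //; apply: closed_openC; rewrite (val_varP I N); exact: closed_closure.
- apply: contrapT => H; apply: h; case: W0 => z Oz; exists z; split=> //.
  rewrite interiorEbigcup; exists W => //; split=> // y Oy.
  by apply: contrapT => Iy; apply: H; exists y.
- by move=> z [/sW].
- move=> z [Oz Iz] v; rewrite ltnS leq_eqVlt => /orP [/eqP ->|]; first by right.
  exact: g.
Qed.

End Generic.

(** * The sample of a given interpretation *)

Section Sample.
Variables (T : topologicalType) (I : interpretation T) (phi : formula).
Hypothesis cT : connected [set: T].
Hypothesis t0 : T.

Let A := atoms phi.
Let n := size A.
Let N := foldr maxn 0 (map abound A).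
Let cterm k := if anth A k is IntConn t then t else Zero.

Let abound_le k : k < n -> abound (anth A k) <= N.
Proof.
rewrite /n /N /anth; elim: A k => [|a s IH] [|k] //= lt; first exact: leq_maxl.
exact: leq_trans (IH _ lt) (leq_maxr _ _).
Qed.

(** A code names the open set from which a sample point is drawn. Codes 1 and 2 are the two
    differences of an equation, or the two parts of a disconnected interior; 3 is the outside of a
    term; 4 is the part of the [i]-th interior outside the [k]-th term. Code 0 keeps the sample
    nonempty. The number of codes depends only on that of the atoms, as the template of the verifier
    requires. *)
Let codes : seq (nat * nat * nat) :=
  (0, 0, 0) :: [seq (1, k, 0) | k <- iota 0 n] ++ [seq (2, k, 0) | k <- iota 0 n] ++
  [seq (3, k, 0) | k <- iota 0 n] ++ [seq (4, i, k) | i <- iota 0 n, k <- iota 0 n].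

Lemma sample : exists P : seq point, size P = n * n + 3 * n + 1 /\
  good A P (fun k => `[< models I (anth A k) >]).
Proof.
have exE k : exists E : set T, isconn (anth A k) -> ~ models I (anth A k) ->
    let O := (eval I (cterm k))° in
    [/\ open E, E `<=` O, open (O `\` E), E !=set0 & (O `\` E) !=set0].
  rewrite /cterm; case: (anth A k) => [t u|t|f f'|f]; try by exists set0.
  case: (pselect (connected (eval I t)°)) => [c|nc]; first by exists set0 => _ /=.
  exists ((fun b => if pselect (exists E : bool -> set T, [/\ forall b, E b !=set0,
    (eval I t)° = E false `|` E true & separated (E false) (E true)]) is left h then
    projT1 (cid h) b else set0) true) => _ _.
  move/connectedPn: (nc) => h; case: pselect => // {}h; case: cid => /= E [E0 EU sE].
  have [s1 s2] := sE; have oO : open (eval I t)° by exact: open_interior.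
  (* Both halves of a separation of an open set are open, each being the part of it outside the
     closure of the other. *)
  have e1 : E true = (eval I t)° `\` closure (E false).
    apply/seteqP; split=> [z Ez|z []].
      by split; [rewrite EU; right|move=> cz; have : (closure (E false) `&` E true) z by []; rewrite s1].
    by rewrite EU => -[|//] Ez []; exact: subset_closure.
  have e2 : (eval I t)° `\` E true = (eval I t)° `\` closure (E true).
    apply/seteqP; split=> z [Oz nE]; split=> //.
      move=> cz; have Ef : E false z by move: Oz; rewrite EU => -[].
      by have : (E false `&` closure (E true)) z by []; rewrite s2.
    by move=> Ez; apply: nE; exact: subset_closure.
  split=> //.
  - by rewrite e1; apply: openI => //; apply: closed_openC; exact: closed_closure.
  - by rewrite EU => z; right.
  - by rewrite e2; apply: openI => //; apply: closed_openC; exact: closed_closure.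
  - have [z Ez] := E0 false; exists z; split; first by rewrite EU; left.
    by move=> Et; have : (E false `&` closure (E true)) z by [split=> //; exact: subset_closure]; rewrite s2.
have [E hE] := choice exE.
have exz (O : set T) : exists z, open O -> generic I N z /\ (O !=set0 -> O z).
  have [ne|ne] := pselect (O !=set0).
    have [op|nO] := pselect (open O); last by exists t0.
    by have [z Oz gz] := @generic_exists _ I N O op ne; exists z.
  by have [z _ gz] := @generic_exists _ I N setT openT (ex_intro _ t0 Logic.I); exists z.
have [pk hpk] := choice exz.
pose lab (z : T) : point := (fun v => `[< I v z >], fun k => `[< E k z >]).
pose Oc (c : nat * nat * nat) : set T :=
  match c with
  | (1, k, _) => if anth A k is Equal t u then (eval I t)° `\` eval I u else E k
  | (2, k, _) => if anth A k is Equal t u then (eval I u)° `\` eval I t else (eval I (cterm k))° `\` E k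
  | (3, k, _) => ~` eval I (cterm k)
  | (4, i, k) => (eval I (cterm i))° `\` eval I (cterm k)
  | _ => setT
  end.
(* Where no splitting exists, [E k] is an arbitrary set and [Oc c] may fail to be open; the whole
   space then replaces it, so that every sample point is generic. *)
pose Pz c := pk (if pselect (open (Oc c)) is left _ then Oc c else setT).
have gz c : generic I N (Pz c).
  rewrite /Pz; case: pselect => [h|_]; first by case: (hpk _ h).
  by case: (hpk _ openT).
have inz c : open (Oc c) -> Oc c !=set0 -> Oc c (Pz c).
  by move=> oc c0; rewrite /Pz; case: pselect => // h; case: (hpk _ h) => _; apply.
exists [seq lab (Pz c) | c <- codes]; split.
  by rewrite size_map /= !size_cat !size_map size_allpairs size_iota; lia.
have avalT k t : k < n -> anth A k = IntConn t -> cterm k = t by rewrite /cterm => _ ->.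
have avI k z : k < n -> isconn (anth A k) -> generic I N z ->
    if aval (lab z) (anth A k) then (eval I (cterm k))° z else ~ eval I (cterm k) z.
  move=> kn; have := abound_le kn; rewrite /cterm; case: (anth A k) => // t tN _ g.
  exact: genericP g tN.
have opE t u : open ((eval I t)° `\` eval I u).
  by apply: openI; [exact: open_interior|apply: closed_openC; exact: eval_closed].
have inc a k i : (a, i, k) \in codes -> forall Q : pred point, Q (lab (Pz (a, i, k))) ->
    has Q [seq lab (Pz c) | c <- codes].
  by move=> h Q q; rewrite has_map; apply/hasP; exists (a, i, k).
have inm (a k : nat) : k < n -> (a, k, 0) \in [seq (a, k, 0) | k <- iota 0 n].
  by move=> kn; apply/mapP; exists k; rewrite ?mem_iota.
have in1 k : k < n -> (1, k, 0) \in codes by move=> /(inm 1) h; rewrite inE !mem_cat h !orbT.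
have in2 k : k < n -> (2, k, 0) \in codes by move=> /(inm 2) h; rewrite inE !mem_cat h !orbT.
have in3 k : k < n -> (3, k, 0) \in codes by move=> /(inm 3) h; rewrite inE !mem_cat h !orbT.
have in4 i k : i < n -> k < n -> (4, i, k) \in codes.
  move=> i_n kn; rewrite inE !mem_cat; do ![apply/orP; right].
  by apply/allpairsP; exists (i, k); rewrite !mem_iota.
clearbody codes; move=> k kn a; have [[t [u Ea]]|[t Ea]] := atoms_atomic kn; rewrite -/A in Ea; rewrite /a Ea /=.
  have := abound_le kn; rewrite Ea /= geq_max => /andP [tN uN].
  rewrite all_map; apply/asboolP/allP => /= [Etu c _|H].
    have := genericP (gz c) tN; have := genericP (gz c) uN; rewrite Etu.
    by case: (bev _ u); case: (bev _ t) => // h1 h2; [case: h2; exact: interior_subset|case: h1; exact: interior_subset].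
  (* If a regular closed set is not contained in another, its interior already leaves the other, and
     the sample point drawn there distinguishes the two terms. *)
  have half c x y : (c \in codes) -> Oc c = (eval I x)° `\` eval I y -> tbound x <= N -> tbound y <= N ->
      (bev (lab (Pz c)).1 x == bev (lab (Pz c)).1 y) -> eval I x `<=` eval I y.
    move=> cc Ec xN yN eqb; apply: contrapT => ns.
    have c0 : Oc c !=set0.
      apply: contrapT => e0; apply: ns; rewrite (eval_regular I x) [X in _ `<=` X](eval_regular I y).
      apply: closureS => z xz; rewrite interiorEbigcup; exists (eval I x)° => //; split; first exact: open_interior.
      by move=> y' xy'; apply: contrapT => ny; apply: e0; exists y'; rewrite Ec.
    have := inz c; rewrite Ec => /(_ (opE _ _)); rewrite -Ec => /(_ c0); rewrite Ec => -[xz nyz].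
    have := genericP (gz c) xN; have := genericP (gz c) yN; move: eqb => /= /eqP ->.
    case: (bev _ y) => h1 h2; first by apply: nyz; exact: interior_subset.
    by apply: h2; exact: interior_subset.
  apply/seteqP; split.
    by apply: (half (1, k, 0)) => //; [exact: in1|rewrite /= Ea|exact: H (in1 k kn)].
  apply: (half (2, k, 0)) => //; [exact: in2|by rewrite /= Ea|].
  by rewrite eq_sym; exact: H (in2 k kn).
have ck : isconn (anth A k) by rewrite Ea.
have Et : cterm k = t := avalT k t kn Ea.
case: asboolP => [|nc]; [by left|right].
have nm : ~ models I (anth A k) by rewrite Ea.
have [oE sE oE' E0 E0'] := hE k ck nm; rewrite /= Et in sE oE' E0'.
have bt c : if bev (lab (Pz c)).1 t then (eval I t)° (Pz c) else ~ eval I t (Pz c).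
  by have := avI k _ kn ck (gz c); rewrite Et Ea.
split.
- apply: (inc 1 0 k (in1 k kn)) => /=.
  have := inz (1, k, 0); rewrite /= Ea => /(_ oE E0) Ez; rewrite (asboolT Ez) andbT.
  by have := bt (1, k, 0); case: (bev _ t) => // h; case: h; apply: interior_subset; exact: sE.
- apply: (inc 2 0 k (in2 k kn)) => /=.
  have := inz (2, k, 0); rewrite /= Ea Et => /(_ oE' E0') [Oz nEz]; rewrite (asboolF nEz) andbT.
  by have := bt (2, k, 0); case: (bev _ t) => // h; case: h; exact: interior_subset.
- apply: (inc 3 0 k (in3 k kn)) => /=.
  have o3 : open (~` eval I t) by apply: closed_openC; exact: eval_closed.
  (* Connectedness of the space enters here: a term equal to the whole space would have connected
     interior. *)
  have n3 : ~` eval I t !=set0.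
    apply: contrapT => e0; apply: nc; rewrite (_ : eval I t = setT) ?interiorT //.
    by apply/seteqP; split=> // z _; apply: contrapT => nz; apply: e0; exists z.
  have := inz (3, k, 0); rewrite /= Et => /(_ o3 n3) nz.
  by have := bt (3, k, 0); case: (bev _ t) => // h; case: nz; exact: interior_subset.
- move=> i i_n ci /asboolP mi.
  have [[x [y Ei]]|[x Ei]] := atoms_atomic i_n; rewrite -/A in Ei; first by rewrite Ei in ci.
  have Ex : cterm i = x := avalT i x i_n Ei.
  have bx c : if aval (lab (Pz c)) (anth A i) then (eval I x)° (Pz c) else ~ eval I x (Pz c).
    by have := avI i _ i_n ci (gz c); rewrite Ex.
  have [ne4|ne4] := pselect (Oc (4, i, k) !=set0).
    apply: Or31; apply: (inc 4 k i (in4 i k i_n kn)) => /=.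
    have := inz (4, i, k); rewrite /= Ex Et => /(_ (opE _ _)); rewrite /= Ex Et in ne4 => /(_ ne4) [xz nz].
    have := bx (4, i, k); case: (aval _ _) => [_|h]; last by case: h; exact: interior_subset.
    by have := bt (4, i, k); case: (bev _ t) => // h; case: nz; exact: interior_subset.
  (* With nothing of the [i]-th interior outside the [k]-th term, the [i]-th interior lies inside
     the [k]-th, hence, being connected, in one of its two parts. *)
  have sub : (eval I x)° `<=` (eval I t)°.
    move=> z xz; rewrite interiorEbigcup; exists (eval I x)° => //; split; first exact: open_interior.
    by move=> y xy; apply: contrapT => ny; apply: ne4; exists y; rewrite /= Ex Et.
  have sep : separated (E k) ((eval I t)° `\` E k).
    split; apply/seteqP; split=> // z.
      case=> cz [Oz nEz]; have [] := cz ((eval I t)° `\` E k); first by apply: open_nbhs_nbhs; split.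
      by move=> y [Ey [_ nEy]].
    case=> Ez cz; have [] := cz (E k); first by apply: open_nbhs_nbhs; split.
    by move=> y [[_ nEy] Ey].
  have cx : connected (eval I x)° by move: mi; rewrite Ei.
  have [s|s] : (eval I x)° `<=` E k \/ (eval I x)° `<=` (eval I t)° `\` E k.
    by apply: connected_subset sep _ cx => z /sub Oz; have [?|?] := pselect (E k z); [left|right].
  + apply: Or32; rewrite all_map; apply/allP => c _ /=; have := bx c.
    by case: (aval _ _) => //= h; apply/asboolP/s.
  + apply: Or33; rewrite all_map; apply/allP => c _ /=; have := bx c.
    by case: (aval _ _) => //= h; apply/asboolP => Ez; case: (s _ h).
Qed.

End Sample.

End Sampling.

(** * A self-similar colouring of the integer lattice *)

Section Lattice.

Import Order.TTheory GRing.Theory Num.Theory.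

(** This is where dimension three is used: two axis-parallel lines have a common transverse axis,
    along which lines through different diagonal positions are separated. *)
Lemma ord3_other (i i' : 'I_3) : exists j : 'I_3, j != i /\ j != i'.
Proof.
by case: i i' => [[|[|[|//]]] hi] [[|[|[|//]]] hi'];
  first [by exists (Ordinal (isT : 0 < 3)%N) | by exists (Ordinal (isT : 1 < 3)%N)
        | by exists (Ordinal (isT : 2 < 3)%N)].
Qed.

Lemma divz_step (m q q' d d' : int) : (3 <= m -> 0 <= d < m -> 0 <= d' < m ->
  `|(m * q + d) - (m * q' + d')| <= 1 ->
  [\/ q = q' /\ `|d - d'| <= 1, [/\ q' = q + 1, d = m - 1 & d' = 0] |
      [/\ q' = q - 1, d = 0 & d' = m - 1]])%R.
Proof.
move=> m3 hd hd' H.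
have [E|[E|[E|[E|E]]]] : (q = q' \/ q' = q + 1 \/ q' = q - 1 \/ q' >= q + 2 \/ q' <= q - 2)%R by lia.
- by apply: Or31; subst q'; lia.
- by apply: Or32; subst q'; rewrite mulrDr mulr1 in H; split; lia.
- by apply: Or33; subst q'; rewrite mulrBr mulr1 in H; split; lia.
- have : (m * (q + 2) <= m * q')%R by rewrite ler_pM2l //; lia.
  by rewrite mulrDr; lia.
- have : (m * q' <= m * (q - 2))%R by rewrite ler_pM2l //; lia.
  by rewrite mulrBr; lia.
Qed.

Section Coloring.
Variables (n : nat) (e : nat -> 'I_n -> bool).

Local Open Scope ring_scope.

(** The [2n+1] positions along an edge run from [0] to [2n], and colour [p] is centred at [2p+1].
    The centres are odd, hence at mutual distance at least two, and none lies at an end, so that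
    lines reach a face of the cube only head-on. *)
Definition msc : int := (n.*2.+1)%:Z.
Definition ctrc (p : 'I_n) : int := (p.*2.+1)%:Z.

Lemma msc_ge3 (p : 'I_n) : 3 <= msc.
Proof. by rewrite /msc; have := ltn_ord p; lia. Qed.

Lemma ctrc_itv p : 0 < ctrc p < msc - 1.
Proof. by rewrite /msc /ctrc; have := ltn_ord p; lia. Qed.

Lemma ctrc_sep p q : `|ctrc p - ctrc q| <= 1 -> p = q.
Proof. by rewrite /ctrc => H; apply: val_inj => /=; lia. Qed.

Definition idx3 := 'I_3 -> int.

Definition upd (x : idx3) (i : 'I_3) (v : int) : idx3 := fun j => if j == i then v else x j.

Definition adj (x y : idx3) : Prop := forall j, `|x j - y j| <= 1.

Lemma adj_sym x y : adj x y -> adj y x.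
Proof. by move=> h j; have := h j; lia. Qed.

(** The cube at [(2i, 2i, 2i)] is reserved for the [i]-th region; the factor two keeps reserved
    cubes from touching each other. *)
Definition tag0 (x : idx3) : option nat :=
  if pselect (exists i : nat, forall j, x j = (i.*2)%:Z) is left h
  then Some (projT1 (cid h)) else None.

Lemma tag0P x i : tag0 x = Some i <-> forall j, x j = (i.*2)%:Z.
Proof.
rewrite /tag0; case: pselect => [h|h]; last by split=> // H; case: h; exists i.
case: cid => i' /= H; split=> [[<-] //|H2]; congr Some.
by have := H ord0; rewrite (H2 ord0); lia.
Qed.

Definition tset (u : option nat) (p : 'I_n) : bool := if u is Some i then e i p else true.

Definition arm (ps : idx3 -> bool) (x d : idx3) (p : 'I_n) : bool :=
  [exists i : 'I_3, [&& [forall j, (j != i) ==> (d j == ctrc p)],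
    (d i == msc - 1) ==> ps (upd x i (x i + 1)) & (d i == 0) ==> ps (upd x i (x i - 1))]].

(** Colour [p] is present in the cube or may still come to be. *)
Definition pishc (c : 'I_n + option nat) (p : 'I_n) : bool :=
  match c with inl q => q == p | inr u => tset u p end.

(* [inl p]: the cube has colour [p]; [inr u]: it is still to be subdivided, and
   only the colours in [tset u] will occur in it.  Inside such a cube colour [p]
   receives the three axis-parallel lines of subcubes through the [p]-th
   diagonal subcube, except where they would run into a region without [p]. *)
Fixpoint chi (k : nat) (y : idx3) {struct k} : 'I_n + option nat :=
  if k is k'.+1 then
    let x j := (y j %/ msc)%Z in let d j := (y j %% msc)%Z in
    match chi k' x with
    | inl p => inl p
    | inr u => if [pick p | tset u p && arm (fun x' => pishc (chi k' x') p) x d p] is Some p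
               then inl p else inr u
    end
  else inr (tag0 y).

Definition pish k x p := pishc (chi k x) p.

Definition subcube (x d : idx3) : idx3 := fun j => msc * x j + d j.
Definition digit (d : idx3) : Prop := forall j, 0 <= d j < msc.

Lemma sub_surj y : exists x d, digit d /\ y = subcube x d.
Proof.
exists (fun j => (y j %/ msc)%Z), (fun j => (y j %% msc)%Z); split.
  by move=> j; rewrite modz_ge0 //= ltz_pmod.
by apply/funext => j; rewrite /subcube mulrC -divz_eq.
Qed.

Lemma divz_sub x d j : digit d -> ((subcube x d) j %/ msc)%Z = x j.
Proof.
move=> hd; have [h0 h1] := andP (hd j).
by rewrite /subcube mulrC divzMDl // divz_small ?addr0 //; apply/andP.
Qed.

Lemma modz_sub x d j : digit d -> ((subcube x d) j %% msc)%Z = d j.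
Proof.
move=> hd; have [h0 h1] := andP (hd j).
by rewrite /subcube mulrC modzMDl modz_small //; apply/andP.
Qed.

Lemma chiS k x d : digit d -> chi k.+1 (subcube x d) =
  match chi k x with
  | inl p => inl p
  | inr u => if [pick p | tset u p && arm (pish k ^~ p) x d p] is Some p
             then inl p else inr u
  end.
Proof.
move=> hd /=; have -> : (fun j => (subcube x d j %/ msc)%Z) = x by apply/funext => j; rewrite divz_sub.
by have -> : (fun j => (subcube x d j %% msc)%Z) = d by apply/funext => j; rewrite modz_sub.
Qed.

Arguments chi : simpl never.

Lemma chi0 y : chi 0 y = inr (tag0 y). Proof. by []. Qed.

Lemma armP (ps : idx3 -> bool) x d p : reflect (exists i : 'I_3, [/\ forall j, j != i -> d j = ctrc p,
    d i = msc - 1 -> ps (upd x i (x i + 1)) & d i = 0 -> ps (upd x i (x i - 1))]) (arm ps x d p).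
Proof.
apply: (iffP existsP) => -[i].
  case/and3P=> /forallP h1 /implyP h2 /implyP h3; exists i; split.
  - by move=> j ji; apply/eqP; have /implyP := h1 j; apply.
  - by move=> E; apply: h2; apply/eqP.
  - by move=> E; apply: h3; apply/eqP.
case=> h1 h2 h3; exists i; apply/and3P; split.
- by apply/forallP => j; apply/implyP => ji; apply/eqP/h1.
- by apply/implyP => /eqP.
- by apply/implyP => /eqP.
Qed.

(** * Different colours do not touch *)

Lemma arm_uniq ps ps' x x' d p q : arm ps x d p -> arm ps' x' d q -> p = q.
Proof.
case/armP=> i [h _ _] /armP [i' [h' _ _]]; have [j [ji ji']] := ord3_other i i'.
by apply: ctrc_sep; rewrite -(h _ ji) -(h' _ ji') subrr.
Qed.

Lemma chiS_inl k x d p : digit d -> chi k.+1 (subcube x d) = inl p ->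
  chi k x = inl p \/ exists u, [/\ chi k x = inr u, tset u p & arm (pish k ^~ p) x d p].
Proof.
move=> hd; rewrite chiS //; case: (chi k x) => [q [->]|u]; first by left.
by case: pickP => // q /andP [h1 h2] [<-]; right; exists u.
Qed.

Lemma chiS_arm k x d p u : digit d -> chi k x = inr u -> tset u p ->
  arm (pish k ^~ p) x d p -> chi k.+1 (subcube x d) = inl p.
Proof.
move=> hd E h1 h2; rewrite chiS // E; case: pickP => [q /andP [_ h]|/(_ p)].
  by rewrite (arm_uniq h h2).
by rewrite h1 h2.
Qed.

Lemma chiS_col k x d p : digit d -> chi k x = inl p -> chi k.+1 (subcube x d) = inl p.
Proof. by move=> hd E; rewrite chiS // E. Qed.

Lemma chiS_inr k x d u : digit d -> chi k.+1 (subcube x d) = inr u -> chi k x = inr u.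
Proof. by move=> hd; rewrite chiS //; case: (chi k x) => // u'; case: pickP => // _ [->]. Qed.

Lemma pishS k x d p : digit d -> pish k.+1 (subcube x d) p -> pish k x p.
Proof.
move=> hd; rewrite /pish; case E: (chi k.+1 _) => [q|u] /=.
  by move/eqP=> <-; case: (chiS_inl hd E) => [-> /=|[u [-> h _]] //]; rewrite eqxx.
by rewrite (chiS_inr hd E).
Qed.

Lemma adj_sub x d x' d' (p : 'I_n) : digit d -> digit d' -> adj (subcube x d) (subcube x' d') ->
  forall j, [\/ x j = x' j /\ `|d j - d' j| <= 1,
    [/\ x' j = x j + 1, d j = msc - 1 & d' j = 0] |
    [/\ x' j = x j - 1, d j = 0 & d' j = msc - 1]].
Proof. by move=> hd hd' h j; apply: divz_step; [exact: msc_ge3 p|exact: hd|exact: hd'|exact: h]. Qed.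

(** The transverse coordinates of a line stay away from the faces of the big cube, so its subcubes
    touch other big cubes only across the face at an end of the line, where [arm] has consulted
    [ps]. *)
Lemma arm_adj ps x d x' d' p : digit d -> digit d' -> adj (subcube x d) (subcube x' d') ->
  arm ps x d p -> x = x' \/ ps x'.
Proof.
move=> hd hd' ha /armP [i [h1 h2 h3]]; have H := adj_sub p hd hd' ha.
have E j : j != i -> x' j = x j.
  by move=> ji; have := ctrc_itv p; case: (H j) => [[]|[_]|[_]]; rewrite ?(h1 _ ji) //; lia.
have eqx v : x' i = v -> x' = upd x i v.
  by move=> xi; apply/funext => j; rewrite /upd; case: eqP => [->//|/eqP/E].
case: (H i) => [[xi _]|[xi di _]|[xi di _]].
- by left; apply/funext => j; case: (eqVneq j i) => [->//|/E].
- by right; rewrite (eqx _ xi); apply: h2.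
- by right; rewrite (eqx _ xi); apply: h3.
Qed.

(** The invariant of the construction: a coloured cube touches, even at a corner, neither a cube of
    another colour nor an undecided cube barring its colour. Newly coloured subcubes preserve it, by
    the separation of the lines inside a cube and by the test at their ends. *)
Lemma chi_adj k x y p : adj x y -> chi k x = inl p -> pish k y p.
Proof.
elim: k x y p => [|k IH] y1 y2 p ha; first by rewrite chi0.
have [x1 [d1 [hd1 E1]]] := sub_surj y1; have [x2 [d2 [hd2 E2]]] := sub_surj y2; subst y1 y2.
have hx : adj x1 x2 by move=> j; case: (adj_sub p hd1 hd2 ha j) => [[]|[]|[]]; lia.
have armarm q : arm (pish k ^~ p) x1 d1 p -> arm (pish k ^~ q) x2 d2 q -> q = p.
  move=> a1 a2; have /armP [i [h1 _ _]] := a1; have /armP [i' [h1' _ _]] := a2.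
  have [j [ji ji']] := ord3_other i i'; apply/esym/ctrc_sep.
  rewrite -(h1 _ ji) -(h1' _ ji').
  have := ctrc_itv p; rewrite -(h1 _ ji); case: (adj_sub p hd1 hd2 ha j) => [[]|[_]|[_]]; lia.
case/(chiS_inl hd1) => [E|[u [E to a1]]].
  have := IH _ _ _ hx E; rewrite /pish; case E2: (chi k x2) => [q|u] /= h.
    by rewrite (chiS_col hd2 E2).
  case E3: (chi k.+1 (subcube x2 d2)) => [q|u'] /=; last first.
    by have := chiS_inr hd2 E3; rewrite E2 => -[<-].
  case: (chiS_inl hd2 E3) => [|[u' [_ _ a2]]]; first by rewrite E2.
  case: (arm_adj hd2 hd1 (adj_sym ha) a2) => [Ex|].
    by move: E; rewrite -Ex E2.
  by rewrite /pish E eq_sym.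
case: (arm_adj hd1 hd2 ha a1) => [Ex|].
  subst x2; rewrite /pish; case E3: (chi k.+1 (subcube x1 d2)) => [q|u'] /=; last first.
    by have := chiS_inr hd2 E3; rewrite E => -[<-].
  case: (chiS_inl hd2 E3) => [|[u' [_ _ a2]]]; first by rewrite E.
  by rewrite (armarm q).
rewrite /pish; case E2: (chi k x2) => [q|u'] /= h; first by rewrite (chiS_col hd2 E2).
case E3: (chi k.+1 (subcube x2 d2)) => [q|u2] /=; last first.
  by have := chiS_inr hd2 E3; rewrite E2 => -[<-].
case: (chiS_inl hd2 E3) => [|[u2 [_ _ a2]]]; first by rewrite E2.
by rewrite (armarm q).
Qed.

(** Tags are inherited from the initial cubes, and touching cubes descend from equal or touching
    ones, while distinct reserved cubes do not touch. *)
Lemma chi_adj_tag k x y u u' (p : 'I_n) : adj x y -> chi k x = inr u -> chi k y = inr u' ->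
  [\/ u = u', u = None | u' = None].
Proof.
elim: k x y => [|k IH] y1 y2 ha.
  rewrite !chi0; case=> <- [<-]; case E1: (tag0 y1) => [i|]; last by apply: Or32.
  case E2: (tag0 y2) => [i'|]; last by apply: Or33.
  apply: Or31; congr Some; move/tag0P: E1 => /(_ ord0) E1; move/tag0P: E2 => /(_ ord0) E2.
  by have := ha ord0; rewrite E1 E2; lia.
have [x1 [d1 [hd1 E1]]] := sub_surj y1; have [x2 [d2 [hd2 E2]]] := sub_surj y2; subst y1 y2.
move=> /(chiS_inr hd1) h1 /(chiS_inr hd2) h2; apply: IH h1 h2.
by move=> j; case: (adj_sub p hd1 hd2 ha j) => [[]|[]|[]]; lia.
Qed.

Definition cdig (p : 'I_n) : idx3 := fun=> ctrc p.

Lemma digit_upd d i v : digit d -> 0 <= v < msc -> digit (upd d i v).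
Proof. by move=> hd hv j; rewrite /upd; case: eqP. Qed.

Lemma digit_cdig p : digit (cdig p).
Proof. by move=> j; have := ctrc_itv p; rewrite /cdig; lia. Qed.

Lemma arm_axis (ps : idx3 -> bool) x (p : 'I_n) i v : (v = msc - 1 -> ps (upd x i (x i + 1))) ->
  (v = 0 -> ps (upd x i (x i - 1))) -> arm ps x (upd (cdig p) i v) p.
Proof.
move=> h1 h2; apply/armP; exists i; rewrite /upd eqxx; split=> // j ji.
by rewrite (negbTE ji).
Qed.

Lemma upd_id x i : upd x i (x i) = x.
Proof. by apply/funext => j; rewrite /upd; case: eqP => [->|]. Qed.

Lemma updE x i v : upd x i v i = v. Proof. by rewrite /upd eqxx. Qed.
Lemma updN x i v j : j != i -> upd x i v j = x j. Proof. by rewrite /upd => /negbTE ->. Qed.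
Lemma upd_upd x i v v' : upd (upd x i v) i v' = upd x i v'.
Proof. by apply/funext => j; rewrite /upd; case: eqP. Qed.
Lemma sub_upd x d i v : subcube x (upd d i v) = upd (subcube x d) i (msc * x i + v).
Proof. by apply/funext => j; rewrite /subcube /upd; case: eqP => [->|]. Qed.

Lemma chi_center k x u p : chi k x = inr u -> tset u p -> chi k.+1 (subcube x (cdig p)) = inl p.
Proof.
move=> E h; apply: (chiS_arm (digit_cdig p) E h).
by rewrite -(upd_id (cdig p) ord0); apply: arm_axis; have := ctrc_itv p; rewrite /cdig; lia.
Qed.

(** * Each colour is connected *)

Section Reach.
Variables (p : 'I_n).

(* An abstract form of "the representatives of two cubes of colour [p] lie in the
   same component". *)
Variable J : nat * idx3 -> nat * idx3 -> Prop.
Hypothesis J_refl : forall a, J a a.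
Hypothesis J_sym : forall a b, J a b -> J b a.
Hypothesis J_trans : forall a b c, J a b -> J b c -> J a c.
Hypothesis J_face : forall k x i, chi k x = inl p -> chi k (upd x i (x i + 1)) = inl p ->
  J (k, x) (k, upd x i (x i + 1)).
Hypothesis J_sub : forall k x d, digit d -> chi k x = inl p -> J (k.+1, subcube x d) (k, x).

Definition rep k x : nat * idx3 :=
  if chi k x is inl _ then (k, x) else (k.+1, subcube x (cdig p)).

Lemma J_arm k x i v w : pish k x p -> 0 <= v <= w -> w < msc ->
  (forall t, v <= t <= w -> chi k.+1 (subcube x (upd (cdig p) i t)) = inl p) ->
  J (k.+1, subcube x (upd (cdig p) i v)) (k.+1, subcube x (upd (cdig p) i w)).
Proof.
move=> _ vw _ H.
have [N EN] : exists N : nat, w = v + N%:Z by exists `|w - v|%N; lia.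
subst w; elim: N H vw => [|N IH] H vw; first by rewrite addr0; exact: J_refl.
apply: J_trans (IH _ _) _; [by move=> t ht; apply: H; lia|by lia|].
have E : subcube x (upd (cdig p) i (v + N.+1%:Z)) = upd (subcube x (upd (cdig p) i (v + N%:Z))) i
    (subcube x (upd (cdig p) i (v + N%:Z)) i + 1).
  by rewrite !sub_upd upd_upd updE; congr upd; lia.
by rewrite E; apply: J_face; rewrite -?E; apply: H; lia.
Qed.

Lemma J_up k x i : pish k x p -> pish k (upd x i (x i + 1)) p ->
  chi k.+1 (subcube x (upd (cdig p) i (msc - 1))) = inl p /\
  J (rep k x) (k.+1, subcube x (upd (cdig p) i (msc - 1))).
Proof.
move=> hx hy; have hc := ctrc_itv p; have dg v : 0 <= v < msc -> digit (upd (cdig p) i v).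
  by apply: digit_upd; exact: digit_cdig.
rewrite /rep; move: (hx); rewrite /pish; case E: (chi k x) => [q|u] /= h.
  move/eqP: h => h; subst q.
  split; first by apply: chiS_col E; apply: dg; lia.
  by apply: J_sym; apply: J_sub E; apply: dg; lia.
have H t : ctrc p <= t <= msc - 1 -> chi k.+1 (subcube x (upd (cdig p) i t)) = inl p.
  by move=> ht; apply: chiS_arm E h _; [apply: dg; lia|apply: arm_axis => //; lia].
split; first by apply: H; lia.
by rewrite -{1}(upd_id (cdig p) i); apply: J_arm => //; rewrite /cdig; lia.
Qed.

Lemma J_down k x i : pish k x p -> pish k (upd x i (x i - 1)) p ->
  chi k.+1 (subcube x (upd (cdig p) i 0)) = inl p /\
  J (rep k x) (k.+1, subcube x (upd (cdig p) i 0)).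
Proof.
move=> hx hy; have hc := ctrc_itv p; have dg v : 0 <= v < msc -> digit (upd (cdig p) i v).
  by apply: digit_upd; exact: digit_cdig.
rewrite /rep; move: (hx); rewrite /pish; case E: (chi k x) => [q|u] /= h.
  move/eqP: h => h; subst q.
  split; first by apply: chiS_col E; apply: dg; lia.
  by apply: J_sym; apply: J_sub E; apply: dg; lia.
have H t : 0 <= t <= ctrc p -> chi k.+1 (subcube x (upd (cdig p) i t)) = inl p.
  by move=> ht; apply: chiS_arm E h _; [apply: dg; lia|apply: arm_axis => //; lia].
split; first by apply: H; lia.
apply: J_sym; rewrite -{2}(upd_id (cdig p) i); apply: J_arm => //; rewrite /cdig; lia.
Qed.

Lemma J_step k x i : pish k x p -> pish k (upd x i (x i + 1)) p ->
  J (rep k x) (rep k (upd x i (x i + 1))).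
Proof.
move=> hx hy; set y := upd x i (x i + 1).
have Ey : upd y i (y i - 1) = x by rewrite /y upd_upd updE addrK upd_id.
have [c1 J1] := J_up hx hy; have [|c2 J2] := @J_down k y i hy; first by rewrite Ey.
apply: J_trans J1 _; apply: J_trans _ (J_sym J2).
have E : subcube y (upd (cdig p) i 0) = upd (subcube x (upd (cdig p) i (msc - 1))) i
    (subcube x (upd (cdig p) i (msc - 1)) i + 1).
  rewrite !sub_upd upd_upd updE /y updE; apply/funext => j; rewrite /upd /subcube.
  by case: eqP => // _; lia.
by rewrite E; apply: J_face; rewrite -?E.
Qed.

Lemma J_walk k x i v w : (forall t, v <= t <= w \/ w <= t <= v -> pish k (upd x i t) p) ->
  J (rep k (upd x i v)) (rep k (upd x i w)).
Proof.
wlog vw : v w / v <= w.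
  move=> W H; case: (leP v w) => vw; first exact: W.
  by apply: J_sym; apply: W; [lia|move=> t ht; apply: H; lia].
have [N EN] : exists N : nat, w = v + N%:Z by exists `|w - v|%N; lia.
subst w => H; elim: N H {vw} => [|N IH] H; first by rewrite addr0; exact: J_refl.
apply: J_trans (IH _) _; first by move=> t ht; apply: H; lia.
have E : upd x i (v + N.+1%:Z) = upd (upd x i (v + N%:Z)) i (upd x i (v + N%:Z) i + 1).
  by rewrite upd_upd updE; congr upd; lia.
by rewrite E; apply: J_step; rewrite -?E; apply: H; lia.
Qed.

Lemma J_move k x i w : (forall t, x i <= t <= w \/ w <= t <= x i -> pish k (upd x i t) p) ->
  J (rep k x) (rep k (upd x i w)).
Proof. by move=> H; rewrite -{1}(upd_id x i); apply: J_walk. Qed.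

Definition oddz (v : int) : bool := odd `|v|%N.
(** A safe coordinate is a transverse coordinate of no line of another colour, since centres are
    odd. Safety along two axes suffices to keep a subcube off all such lines, every line being
    transverse to one of the two. *)
Definition safe (v : int) : Prop := ~~ oddz v \/ v = ctrc p.

Lemma oddzS v : oddz (v + 1) = ~~ oddz v.
Proof.
rewrite /oddz; case: v => v; first by have -> : absz (Posz v + 1) = v.+1 by lia.
rewrite (_ : absz (Negz v + 1) = v); last by lia.
by rewrite /= negbK.
Qed.

Lemma pish_safe k x u d i : chi k x = inr u -> tset u p -> digit d ->
  (forall j, j != i -> safe (d j)) -> pish k.+1 (subcube x d) p.
Proof.
move=> E h hd hs; rewrite /pish; case E2: (chi k.+1 _) => [q|u'] /=; last first.
  by have := chiS_inr hd E2; rewrite E => -[<-].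
case: (chiS_inl hd E2) => [|[u' [_ _ /armP [i' [h1 _ _]]]]]; first by rewrite E.
have [j [ji ji']] := ord3_other i i'; case: (hs _ ji); rewrite (h1 _ ji').
  by rewrite /oddz /ctrc /= odd_double.
by move=> Eq; apply/eqP/ctrc_sep; rewrite Eq subrr.
Qed.

(** If the lower neighbour were on a line, that line would run along axis [i], its [i]-th coordinate
    being even. The subcube itself would then lie on the same line, and not at an end, because both
    ends are even. *)
Lemma mixed_even k x u d i : chi k x = inr u -> digit d -> chi k.+1 (subcube x d) = inr u ->
  oddz (d i) -> digit (upd d i (d i - 1)) /\ chi k.+1 (subcube x (upd d i (d i - 1))) = inr u.
Proof.
move=> E hd E1 od; have hd' : digit (upd d i (d i - 1)).
  apply: digit_upd => //; have := hd i; move: od; rewrite /oddz.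
  by case: (d i) => [[|v]|v] //=; lia.
split=> //; case E2: (chi k.+1 _) => [q|u']; last by have := chiS_inr hd' E2; rewrite E => -[<-].
case: (chiS_inl hd' E2) => [|[u' []]]; rewrite E // => -[<-] to /armP [i' [h1 _ _]].
case: (eqVneq i i') => [ii|ii]; last first.
  have := h1 _ ii; rewrite updE => H; move: od; have -> : d i = (q.+1.*2)%:Z by rewrite /ctrc in H; lia.
  by rewrite /oddz /= odd_double.
subst i'; have a : arm (pish k ^~ q) x d q.
  apply/armP; exists i; split=> [j ji||].
  - by rewrite -(h1 _ ji) updN.
  - move=> H; move: od; rewrite H -[oddz _]negbK -oddzS subrK.
    by rewrite /oddz /msc /= odd_double.
  - by move=> H; move: od; rewrite H.
by move: E1; rewrite (chiS_arm hd E to a).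
Qed.

Lemma J_even k x u d i : chi k x = inr u -> tset u p -> digit d -> chi k.+1 (subcube x d) = inr u ->
  exists d', [/\ digit d', chi k.+1 (subcube x d') = inr u, J (rep k.+1 (subcube x d)) (rep k.+1 (subcube x d')),
    ~~ oddz (d' i) & forall j, j != i -> d' j = d j].
Proof.
move=> E h hd E1; case: (boolP (oddz (d i))) => od; last by exists d; split=> //; exact: J_refl.
have [hd' E2] := mixed_even E hd E1 od; exists (upd d i (d i - 1)); split=> //.
- apply: J_sym; set y := subcube x _.
  have Ey : subcube x d = upd y i (y i + 1).
    rewrite /y; apply/funext => j; rewrite /subcube /upd eqxx; case: eqP => [->|_] //; lia.
  by rewrite Ey; apply: J_step; rewrite -?Ey /pish ?E1 ?E2.
- rewrite updE; move: od (hd i); rewrite /oddz; case: (d i) => [[|v]|v] //= + _.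
  by rewrite subn1.
- by move=> j ji; rewrite updN.
Qed.

(** A subcube of colour [p] slides along its line to the centre. An undecided one is first moved to
    even coordinates, which are then replaced one after the other by [ctrc p], all positions on the
    way being safe. *)
Lemma J_center k x u d : chi k x = inr u -> tset u p -> digit d -> pish k.+1 (subcube x d) p ->
  J (rep k.+1 (subcube x d)) (k.+1, subcube x (cdig p)).
Proof.
move=> E h hd.
have Rc : rep k.+1 (subcube x (cdig p)) = (k.+1, subcube x (cdig p)) by rewrite /rep (chi_center E h).
have sc : safe (ctrc p) by right.
have mv d' i : digit d' -> (forall j, j != i -> safe (d' j)) ->
    J (rep k.+1 (subcube x d')) (rep k.+1 (subcube x (upd d' i (ctrc p)))).
  move=> hd' hs; rewrite sub_upd; apply: J_move => t ht.
  have Et : t = msc * x i + (t - msc * x i) by lia.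
  rewrite Et -sub_upd; apply: (pish_safe (i := i) E h) => [|j ji]; last by rewrite updN //; apply: hs.
  apply: digit_upd => //; have := hd' i; have := ctrc_itv p; move: ht; rewrite /subcube; lia.
pose i0 : 'I_3 := @Ordinal 3 0 isT; pose i1 : 'I_3 := @Ordinal 3 1 isT; pose i2 : 'I_3 := @Ordinal 3 2 isT.
have all3 (Q : 'I_3 -> Prop) : Q i0 -> Q i1 -> Q i2 -> forall j, Q j.
  by move=> q0 q1 q2 [[|[|[|//]]] hj]; [have -> : Ordinal hj = i0 by apply: val_inj
    |have -> : Ordinal hj = i1 by apply: val_inj|have -> : Ordinal hj = i2 by apply: val_inj].
rewrite /pish; case E1: (chi k.+1 (subcube x d)) => [q|u'] /=.
  move/eqP=> qp; subst q; case: (chiS_inl hd E1) => [|[u' [_ _ /armP [i [h1 _ _]]]]]; first by rewrite E.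
  have Ed : upd d i (ctrc p) = cdig p.
    by apply/funext => j; rewrite /upd; case: eqP => // /eqP ji; rewrite h1.
  by rewrite -Rc -Ed; apply: mv => // j ji; rewrite h1.
have := chiS_inr hd E1; rewrite E => -[Eo] _; subst u'.
have [d1 [hd1 E2 J1 e1 f1]] := J_even i0 E h hd E1.
have [d2 [hd2 E3 J2 e2 f2]] := J_even i1 E h hd1 E2.
have [d3 [hd3 E4 J3 e3 f3]] := J_even i2 E h hd2 E3.
apply: J_trans J1 _; apply: J_trans J2 _; apply: J_trans J3 _.
have ev : forall j, safe (d3 j).
  by apply: all3; left => //; rewrite f3 // ?f2.
pose u1 := upd d3 i0 (ctrc p); pose u2 := upd u1 i1 (ctrc p).
have hc := ctrc_itv p.
have hu1 : digit u1 by apply: digit_upd => //; lia.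
have hu2 : digit u2 by apply: digit_upd => //; lia.
have su1 : forall j, safe (u1 j) by move=> j; rewrite /u1 /upd; case: eqP.
have su2 : forall j, safe (u2 j) by move=> j; rewrite /u2 /upd; case: eqP.
apply: J_trans (mv d3 i0 hd3 (fun j _ => ev j)) _.
apply: J_trans (mv u1 i1 hu1 (fun j _ => su1 j)) _.
have := mv u2 i2 hu2 (fun j _ => su2 j).
suff -> : upd u2 i2 (ctrc p) = cdig p by rewrite Rc.
by apply/funext; apply: all3.
Qed.

Definition one3 : idx3 := fun=> 1.

(** [J_center] lowers the level one by one. In the initial lattice the walk to [(1, 1, 1)] always
    keeps one coordinate odd and thereby avoids the reserved cubes. *)
Lemma J_base k x : pish k x p -> J (rep k x) (rep 0 one3).
Proof.
elim: k x => [|k IH] y hy.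
  have podd x i : oddz (x i) -> pish 0 x p.
    rewrite /pish chi0 /=; case E: (tag0 x) => [i'|] //=; move/tag0P: E => /(_ i) ->.
    by rewrite /oddz /= odd_double.
  pose i0 : 'I_3 := @Ordinal 3 0 isT; pose i1 : 'I_3 := @Ordinal 3 1 isT; pose i2 : 'I_3 := @Ordinal 3 2 isT.
  have [x [ox Jx]] : exists x, oddz (x i0) /\ J (rep 0 y) (rep 0 x).
    case: (boolP (oddz (y i0))) => oy; first by exists y; split=> //; exact: J_refl.
    exists (upd y i0 (y i0 + 1)); split; first by rewrite updE oddzS.
    by apply: J_step => //; apply: (podd _ i0); rewrite updE oddzS.
  apply: J_trans Jx _.
  apply: J_trans (_ : J _ (rep 0 (upd x i1 1))) _.
    by apply: J_move => t _; apply: (podd _ i0); rewrite updN.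
  apply: J_trans (_ : J _ (rep 0 (upd (upd x i1 1) i2 1))) _.
    by apply: J_move => t _; apply: (podd _ i0); rewrite !updN.
  have := @J_move 0 (upd (upd x i1 1) i2 1) i0 1.
  have -> : upd (upd (upd x i1 1) i2 1) i0 1 = one3.
    apply/funext => -[[|[|[|//]]] hj]; rewrite /upd /= //.
  by apply=> t _; apply: (podd _ i1); rewrite updN // updN // updE.
have [x [d [hd E]]] := sub_surj y; subst y.
have hx := pishS hd hy; apply: J_trans _ (IH _ hx).
move: (hx); rewrite /pish /rep; case E: (chi k x) => [q|u] /= h.
  move/eqP: h => h; subst q; rewrite (_ : match _ with inl _ => _ | inr _ => _ end = (k.+1, subcube x d)).
    exact: J_sub.
  by have := chiS_col hd E => /= ->.
exact: (J_center E h hd hy).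
Qed.

End Reach.
End Coloring.

End Lattice.

(** * Wada domains *)

Section Domains.

Import Order.TTheory GRing.Theory Num.Theory.

Local Open Scope classical_set_scope.
Local Open Scope ring_scope.

Lemma connected_between (T : topologicalType) (A B : set T) :
  connected A -> A `<=` B -> B `<=` closure A -> connected B.
Proof.
move=> cA AB BA; apply/connectedP => E [E0 EU sE].
have H b : A `<=` E b -> False.
  move=> AE; have [y Ey] := E0 (~~ b).
  have By : B y by rewrite EU; case: b {AE} Ey => /= ?; [left|right].
  have cy : closure (E b) y by apply: closureS AE _ (BA _ By).
  by case: sE => h1 h2; case: b {AE} Ey cy => /= Ey cy;
    [have : (E false `&` closure (E true)) y by []; rewrite h2
    |have : (closure (E false) `&` E true) y by []; rewrite h1].
have [] : A `<=` E false \/ A `<=` E true by apply: connected_subset sE _ cA; rewrite -EU.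
  exact: H.
exact: H.
Qed.

Section Space.
Variable R : realType.
Notation V := 'rV[R]_3.

Lemma nbhs_coordP (z : V) (P : set V) :
  nbhs z P <-> exists2 r : R, 0 < r & forall y : V, (forall j, `|z ord0 j - y ord0 j| < r) -> P y.
Proof.
split.
  case/nbhs_ballP=> r /= r0 H; exists r => // y hy; apply: H; split=> // i j.
  by rewrite ord1 -ball_normE /ball_ /=; apply: hy.
case=> r r0 H; apply/nbhs_ballP; exists r => //= y [_ hy]; apply: H => j.
by have := hy ord0 j; rewrite -ball_normE.
Qed.

Lemma seg_joined (A : set V) (z z' : V) :
  (forall t : R, 0 <= t <= 1 -> A (z + t *: (z' - z))) -> connected_component A z z'.
Proof.
move=> H; pose f (t : R) : V := z + t *: (z' - z).
have f0 : f 0 = z by rewrite /f scale0r addr0.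
have f1 : f 1 = z' by rewrite /f scale1r addrC subrK.
have cf : continuous f.
  by move=> t; apply: cvgD; [exact: cvg_cst|exact: scalel_continuous].
apply: (@connected_component_max _ _ (f @` `[0, 1])).
- by exists 0; rewrite ?f0 //= in_itv /= lexx ler01.
- by move=> _ [t + <-]; rewrite /= in_itv /=; apply: H.
- apply: connected_continuous_connected; first exact: segment_connected.
  exact: continuous_subspaceT.
- by exists 1; rewrite ?f1 //= in_itv /= lexx ler01.
Qed.

Lemma convex_lt (l a b t : R) : 0 <= t <= 1 -> l < a -> l < b -> l < (1 - t) * a + t * b.
Proof.
case/andP=> t0 t1 la lb; case: (eqVneq t 0) => [->|tn]; first by rewrite subr0 mul1r mul0r addr0.
have h1 : 0 < t * (b - l) by rewrite mulr_gt0 ?subr_gt0 // lt_neqAle eq_sym tn.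
have h2 : 0 <= (1 - t) * (a - l) by rewrite mulr_ge0 ?subr_ge0 // ltW.
by nra.
Qed.

Lemma convex_gt (l a b t : R) : 0 <= t <= 1 -> a < l -> b < l -> (1 - t) * a + t * b < l.
Proof.
by move=> ht al bl; have := @convex_lt (- l) (- a) (- b) t ht; rewrite !ltrN2 !mulrN -opprD ltrN2; apply.
Qed.

Section Wada.
Variables (n : nat) (e : nat -> 'I_n -> bool).
Hypothesis n0 : (0 < n)%N.
Local Notation chi := (chi e).
Local Notation msc := (msc n).
Local Notation tset := (tset e).
Local Notation digit := (@digit n).
Local Notation sub := (@subcube n).

Definition msr : R := msc%:~R.

Lemma msr_ge3 : 3 <= msr.
Proof. by rewrite /msr -[3]/((3%:Z)%:~R) ler_int; exact: msc_ge3 (Ordinal n0). Qed.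

Lemma msr_gt0 : 0 < msr. Proof. by apply: lt_le_trans msr_ge3. Qed.
Lemma msrX_gt0 k : 0 < msr ^+ k. Proof. exact/exprn_gt0/msr_gt0. Qed.

Lemma msrX_large (r : R) : 0 < r -> exists k, 1 < r * msr ^+ k.
Proof.
move=> r0; exists (Num.bound r^-1).
have h : r^-1 < (Num.bound r^-1)%:R by apply: archi_boundP; rewrite invr_ge0 ltW.
have h2 : (Num.bound r^-1)%:R <= msr ^+ Num.bound r^-1.
  apply: le_trans (_ : (2 ^ Num.bound r^-1)%:R <= _).
    by rewrite ler_nat ltnW // ltn_expl.
  by rewrite natrX lerXn2r ?nnegrE ?ltW ?msr_gt0 //; have := msr_ge3; lra.
rewrite -(ltr_pM2l (_ : 0 < r^-1)) ?invr_gt0 // mulr1 mulKf ?gt_eqF //.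
exact: lt_le_trans h h2.
Qed.

Definition idx k (z : V) : idx3 := fun j => Num.floor (msr ^+ k * z ord0 j).

Lemma idxS k z : exists2 d, digit d & idx k.+1 z = sub (idx k z) d.
Proof.
have [x [d [hd E]]] := sub_surj n (idx k.+1 z); exists d => //; rewrite E; congr sub.
have {}E j : Num.floor (msr * (msr ^+ k * z ord0 j)) = msc * x j + d j.
  by rewrite mulrA -exprS -/(idx k.+1 z j) E.
apply/funext => j; apply/esym/floor_def; have [d0 d1] := andP (hd j).
set t := msr ^+ k * z ord0 j; have Et := E j; rewrite -/t in Et.
have h1 := floor_le (msr * t); have h2 := floorD1_gt (msr * t); rewrite Et in h1 h2.
apply/andP; split.
  rewrite -(ler_pM2l msr_gt0); apply: le_trans h1; rewrite /msr -intrM ler_int; lia.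
rewrite -(ltr_pM2l msr_gt0); apply: lt_le_trans h2 _; rewrite /msr -intrM ler_int; lia.
Qed.

Definition st k z := chi k (idx k z).

Lemma st_col k l z p : st k z = inl p -> st (k + l) z = inl p.
Proof.
elim: l => [|l IH]; first by rewrite addn0.
move/IH; rewrite addnS /st; have [d hd ->] := idxS (k + l) z.
exact: chiS_col.
Qed.

Lemma st_mix k l z u : st (k + l) z = inr u -> st k z = inr u.
Proof.
elim: l => [|l IH]; first by rewrite addn0.
rewrite addnS /st; have [d hd ->] := idxS (k + l) z.
by move/(chiS_inr hd); apply: IH.
Qed.

Lemma st_desc k l z u p : st k z = inr u -> st (k + l) z = inl p -> tset u p.
Proof.
move=> E; elim: l => [|l IH]; first by rewrite addn0 E.
rewrite addnS /st; have [d hd ->] := idxS (k + l) z.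
case/(chiS_inl hd); first exact: IH.
by case=> u' [E' h _]; have := st_mix E'; rewrite E => -[->].
Qed.

(** * The domains and their connectedness *)

Definition Hc p k : set V := [set z | st k z = inl p].
(** The interior is taken of the union of all cubes coloured so far, not of each cube, so that faces
    between cubes of the same colour belong to the domain. *)
Definition U p : set V := \bigcup_k (Hc p k)°.

Lemma U_open p : open (U p).
Proof. by apply: bigcup_open => k _; exact: open_interior. Qed.

Lemma U_st p z : U p z -> exists k, st k z = inl p.
Proof. by case=> k _ /interior_subset; exists k. Qed.

Lemma st_uniq k k' z p q : st k z = inl p -> st k' z = inl q -> p = q.
Proof.
move=> /(@st_col _ k') h1 /(@st_col _ k) h2; move: h1 h2; rewrite addnC => ->.
by case.
Qed.

Lemma U_disj p q z : U p z -> U q z -> p = q.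
Proof. by move=> /U_st [k h1] /U_st [k' h2]; apply: st_uniq h1 h2. Qed.

Definition box k (lo hi : idx3) : set V :=
  [set z | forall j, (lo j)%:~R < msr ^+ k * z ord0 j < (hi j)%:~R].

Lemma box_idx k lo hi z : box k lo hi z -> forall j, lo j <= idx k z j < hi j.
Proof.
by move=> h j; have /andP [h1 h2] := h j; rewrite /idx floor_ge_int floor_lt_int h2 ltW.
Qed.

Lemma box_open k lo hi : open (box k lo hi).
Proof.
rewrite openE => z hz; rewrite /interior.
pose D := \big[Num.min/1]_(j < 3) Num.min (msr ^+ k * z ord0 j - (lo j)%:~R)
   ((hi j)%:~R - msr ^+ k * z ord0 j).
have D0 : 0 < D.
  apply: (big_ind (fun x => 0 < x)) => // [x y x0 y0|j _]; first by rewrite lt_min x0.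
  by have /andP [h1 h2] := hz j; rewrite lt_min !subr_gt0 h1.
apply/nbhs_coordP; exists (D / msr ^+ k); first by rewrite divr_gt0 // msrX_gt0.
move=> y hy j; have := hy j; rewrite ltr_pdivlMr ?msrX_gt0 // => hj.
have hD : D <= Num.min (msr ^+ k * z ord0 j - (lo j)%:~R) ((hi j)%:~R - msr ^+ k * z ord0 j).
  by rewrite /D (bigD1 j) //= ge_min lexx.
have : `|msr ^+ k * z ord0 j - msr ^+ k * y ord0 j| < D.
  by rewrite -mulrBr normrM ger0_norm ?ltW ?msrX_gt0 // mulrC.
move: hD; rewrite le_min => /andP [a1 a2]; rewrite ltr_norml => /andP [b1 b2].
by apply/andP; split; lra.
Qed.

Lemma box_U k lo hi p : (forall x, (forall j, lo j <= x j < hi j) -> chi k x = inl p) ->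
  box k lo hi `<=` U p.
Proof.
move=> H z hz; exists k => //; rewrite interiorEbigcup; exists (box k lo hi) => //.
split; first exact: box_open.
by move=> y hy; apply: H; apply: box_idx.
Qed.

Lemma box_joined k lo hi p z z' : (forall x, (forall j, lo j <= x j < hi j) -> chi k x = inl p) ->
  box k lo hi z -> box k lo hi z' -> connected_component (U p) z z'.
Proof.
move=> H hz hz'; apply: seg_joined => t /andP [t0 t1]; apply: (box_U H) => j.
rewrite !mxE; have /andP [a1 a2] := hz j; have /andP [b1 b2] := hz' j.
have -> : msr ^+ k * (z ord0 j + t * (z' ord0 j - z ord0 j)) =
  (1 - t) * (msr ^+ k * z ord0 j) + t * (msr ^+ k * z' ord0 j) by ring.
by rewrite convex_lt ?t0 //= convex_gt ?t0.
Qed.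

Definition ctr k (x : idx3) : V := \row_j (((x j)%:~R + 2^-1) / msr ^+ k).

Lemma ctrE k x j : msr ^+ k * (ctr k x) ord0 j = (x j)%:~R + 2^-1.
Proof. by rewrite mxE mulrC divfK // gt_eqF // msrX_gt0. Qed.

Lemma ctr_box k x lo hi : (forall j, lo j <= x j < hi j) -> box k lo hi (ctr k x).
Proof.
move=> h j; rewrite ctrE; have /andP [h1 h2] := h j.
have {}h1 : (lo j)%:~R <= (x j)%:~R :> R by rewrite ler_int.
have {}h2 : (x j)%:~R + 1 <= (hi j)%:~R :> R by rewrite -[1]/(1%:~R) -intrD ler_int; lia.
by apply/andP; split; lra.
Qed.

Lemma ctr_sub_box k x d : digit d -> box k x (fun j => x j + 1) (ctr k.+1 (sub x d)).
Proof.
move=> hd j; have := ctrE k.+1 (sub x d) j; rewrite exprS -mulrA => E.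
have /andP [d0 d1] := hd j; have m0 := msr_gt0.
rewrite -(ltr_pM2l m0) -[X in _ && X](ltr_pM2l m0) E /sub.
have -> : (msc * x j + d j)%:~R = msr * (x j)%:~R + (d j)%:~R :> R by rewrite intrD intrM.
have {}d0 : 0 <= (d j)%:~R :> R by rewrite -[0]/(0%:~R) ler_int.
have {}d1 : (d j)%:~R + 1 <= msr by rewrite /msr -[1]/(1%:~R) -intrD ler_int; lia.
rewrite intrD mulrDr mulr1z mulr1.
by apply/andP; split; lra.
Qed.

Lemma unit_cell (x y : idx3) : (forall j, x j <= y j < x j + 1) -> y = x.
Proof. by move=> h; apply/funext => j; have := h j; lia. Qed.

Lemma ctr_U k x p : chi k x = inl p -> U p (ctr k x).
Proof.
move=> E; apply: (@box_U k x (fun j => x j + 1)); last by apply: ctr_box => j; lia.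
by move=> y /unit_cell ->.
Qed.

(** The first disjunct makes the relation reflexive also at cubes whose centre is not in [U p]. *)
Definition J p (a b : nat * idx3) : Prop :=
  a = b \/ connected_component (U p) (ctr a.1 a.2) (ctr b.1 b.2).

Lemma U_connected p : connected (U p).
Proof.
have Jr a : J p a a by left.
have Js a b : J p a b -> J p b a.
  by case=> [->|h]; [left|right; apply: connected_component_sym].
have Jt a b c : J p a b -> J p b c -> J p a c.
  case=> [->//|h1] [<-|h2]; right=> //; exact: connected_component_trans h1 h2.
have Jf k x i : chi k x = inl p -> chi k (upd x i (x i + 1)) = inl p ->
    J p (k, x) (k, upd x i (x i + 1)).
  move=> E1 E2; right => /=.
  apply: (@box_joined k x (fun j => if j == i then x j + 2 else x j + 1)).
  - move=> y hy; have [yi|yi] : y i = x i \/ y i = x i + 1.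
      by have := hy i; rewrite eqxx; lia.
    + rewrite (_ : y = x) //; apply/funext => j; have := hy j.
      by case: eqP => [->|_]; lia.
    + rewrite (_ : y = upd x i (x i + 1)) //; apply/funext => j; have := hy j; rewrite /upd.
      by case: eqP => [->|_]; lia.
  - by apply: ctr_box => j; case: eqP => _; lia.
  - by apply: ctr_box => j; rewrite /upd; case: eqP => [->|_]; lia.
have Jsub k x d : digit d -> chi k x = inl p -> J p (k.+1, sub x d) (k, x).
  move=> hd E; right; apply: (@box_joined k x (fun j => x j + 1)).
  - by move=> y /unit_cell ->.
  - exact: ctr_sub_box.
  - by apply: ctr_box => j /=; lia.
have base := J_base Jr Js Jt Jf Jsub.
have repU k x : pish e k x p -> U p (ctr (rep e p k x).1 (rep e p k x).2).
  rewrite /pish /rep; case E: (chi k x) => [q|u] /= h.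
    by move/eqP: h => h; apply: ctr_U; rewrite E h.
  exact/ctr_U/chi_center/h.
pose b := ctr (rep e p 0 one3).1 (rep e p 0 one3).2.
have pone : pish e 0 one3 p.
  rewrite /pish chi0; case E: (tag0 _) => [i|] //; move/tag0P: E => /(_ ord0).
  by rewrite /one3 => -[]; lia.
suff E : U p = connected_component (U p) b by rewrite E; apply: component_connected.
apply/seteqP; split; last exact: connected_component_sub.
move=> z Uz; apply: connected_component_sym; case: (Uz) => k _ zk.
have E : chi k (idx k z) = inl p := interior_subset zk.
apply: connected_component_trans (_ : connected_component (U p) z (ctr k (idx k z))) _.
  (* The point [z] may lie on a face of its half-open cube, but the rest of the segment to the
     centre is in the open cube. *)
  apply: seg_joined => t /andP [t0 t1]; case: (eqVneq t 0) => [->|tn].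
    by rewrite scale0r addr0.
  apply: (@box_U k (idx k z) (fun j => idx k z j + 1)); first by move=> y /unit_cell ->.
  move=> j; rewrite !mxE.
  have -> : msr ^+ k * (z ord0 j + t * (((idx k z j)%:~R + 2^-1) / msr ^+ k - z ord0 j)) =
    (1 - t) * (msr ^+ k * z ord0 j) + t * ((idx k z j)%:~R + 2^-1).
    by have := msrX_gt0 k => /gt_eqF /negbT ?; field.
  have tp : 0 < t by rewrite lt_neqAle eq_sym tn.
  have := floor_le (msr ^+ k * z ord0 j); have := floorD1_gt (msr ^+ k * z ord0 j).
  rewrite -/(idx k z j) intrD mulr1z; move: (msr ^+ k * z ord0 j) (idx k z j)%:~R => a c h1 h2.
  by apply/andP; split; nra.
have pk : pish e k (idx k z) p by rewrite /pish E /= eqxx.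
have := base k (idx k z) pk; rewrite {1}/rep E => -[Eb|//].
by rewrite /b -Eb /=; apply: connected_component_refl; apply: ctr_U.
Qed.

Lemma U_nonempty p : U p !=set0.
Proof.
have pone : tag0 one3 = None.
  case E: (tag0 _) => [i|] //; move/tag0P: E => /(_ ord0).
  by rewrite /one3 => -[]; lia.
by exists (ctr 1 (sub one3 (cdig p))); apply/ctr_U/(@chi_center _ _ _ _ None) => //; rewrite chi0 pone.
Qed.

(** * Points outside the domains and the domains adherent to them *)

Definition cb (z : V) (r : R) : set V := [set y | forall j, `|z ord0 j - y ord0 j| < r].

Lemma near_adj k z r y y' : r * msr ^+ k <= 2^-1 -> cb z r y -> cb z r y' -> adj (idx k y) (idx k y').
Proof.
move=> hr hy hy' j.
have h : `|y ord0 j - y' ord0 j| < r + r.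
  have -> : y ord0 j - y' ord0 j = (z ord0 j - y' ord0 j) - (z ord0 j - y ord0 j) by ring.
  by apply: le_lt_trans (ler_normB _ _) _; rewrite addrC ltrD.
have {}h : `|msr ^+ k * y ord0 j - msr ^+ k * y' ord0 j| < 1.
  rewrite -mulrBr normrM ger0_norm ?ltW ?msrX_gt0 // mulrC.
  have : `|y ord0 j - y' ord0 j| * msr ^+ k < (r + r) * msr ^+ k by rewrite ltr_pM2r ?msrX_gt0.
  by rewrite mulrDl; lra.
rewrite /idx; move: h; set a := msr ^+ k * y ord0 j; set b := msr ^+ k * y' ord0 j.
rewrite ltr_norml => /andP [h1 h2].
have := floor_le a; have := floorD1_gt a; have := floor_le b; have := floorD1_gt b.
rewrite !intrD !mulr1z => b2 b1 a2 a1.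
have c1 : (Num.floor a)%:~R < (Num.floor b + 2)%:~R :> R by rewrite intrD -[2%:~R]/(2 : R); lra.
have c2 : (Num.floor b)%:~R < (Num.floor a + 2)%:~R :> R by rewrite intrD -[2%:~R]/(2 : R); lra.
by move: c1 c2; rewrite !ltr_int; lia.
Qed.

Lemma small_r k (r : R) : 0 < r -> exists r', [/\ 0 < r', r' <= r & r' * msr ^+ k <= 2^-1].
Proof.
move=> r0; have m0 := msrX_gt0 k; exists (Num.min r (2^-1 / msr ^+ k)); split.
- by rewrite lt_min r0 divr_gt0.
- by rewrite ge_min lexx.
- apply: le_trans (_ : (2^-1 / msr ^+ k) * msr ^+ k <= _); last by rewrite divfK ?gt_eqF.
  by rewrite ler_pM2r // ge_min lexx orbT.
Qed.

Lemma cb_center z r : 0 < r -> cb z r z.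
Proof. by move=> r0 j; rewrite subrr normr0. Qed.

Lemma cb_le z r r' : r <= r' -> cb z r `<=` cb z r'.
Proof. by move=> h y hy j; apply: lt_le_trans (hy j) h. Qed.

(** If all cubes near [z] were coloured at stage [k], those close enough to touch the cube of [z]
    would share its colour by [chi_adj], and [z] would be in that domain. *)
Lemma mixed_near z k r : (forall p, ~ U p z) -> 0 < r ->
  exists y u, cb z r y /\ st k y = inr u.
Proof.
move=> nU r0; apply: contrapT => H.
have col y : cb z r y -> exists p, st k y = inl p.
  by case E: (st k y) => [p|u] hy; [exists p|case: H; exists y, u].
have [r' [r'0 r'r hr']] := small_r k r0.
have [p Ep] := col z (cb_center z r0).
apply: (nU p); exists k => //; apply/nbhs_coordP; exists r' => // y hy.
have [q Eq] := col y (cb_le r'r hy).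
have := chi_adj (near_adj hr' (cb_center z r'0) hy) Ep.
by rewrite /pish -/(st k y) Eq /= => /eqP <-.
Qed.

(** An undecided cube admitting [p] contains a subcube of colour [p] one stage later, and cubes of
    late stages are small. *)
Lemma closure_mixed z p : (forall k r, 0 < r -> exists y u, [/\ cb z r y, st k y = inr u & tset u p]) ->
  closure (U p) z.
Proof.
move=> H B /nbhs_coordP [r r0 hB].
have r20 : 0 < r / 2 by rewrite divr_gt0.
have [k hk] := msrX_large r20; have [y [u [hy E h]]] := H k _ r20.
exists (ctr k.+1 (sub (idx k y) (cdig p))); split; first by apply/ctr_U/chi_center/h.
apply: hB => j; set c := ctr _ _.
have hc := ctr_sub_box k (idx k y) (@digit_cdig n p).
have /andP [c1 c2] := hc j; rewrite -/c in c1 c2.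
have := floor_le (msr ^+ k * y ord0 j); have := floorD1_gt (msr ^+ k * y ord0 j).
rewrite -/(idx k y j) => y2 y1.
have d1 : `|msr ^+ k * y ord0 j - msr ^+ k * c ord0 j| < 1.
  by rewrite ltr_norml; move: c2 y2; rewrite !intrD !mulr1z => c2 y2; apply/andP; split; lra.
have d2 : `|y ord0 j - c ord0 j| < r / 2.
  move: d1; rewrite -mulrBr normrM ger0_norm ?ltW ?msrX_gt0 // => d1.
  by rewrite -(ltr_pM2l (msrX_gt0 k)) (lt_trans d1) // mulrC.
have -> : z ord0 j - c ord0 j = (z ord0 j - y ord0 j) + (y ord0 j - c ord0 j) by ring.
apply: le_lt_trans (ler_normD _ _) _; have := hy j => d3; rewrite [ltRHS]splitr.
exact: ltrD.
Qed.

(** Near [z] the cubes of stage [k0] touch one another, so the undecided ones all carry the tag [i].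
    A colour occurring near [z] therefore arises inside such a cube or already belongs to a cube
    touching one, and in both cases it is in [e i]. *)
Lemma tagged_point z k0 r0 y0 i : (forall p, ~ U p z) -> r0 * msr ^+ k0 <= 2^-1 -> 0 < r0 ->
  (forall y, cb z r0 y -> st k0 y <> inr None) -> cb z r0 y0 -> st k0 y0 = inr (Some i) ->
  forall p, closure (U p) z <-> e i p.
Proof.
move=> nU hr r00 nN h0 E0 p.
have tag y u : cb z r0 y -> st k0 y = inr u -> u = Some i.
  move=> hy Eu; case: (chi_adj_tag (Ordinal n0) (near_adj hr h0 hy) E0 Eu) => [<-//|//|Eu'].
  by case: (nN y hy); rewrite Eu Eu'.
split.
  move=> /(_ (cb z r0)) []; first by apply/nbhs_coordP; exists r0.
  move=> y [/U_st [k Ek] hy]; case E: (st k0 y) => [q|u].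
    have Eqp := st_uniq E Ek; subst q.
    by have := chi_adj (near_adj hr hy h0) E; rewrite /pish -/(st k0 y0) E0.
  have := st_desc E (_ : st (k0 + k) y = inl p); rewrite (tag _ _ hy E); apply.
  by rewrite addnC; apply: st_col.
move=> ep; apply: closure_mixed => k r rp.
have mp : 0 < Num.min r r0 by rewrite lt_min rp.
have [y [u [hy E]]] := mixed_near (k0 + k) nU mp.
have hy1 : cb z r y by apply: cb_le hy; rewrite ge_min lexx.
have hy2 : cb z r0 y by apply: cb_le hy; rewrite ge_min lexx orbT.
exists y, u; split=> //; first by apply: (@st_mix _ k0); rewrite addnC.
by rewrite (tag _ _ hy2 (st_mix E)).
Qed.

(** Outside the domains, either untagged undecided cubes accumulate at [z] at every stage, which
    makes every colour adherent, or at some stage they are absent from a neighbourhood of [z], where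
    a single tag remains. *)
Lemma classify z : [\/ exists p, U p z, forall p, closure (U p) z |
  exists i, forall p, closure (U p) z <-> e i p].
Proof.
case: (pselect (exists p, U p z)) => [|nU]; first exact: Or31.
have {}nU p : ~ U p z by move=> h; apply: nU; exists p.
case: (pselect (forall k r, 0 < r -> exists y, cb z r y /\ st k y = inr None)) => [H|].
  by apply: Or32 => p; apply: closure_mixed => k r /(H k) [y [hy E]]; exists y, None.
move/existsNP => [k0 /existsNP [r /not_implyP [rp H]]]; apply: Or33.
have [r' [r'0 r'r hr']] := small_r k0 rp.
have nN y : cb z r' y -> st k0 y <> inr None.
  by move=> hy E; apply: H; exists y; split=> //; apply: cb_le hy.
have [y0 [[i|] [hy0 E]]] := mixed_near k0 nU r'0; last by case: (nN _ hy0).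
exists i; exact: (@tagged_point z k0 r' y0 i nU hr' r'0 nN hy0 E).
Qed.

Lemma tag_point i : exists z, forall p, closure (U p) z <-> e i p.
Proof.
pose X0 : idx3 := fun=> (i.*2)%:Z.
(* All digits are even, so no cube around [z] is ever coloured. The one digit that is not zero moves
   [z] to distance at least [2 / msr ^+ 2] from the lower faces of the reserved cube, more than the
   radius [(msr ^+ 2)^-1] used below. *)
pose dig (k : nat) : idx3 := fun=> if k == 1%N then 2 else 0.
pose X := fix X k : idx3 := if k is k'.+1 then sub (X k') (dig k') else X0.
have m3 := msc_ge3 (Ordinal n0).
have hdig k : digit (dig k) by move=> j; rewrite /dig; case: eqP; lia.
have chiX k : chi k (X k) = inr (Some i).
  elim: k => [|k IH]; first by rewrite chi0 (tag0P _ i).2.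
  case E: (chi k.+1 _) => [q|u]; last by have := chiS_inr (hdig k) E; rewrite IH => ->.
  case: (chiS_inl (hdig k) E) => [|[u [_ _ /armP [a [h _ _]]]]]; first by rewrite IH.
  have [j [ja _]] := ord3_other a a; have := h _ ja; rewrite /dig /ctrc.
  by case: eqP => _; lia.
pose z : V := \row_j ((X 2%N j)%:~R / msr ^+ 2).
have idx2 k : idx k.+2 z = X k.+2.
  have E j : msr ^+ k.+2 * z ord0 j = (X k.+2 j)%:~R.
    elim: k => [|k IH]; first by rewrite mxE mulrC divfK // gt_eqF // msrX_gt0.
    by rewrite exprS -mulrA IH [X k.+3]/= /subcube /dig addr0 intrM.
  by apply/funext => j; rewrite /idx E intrKfloor.
have sub_inj x x' d d' : digit d -> digit d' -> sub x d = sub x' d' -> x = x'.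
  by move=> hd hd' E; apply/funext => j; rewrite -(divz_sub x j hd) E divz_sub.
have idx1 : idx 1 z = X 1%N.
  by have [d hd] := idxS 1 z; rewrite idx2 => /esym/sub_inj; apply.
have idx0 : idx 0 z = X 0%N.
  by have [d hd] := idxS 0 z; rewrite idx1 => /esym/sub_inj; apply.
have stz k : st k z = inr (Some i).
  by rewrite /st; case: k => [|[|k]]; rewrite ?idx0 ?idx1 ?idx2 chiX.
exists z; have m0 := msrX_gt0 2; have r3 := msr_ge3.
have r9 : 9 <= msr ^+ 2 by rewrite expr2; nra.
have zj j : z ord0 j = (i.*2)%:~R + 2 / msr ^+ 2.
  rewrite mxE /= /subcube /dig /= addr0 intrD intrM intrM -/msr.
  by field; rewrite gt_eqF // msr_gt0.
have y9 : 2 / msr ^+ 2 <= 2 / 9 by rewrite ler_pM2l // lef_pV2 ?posrE.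
have idxy y : cb z (msr ^+ 2)^-1 y -> idx 0 y = X0.
  move=> hy; apply/funext => j; apply: floor_def; rewrite expr0 mul1r intrD mulr1z.
  have := hy j; rewrite zj ltr_norml; set c := (msr ^+ 2)^-1 in y9 *.
  have c0 : 0 < c by rewrite invr_gt0.
  by move=> /andP [h1 h2]; rewrite /X0; apply/andP; split; lra.
apply: (@tagged_point z 0 (msr ^+ 2)^-1 z i) => //.
- by move=> p /U_st [k]; rewrite stz.
- by rewrite expr0 mulr1; set c := (msr ^+ 2)^-1 in y9 *; lra.
- by rewrite invr_gt0.
- by move=> y /idxy E; rewrite /st E chi0 (tag0P _ i).2.
- by apply: cb_center; rewrite invr_gt0.
Qed.

End Wada.
End Space.

End Domains.

(** * Realizing a finite sample in space *)

Section Realization.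

Local Open Scope classical_set_scope.

(** * Regular closed sets made of domains *)

Section Cells.
Variables (T : topologicalType) (n : nat) (U : 'I_n -> set T) (e : nat -> 'I_n -> bool).
Hypothesis oU : forall p, open (U p).
Hypothesis neU : forall p, U p !=set0.
Hypothesis cU : forall p, connected (U p).
Hypothesis dU : forall p q z, U p z -> U q z -> p = q.
Hypothesis cls : forall z, [\/ exists p, U p z, forall p, closure (U p) z |
  exists i, forall p, closure (U p) z <-> e i p].
Hypothesis ptU : forall i, exists z, forall p, closure (U p) z <-> e i p.
Hypothesis n0 : 0 < n.
Hypothesis e0 : forall i, exists p, e i p.

Lemma cl_U p q z : U p z -> closure (U q) z -> p = q.
Proof.
move=> Up cq; have [] := cq (U p); first by apply: open_nbhs_nbhs; split.
by move=> y [Uq Up']; apply: dU Up' Uq.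
Qed.

Lemma cl_cover z : exists p, closure (U p) z.
Proof.
case: (cls z) => [[p Up]|h|[i h]]; first by exists p; apply: subset_closure.
  by exists (Ordinal n0).
by have [p ep] := e0 i; exists p; apply/h.
Qed.

Definition cells (S : pred 'I_n) : set T := [set z | exists2 p, S p & closure (U p) z].

Lemma cells_closed S : closed (cells S).
Proof.
have key (s : seq 'I_n) : closed [set z | exists2 p, (p \in s) && S p & closure (U p) z].
  elim: s => [|q s IH].
    by rewrite (_ : [set z | _] = set0); [exact: closed0|apply/seteqP; split=> // z [p]].
  rewrite (_ : [set z | _] = (if S q then closure (U q) else set0) `|`
     [set z | exists2 p, (p \in s) && S p & closure (U p) z]).
    by apply: closedU => //; case: (S q); [exact: closed_closure|exact: closed0].
  apply/seteqP; split=> z.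
    case=> p; rewrite inE => /andP [/orP [/eqP ->|ps] Sp] cz; first by left; rewrite Sp.
    by right; exists p => //; rewrite ps.
  case=> [|[p /andP [ps Sp] cz]]; last by exists p => //; rewrite inE ps orbT.
  by case Sq: (S q) => // cz; exists q => //; rewrite inE eqxx.
rewrite (_ : cells S = [set z | exists2 p, (p \in enum 'I_n) && S p & closure (U p) z]); first exact: key.
by apply/seteqP; split=> z [p Sp cz]; exists p => //; move: Sp; rewrite mem_enum.
Qed.

(** Every point is adherent to some domain, and no domain meets the closure of another.
    Complementing the index set is therefore the complement of the Boolean algebra. *)
Lemma cells_opp S : closure (~` cells S) = cells (fun p => ~~ S p).
Proof.
apply/seteqP; split.
  rewrite [X in _ `<=` X](closure_id _).1; last exact: cells_closed.
  apply: closureS => z nz; have [p cp] := cl_cover z; exists p => //.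
  by apply/negP => Sp; apply: nz; exists p.
move=> z [p Sp cp]; apply: closureS cp => y Up [q Sq cq].
by rewrite (cl_U Up cq) Sq in Sp.
Qed.

Lemma cells_int S : (cells S)° = [set z | forall p, closure (U p) z -> S p].
Proof.
rewrite -[X in X°]setCK interiorC cells_opp; apply/seteqP; split=> z.
  by move=> h p cp; apply: contrapT => /negP Sp; apply: h; exists p.
by move=> h [p Sp cp]; rewrite (h p cp) in Sp.
Qed.

Lemma cells_ext S S' : S =1 S' -> cells S = cells S'.
Proof. by move=> h; apply/seteqP; split=> z [p Sp cp]; exists p => //; move: Sp; rewrite h. Qed.

Lemma cells_closure_int S : closure (cells S)° = cells S.
Proof.
rewrite -[in LHS](setCK (cells S)) interiorC cells_opp cells_opp.
by apply: cells_ext => p; rewrite negbK.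
Qed.

Lemma cells_mul S S' : rc_mul (cells S) (cells S') = cells (fun p => S p && S' p).
Proof.
rewrite /rc_mul interiorI -(cells_closure_int (fun p => S p && S' p)) !cells_int; congr closure.
apply/seteqP; split=> z; first by move=> [h1 h2] p cp; rewrite h1 ?h2.
by move=> h; split=> p /h /andP [].
Qed.

Lemma cells_sub S S' : cells S `<=` cells S' -> forall p, S p -> S' p.
Proof.
move=> h p Sp; have [z Uz] := neU p.
have [q Sq cq] : cells S' z by apply: h; exists p => //; apply: subset_closure.
by rewrite (cl_U Uz cq).
Qed.

Lemma U_int p (S : pred 'I_n) : S p -> U p `<=` (cells S)°.
Proof. by move=> Sp z Uz; rewrite cells_int => q cq; rewrite -(cl_U Uz cq). Qed.

(** The domains of the region, each enlarged by the common adherent point, form a connected set that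
    is dense in the interior. *)
Lemma cells_connected i : connected (cells (e i))°.
Proof.
have [z hz] := ptU i.
have c1 : connected (\bigcup_(p in [set p | e i p]) (U p `|` [set z])).
  apply: bigcup_connected; first by exists z => p _; right.
  move=> p ep; refine (@connected_between T (U p) _ (@cU p) _ _); first by move=> y; left.
  by move=> y [|->]; [exact: subset_closure|apply/hz].
refine (@connected_between T _ _ c1 _ _).
  move=> y [p ep [Up|->]]; first exact: U_int ep _ Up.
  by rewrite cells_int => q /hz.
move=> y /interior_subset [p ep cp]; apply: closureS cp => x Ux.
by exists p => //; left.
Qed.

Lemma cells_split S (l : pred 'I_n) : (exists p, S p && l p) -> (exists p, S p && ~~ l p) ->
  (exists p, ~~ S p) ->
  (forall i, [\/ exists p, e i p && ~~ S p, forall p, e i p -> l p | forall p, e i p -> ~~ l p]) ->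
  ~ connected (cells S)°.
Proof.
move=> [p1 /andP [S1 l1]] [p2 /andP [S2 l2]] [p3 S3] He; apply/connectedPn.
pose E b := (cells S)° `&` cells (fun p => l p == b).
have ncl z : (cells S)° z -> cells (fun p => l p == false) z -> cells (fun p => l p == true) z -> False.
  rewrite cells_int => hS [p /eqP lp cp] [q /eqP lq cq].
  case: (cls z) => [[p0 U0]|h|[i h]].
  - by move: lp lq; rewrite -(cl_U U0 cp) -(cl_U U0 cq) => ->.
  - by rewrite (hS _ (h p3)) in S3.
  - case: (He i) => [[x /andP [ex Sx]]|hl|hl].
    + by rewrite (hS _ ((h x).2 ex)) in Sx.
    + by rewrite hl in lp => //; apply/h.
    + by have := hl q ((h q).1 cq); rewrite lq.
exists E; split.
- case.
    have [z Uz] := neU p1; exists z; split; first exact: U_int S1 _ Uz.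
    by exists p1; [rewrite l1|apply: subset_closure].
  have [z Uz] := neU p2; exists z; split; first exact: U_int S2 _ Uz.
  by exists p2; [rewrite (negbTE l2)|apply: subset_closure].
- apply/seteqP; split=> z; last by case=> -[].
  move=> Sz; have [p cp] := cl_cover z.
  case: (boolP (l p)) => lp; [right|left]; split=> //; exists p => //; apply/eqP => //.
  exact: negbTE.
- split; apply/seteqP; split=> // z.
    case=> cz [Sz h]; apply: (ncl z) => //.
    have := closureI cz => -[_]; by rewrite -(closure_id _).1 //; exact: cells_closed.
  case=> -[Sz h] cz; apply: (ncl z) => //.
  have := closureI cz => -[_]; by rewrite -(closure_id _).1 //; exact: cells_closed.
Qed.

Lemma cells_eval (v : 'I_n -> nat -> bool) : exists I : interpretation T,
  forall t, eval I t = cells (fun p => bev (v p) t).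
Proof.
exists (@Interpretation T (fun i => cells (fun p => v p i))
  (fun i => esym (cells_closure_int (fun p => v p i)))).
elim=> [i|||t1 IH1 t2 IH2|t1 IH1 t2 IH2|t1 IH1] //=.
- by apply/seteqP; split=> // z [].
- by apply/seteqP; split=> // z _; have [p cp] := cl_cover z; exists p.
- rewrite IH1 IH2; apply/seteqP; split=> z.
    by case=> -[p Sp cp]; exists p => //; rewrite Sp ?orbT.
  by case=> p /orP [] Sp cp; [left|right]; exists p.
- by rewrite IH1 IH2 cells_mul.
- by rewrite IH1 /rc_opp cells_opp.
Qed.

End Cells.

(** * From samples to interpretations and back *)

Section Satisfiability.
Variable R : realType.
Notation V := 'rV[R]_3.

Lemma realize phi (P : seq point) (g : nat -> bool) : let A := atoms phi in
  0 < size P -> good A P g ->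
  exists I : interpretation V, forall k, k < size A -> models I (anth A k) <-> g k.
Proof.
move=> A P0 G; pose n := size P; pose d : point := (fun=> false, fun=> false).
pose pt (p : 'I_n) := nth d P p.
have hasn (Q : pred point) : has Q P -> exists p : 'I_n, Q (pt p).
  by case/(has_nthP d) => i lt Qi; exists (Ordinal lt).
have alln (Q : pred point) : all Q P -> forall p : 'I_n, Q (pt p).
  by move=> /(all_nthP d) h p; apply: h.
(* Only nonempty regions required to be connected are passed to the construction. All other indices
   get the full set of colours, which keeps every [e i] nonempty and splits no region that misses a
   colour. *)
pose act k := [&& k < size A, isconn (anth A k), g k & [exists q, aval (pt q) (anth A k)]].
pose e k p := if act k then aval (pt p) (anth A k) else true.
have e0 i : exists p, e i p.
  rewrite /e; case E: (act i); last by exists (Ordinal P0).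
  by case/and4P: E => _ _ _ /existsP [q hq]; exists q.
pose W := @U R n e.
have oW := @U_open R n e; have neW := @U_nonempty R n e P0; have cW := @U_connected R n e P0.
have dW := @U_disj R n e P0; have clsW := @classify R n e P0; have ptW := @tag_point R n e P0.
have [I hI] := cells_eval oW dW clsW P0 e0 (fun p => (pt p).1).
exists I => k kA; have := G k kA; have [[t [u Ea]]|[t Ea]] := atoms_atomic kA; rewrite -/A in Ea; rewrite Ea /=.
  move=> ->; rewrite !hI; split.
    move=> E; apply/(all_nthP d) => i lt /=; have := cells_sub oW neW dW (S := fun p => bev (pt p).1 t).
    move=> h; apply/eqP; apply/idP/idP => b.
      by apply: (h (fun p => bev (pt p).1 u) _ (Ordinal lt)) => //; rewrite E.
    by apply: (cells_sub oW neW dW (S := fun p => bev (pt p).1 u) (S' := fun p => bev (pt p).1 t) _ (p := Ordinal lt)) => //; rewrite E.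
  by move/alln => h; apply: cells_ext => p; apply/eqP/h.
rewrite hI => H; split; last first.
  move=> gk; case: (pselect (exists q, aval (pt q) (anth A k))) => [[q hq]|nq].
    rewrite (cells_ext _ (S' := e k)); first exact: cells_connected.
    move=> p; rewrite /e /act kA Ea gk /=; case: existsP => //.
    by case; exists q; move: hq; rewrite Ea.
  rewrite (_ : cells _ _ = set0); first by rewrite interior0; exact: connected0.
  by apply/seteqP; split=> // z [p bp _]; case: nq; exists p; rewrite Ea.
case: H => [//|[h1 h2 h3 h4]] c; exfalso; move: c.
apply: (cells_split oW neW dW clsW P0 e0 (l := fun p => (pt p).2 k)).
- exact: (hasn _ h1).
- exact: (hasn _ h2).
- exact: (hasn _ h3).
- move=> i; rewrite /e; case E: (act i); last first.
    by have [p hp] := hasn _ h3; apply: Or31; exists p.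
  case/and4P: E => iA ci gi _; case: (h4 i iA ci gi) => [h|h|h].
  + exact/Or31/(hasn _ h).
  + by apply: Or32 => p hp; have := alln _ h p; rewrite hp.
  + by apply: Or33 => p hp; have := alln _ h p; rewrite hp.
Qed.

(** A repeated atom could a priori receive different values of [g] at its different positions; truth
    in the realizing interpretation supplies one value per atom. *)
Lemma sat_of_good phi (P : seq point) (g : nat -> bool) : 0 < size P -> good (atoms phi) P g ->
  exists c : formula -> bool, (forall k, k < size (atoms phi) -> c (anth (atoms phi) k) = g k) /\
    (feval c phi -> satisfiable V phi).
Proof.
move=> P0 G; have [I hI] := realize P0 G; exists (fun a => `[< models I a >]); split.
  by move=> k kA; apply/asboolP/idP => /hI; apply.
move=> h; exists I; have H k : k < size (atoms phi) ->
    models I (anth (atoms phi) k) <-> `[< models I (anth (atoms phi) k) >].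
  by move=> _; split=> [?|/asboolP //]; apply/asboolP.
exact: (models_feval (c := fun a => `[< models I a >]) H).2 h.
Qed.

Lemma space_connected : connected [set: V].
Proof.
have -> : [set: V] = connected_component ([set: V]) (0%R : V).
  by apply/seteqP; split=> // z _; apply: seg_joined.
exact: component_connected.
Qed.

Lemma good_of_sat phi : satisfiable V phi -> exists (P : seq point) (c : formula -> bool),
  let A := atoms phi in
  [/\ size P = size A * size A + 3 * size A + 1, good A P (fun k => c (anth A k)) & feval c phi].
Proof.
case=> I mI; have [P [sP gP]] := sample I phi space_connected (0%R : V).
exists P, (fun a => `[< models I a >]); split=> //.
have H k : k < size (atoms phi) ->
    models I (anth (atoms phi) k) <-> `[< models I (anth (atoms phi) k) >].
  by move=> _; split=> [?|/asboolP //]; apply/asboolP.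
exact: (models_feval (c := fun a => `[< models I a >]) H).1 mI.
Qed.

(** A generic point turns an interpretation into a valuation; conversely, a valuation is realized
    with the empty set and the whole space. *)
Lemma sat_equations (fs : seq (term * term)) :
  satisfiable V (foldr And (Equal Zero Zero) [seq Equal p.1 p.2 | p <- fs]) <->
  exists v : nat -> bool, all (fun p => bev v p.1 == bev v p.2) fs.
Proof.
split.
  case=> I mI; pose N := foldr maxn 0 [seq maxn (tbound p.1) (tbound p.2) | p <- fs].
  have [z _ gz] := @generic_exists V I N setT openT (ex_intro _ (0%R : V) Logic.I).
  exists (fun v => `[< I v z >]); rewrite /N in gz.
  elim: fs {N} mI gz => //= -[t u] fs IH [/= E mI] gz; apply/andP; split.
    have tN : tbound t <= foldr maxn 0 [seq maxn (tbound p.1) (tbound p.2) | p <- (t, u) :: fs] by rewrite /=; lia.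
    have uN : tbound u <= foldr maxn 0 [seq maxn (tbound p.1) (tbound p.2) | p <- (t, u) :: fs] by rewrite /=; lia.
    have := genericP gz tN; have := genericP gz uN; rewrite E.
    by case: (bev _ u); case: (bev _ t) => // h1 h2; [case: h2; exact: interior_subset|case: h1; exact: interior_subset].
  by apply: IH mI _ => v lt; apply: gz => /=; lia.
case=> v hv.
have reg i : regular_closed (if v i then [set: V] else set0).
  by rewrite /regular_closed; case: (v i); rewrite ?interiorT ?closureT ?interior0 ?closure0.
pose I := @Interpretation V (fun i => if v i then setT else set0) reg.
have ev t : eval I t = if bev v t then setT else set0.
  elim: t => [i|||t1 IH1 t2 IH2|t1 IH1 t2 IH2|t1 IH1] //=; rewrite ?IH1 ?IH2 /rc_add /rc_mul /rc_opp.
  - by case: (bev v t1); case: (bev v t2); rewrite ?setTU ?setUT ?setU0.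
  - by case: (bev v t1); case: (bev v t2); rewrite /= ?setTI ?set0I ?setI0 ?interiorT ?closureT ?interior0 ?closure0.
  - by case: (bev v t1); rewrite /= ?setCT ?setC0 ?closureT ?closure0.
exists I; elim: fs hv => //= -[t u] fs IH /andP [/eqP E h]; split; last exact: IH.
by rewrite /= !ev E.
Qed.

End Satisfiability.

End Realization.

(** * The verifier *)

(** Syntax-directed: the shape of the function body selects the closure property. The rule for
    conditionals comes last because its pattern matches any body. *)
Ltac pt1 :=
  cbv beta;
  lazymatch goal with
  | |- ptm (fun x => x) => exact: pt_id
  | |- ptm (fun _ => ?c) => exact: pt_const
  | |- ptm (@fst _ _) => apply: (pt_fst (f := fun x => x))
  | |- ptm (@snd _ _) => apply: (pt_snd (f := fun x => x))
  | |- ptm (fun x => fst (@?f x)) => apply: (pt_fst (f := f))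
  | |- ptm (fun x => snd (@?f x)) => apply: (pt_snd (f := f))
  | |- ptm (fun x => (@?f x, @?g x)) => apply: (pt_pair (f := f) (g := g))
  | |- ptm (fun x => @?f x :: @?g x) => apply: (pt_cons (a := f) (l := g))
  | |- ptm (fun x => @?f x ++ @?g x) => apply: (pt_cat (a := f) (b := g))
  | |- ptm (fun x => ~~ @?f x) => apply: (pt_negb (f := f))
  | |- ptm (fun x => @?f x && @?g x) => apply: (pt_andb (f := f) (g := g))
  | |- ptm (fun x => @?f x || @?g x) => apply: (pt_orb (f := f) (g := g))
  | |- ptm (fun x => @?f x ==> @?g x) => apply: (pt_implb (f := f) (g := g))
  | |- ptm (fun x => rev (@?f x)) => apply: (pt_rev (l := f))
  | |- ptm (fun x => flatten (@?f x)) => apply: (pt_flatten (l := f))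
  | |- ptm (fun x => behead (@?f x)) => apply: (pt_behead (l := f))
  | |- ptm (fun x => size (@?f x)) => apply: (pt_size (l := f))
  | |- ptm (fun x => nth ?d (@?f x) (@?g x)) => apply: (@pt_nth _ _ _ _ _ d f g)
  | |- ptm (fun x => drop (@?g x) (@?f x)) => apply: (pt_drop (l := f) (k := g))
  | |- ptm (fun x => iota (@?g x) (@?f x)) => apply: (pt_iota (m := g) (n := f))
  | |- ptm (fun x => nseq (@?g x) (@?f x)) => apply: (pt_nseq (k := g) (y := f))
  | |- ptm (fun x => has (@?a x) (@?l x)) => apply: (pt_has (a := a) (l := l))
  | |- ptm (fun x => all (@?a x) (@?l x)) => apply: (pt_all (a := a) (l := l))
  | |- ptm (fun x => map (@?a x) (@?l x)) => apply: (pt_map (F := a) (l := l))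
  | |- ptm (fun x => S (@?f x)) => apply: (pt_succ (a := f))
  | |- ptm (fun x => addn (@?f x) (@?g x)) => apply: (pt_addn (a := f) (b := g))
  | |- ptm (fun x => muln (@?f x) (@?g x)) => apply: (pt_muln (a := f) (b := g))
  | |- ptm (fun x => @eq_op _ (@?f x) (@?g x)) =>
      first [apply: (pt_eqb (f := f) (g := g)) | apply: (pt_eqbits (a := f) (b := g))]
  | |- ptm (fun x => @?f x) => apply: pt_if
  end.
Ltac pts := repeat first [assumption | pt1].

(** * Lexical analysis *)

Definition lexeme := (token * seq bool)%type.

Definition lex_step (a : token) (s : seq bool * seq lexeme) : seq bool * seq lexeme :=
  if a is TBit b then (b :: s.1, s.2) else ([::], (a, s.1) :: s.2).

Definition lex (w : seq token) := foldr lex_step ([::], [::]) w.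

Definition unlex (l : seq lexeme) : seq token := flatten [seq x.1 :: map TBit x.2 | x <- l].

Fixpoint lterm (t : term) : seq lexeme :=
  match t with
  | Var v => [:: (TVar, bits_of_nat v)]
  | Zero => [:: (TZero, [::])]
  | One => [:: (TOne, [::])]
  | Add t1 t2 => (TAdd, [::]) :: lterm t1 ++ lterm t2
  | Mul t1 t2 => (TMul, [::]) :: lterm t1 ++ lterm t2
  | Opp t1 => (TOpp, [::]) :: lterm t1
  end.

Fixpoint lformula (f : formula) : seq lexeme :=
  match f with
  | Equal t1 t2 => (TEqual, [::]) :: lterm t1 ++ lterm t2
  | IntConn t => (TIntConn, [::]) :: lterm t
  | And f1 f2 => (TAnd, [::]) :: lformula f1 ++ lformula f2
  | Not f1 => (TNot, [::]) :: lformula f1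
  end.

Lemma lex_unlex w : w = map TBit (lex w).1 ++ unlex (lex w).2.
Proof. by elim: w => [|[|b|||||||||] w IH] //=; rewrite {1}IH. Qed.

Lemma lex_term t s : (lex s).1 = [::] -> lex (encode_term t ++ s) = ([::], lterm t ++ (lex s).2).
Proof.
elim: t s => [v|||t1 IH1 t2 IH2|t1 IH1 t2 IH2|t1 IH1] s hs //=; rewrite -?catA.
- have -> : lex (map TBit (bits_of_nat v) ++ s) =
      (bits_of_nat v ++ (lex s).1, (lex s).2).
    by elim: (bits_of_nat v) => [|b l IH] /=; rewrite ?IH //; rewrite -/(lex s); case: (lex s).
  by rewrite hs cats0.
- by rewrite -/(lex s) /lex_step hs.
- by rewrite -/(lex s) /lex_step hs.
- by rewrite -/(lex _) IH1 IH2 //= -catA.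
- by rewrite -/(lex _) IH1 IH2 //= -catA.
- by rewrite -/(lex _) IH1.
Qed.

Lemma lex_formula f s : (lex s).1 = [::] -> lex (encode f ++ s) = ([::], lformula f ++ (lex s).2).
Proof.
elim: f s => [t1 t2|t|f1 IH1 f2 IH2|f1 IH1] s hs //=; rewrite -?catA.
- by rewrite -/(lex _) lex_term lex_term //= -catA.
- by rewrite -/(lex _) lex_term.
- by rewrite -/(lex _) IH1 IH2 //= -catA.
- by rewrite -/(lex _) IH1.
Qed.

Lemma lex_encode f : lex (encode f) = ([::], lformula f).
Proof. by rewrite -[encode f]cats0 lex_formula //= cats0. Qed.

(** * Recognizing the codes of formulas *)

Definition arity (a : token) : nat :=
  match a with
  | TAdd | TMul | TEqual | TAnd => 2
  | TOpp | TIntConn | TNot => 1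
  | _ => 0
  end.
Definition arg_kind (a : token) : bool := if a is TAnd then true else if a is TNot then true else false.
Definition res_kind (a : token) : bool :=
  match a with TEqual | TIntConn | TAnd | TNot => true | _ => false end.
Definition isvar (a : token) : bool := if a is TVar then true else false.
Definition isbit (a : token) : bool := if a is TBit _ then true else false.

(* A stack of kinds, [true] for formulas and [false] for terms. *)
Definition wf_step (x : lexeme) (s : bool * seq bool) : bool * seq bool :=
  let k := arity x.1 in
  ([&& s.1, ~~ isbit x.1, if isvar x.1 then foldl (fun _ y => y) true x.2 else x.2 == [::] &
       s.2 == nseq k (arg_kind x.1) ++ drop k s.2],
   res_kind x.1 :: drop k s.2).

Definition wf (w : seq token) : bool :=
  let s := foldr wf_step (true, [::]) (lex w).2 in
  [&& (lex w).1 == [::], s.1 & s.2 == [:: true]].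

Lemma wf_term t l : foldr wf_step (true, [::]) (lterm t ++ l) =
  let s := foldr wf_step (true, [::]) l in (s.1, false :: s.2).
Proof.
elim: t l => [v|||t1 IH1 t2 IH2|t1 IH1 t2 IH2|t1 IH1] l /=; rewrite /wf_step /= ?drop0 ?eqxx ?andbT //.
- suff -> : foldl (fun _ y => y) true (bits_of_nat v) by rewrite andbT.
  rewrite /bits_of_nat; case: (bin_of_nat v) => // p.
  by elim: p true => //= p IH b; apply: IH.
- by rewrite -catA IH1 IH2 /= drop0 eqxx andbT.
- by rewrite -catA IH1 IH2 /= drop0 eqxx andbT.
- by rewrite IH1 /= drop0 eqxx andbT.
Qed.

Lemma wf_formula f l : foldr wf_step (true, [::]) (lformula f ++ l) =
  let s := foldr wf_step (true, [::]) l in (s.1, true :: s.2).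
Proof.
elim: f l => [t1 t2|t|f1 IH1 f2 IH2|f1 IH1] l /=; rewrite /wf_step /=.
- by rewrite -catA !wf_term /= drop0 eqxx andbT.
- by rewrite wf_term /= drop0 eqxx andbT.
- by rewrite -catA IH1 IH2 /= drop0 eqxx andbT.
- by rewrite IH1 /= drop0 eqxx andbT.
Qed.

Lemma wf_encode f : wf (encode f).
Proof. by rewrite /wf lex_encode -[lformula f]cats0 wf_formula. Qed.

Definition pos_of_bits (l : seq bool) : positive := foldr (fun b p => if b then xI p else xO p) xH l.
(** Adding a leading digit 1 makes an arbitrary bit string the canonical expansion of a variable
    index. The tableau variables are named in this way too. *)
Definition var_of (l : seq bool) : nat := nat_of_bin (Npos (pos_of_bits l)).

Lemma bits_var_of l : bits_of_nat (var_of l) = rcons l true.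
Proof.
rewrite /bits_of_nat /var_of nat_of_binK.
by elim: l => //= b l <-; case: b.
Qed.

(** The fold is the last, most significant, digit with default [true]: an expansion is canonical iff
    it is empty or ends in 1. *)
Lemma bits_surj l : foldl (fun _ y => y) true l -> exists v, bits_of_nat v = l.
Proof.
case/lastP: l => [|l b]; first by exists 0.
by rewrite -cats1 foldl_cat /= => ->; exists (var_of l); rewrite bits_var_of cats1.
Qed.

Definition item := (term + formula)%type.
Definition enc_item (i : item) := match i with inl t => encode_term t | inr f => encode f end.
Definition item_kind (i : item) : bool := if i is inr _ then true else false.

Lemma wf_sound l s : foldr wf_step (true, [::]) l = (true, s) ->
  exists is_ : seq item, unlex l = flatten (map enc_item is_) /\ s = map item_kind is_.
Proof.
elim: l s => [|[a b] l IH] s /=; first by case=> <-; exists [::].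
case E: (foldr _ _ l) => [k s']; rewrite /wf_step /= => -[/and4P [hk nb hb /eqP hs] <-].
rewrite hk in E; have [it [El Es]] := IH _ E; rewrite /unlex /= -/(unlex l) El.
move: hs hb nb; rewrite Es; case: a => [|c|||||||||] //=.
- move=> _ /bits_surj [v <-] _; exists (inl (Var v) :: it) => /=.
  by rewrite drop0.
- by move=> _ /eqP -> _; exists (inl Zero :: it); rewrite /= drop0.
- by move=> _ /eqP -> _; exists (inl One :: it); rewrite /= drop0.
- case: it {El Es} => [|[t1|?] [|[t2|?] it]] //= _ /eqP -> _; exists (inl (Add t1 t2) :: it).
  by rewrite /= drop0 -catA.
- case: it {El Es} => [|[t1|?] [|[t2|?] it]] //= _ /eqP -> _; exists (inl (Mul t1 t2) :: it).
  by rewrite /= drop0 -catA.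
- case: it {El Es} => [|[t1|?] it] //= _ /eqP -> _; exists (inl (Opp t1) :: it).
  by rewrite /= drop0.
- case: it {El Es} => [|[t1|?] [|[t2|?] it]] //= _ /eqP -> _; exists (inr (Equal t1 t2) :: it).
  by rewrite /= drop0 -catA.
- case: it {El Es} => [|[t1|?] it] //= _ /eqP -> _; exists (inr (IntConn t1) :: it).
  by rewrite /= drop0.
- case: it {El Es} => [|[?|f1] [|[?|f2] it]] //= _ /eqP -> _; exists (inr (And f1 f2) :: it).
  by rewrite /= drop0 -catA.
- case: it {El Es} => [|[?|f1] it] //= _ /eqP -> _; exists (inr (Not f1) :: it).
  by rewrite /= drop0.
Qed.

Lemma wfP w : reflect (exists f, w = encode f) (wf w).
Proof.
apply: (iffP idP) => [|[f ->]]; last exact: wf_encode.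
rewrite /wf; case E: (foldr _ _ _) => [k s] /and3P [/eqP hb /= hk /eqP hs].
rewrite hk in E; have [it [El Es]] := wf_sound E.
have := lex_unlex w; rewrite hb El /= => ->.
move: Es; rewrite hs; case: it {El} => [|[?|f] [|? ?]] // _.
by exists f; rewrite /= cats0.
Qed.

(* Prefix notation is evaluated by a stack machine scanning from the right; the
   values of the atoms are recorded in the second component. *)
Definition ev_ar (a : token) : nat :=
  match a with TAdd | TMul | TEqual => 2 | TOpp | TIntConn => 1 | _ => 0 end.
Definition ev_psh (a : token) : bool :=
  match a with TVar | TZero | TOne | TAdd | TMul | TOpp => true | _ => false end.
Definition isatom (a : token) : bool :=
  match a with TEqual | TIntConn => true | _ => false end.
Definition ev_fun (a : token) (m b1 b2 : bool) : bool :=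
  match a with
  | TVar => m | TOne => true | TAdd => b1 || b2 | TMul => b1 && b2 | TOpp => ~~ b1
  | TEqual => b1 == b2 | TIntConn => b1 | _ => false
  end.

Definition ev_step (X : seq (seq bool)) (x : lexeme) (s : seq bool * seq bool) : seq bool * seq bool :=
  let v := ev_fun x.1 (has (fun y => y == x.2) X) (nth false s.1 0) (nth false s.1 1) in
  let r := drop (ev_ar x.1) s.1 in
  (if ev_psh x.1 then v :: r else r, if isatom x.1 then v :: s.2 else s.2).

Definition evals X l := foldr (ev_step X) ([::], [::]) l.

(** [X] lists the names of the variables that are true at the sample point. *)
Definition val_of (X : seq (seq bool)) (v : nat) : bool := has (fun y => y == bits_of_nat v) X.

Lemma ev_term X t l : evals X (lterm t ++ l) =
  let s := evals X l in (bev (val_of X) t :: s.1, s.2).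
Proof.
rewrite /evals; elim: t l => [v|||t1 IH1 t2 IH2|t1 IH1 t2 IH2|t1 IH1] l /=; rewrite /ev_step /= ?drop0 //.
- by rewrite -catA IH1 IH2 /= drop0.
- by rewrite -catA IH1 IH2 /= drop0.
- by rewrite IH1 /= drop0.
Qed.

Lemma ev_formula X f l : evals X (lformula f ++ l) =
  let s := evals X l in
  (s.1, [seq aval (val_of X, fun=> false) a | a <- atoms f] ++ s.2).
Proof.
elim: f l => [t1 t2|t|f1 IH1 f2 IH2|f1 IH1] l /=.
- by rewrite -catA {1}/evals /= -/(evals X _) !ev_term /ev_step /= drop0.
- by rewrite {1}/evals /= -/(evals X _) !ev_term /ev_step /= drop0.
- by rewrite -catA {1}/evals /= -/(evals X _) IH1 IH2 /ev_step /= drop0 map_cat catA.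
- by rewrite {1}/evals /= -/(evals X _) IH1 /ev_step /= drop0.
Qed.

Definition tr_ar (a : token) : nat := match a with TAnd => 2 | TNot => 1 | _ => 0 end.
Definition tr_fun (a : token) (m b1 b2 : bool) : bool :=
  match a with
  | TEqual | TIntConn => m | TAnd => b1 && b2 | TNot => ~~ b1 | _ => false
  end.

(** The second component is the queue of atom values not yet used. Scanning from the right meets the
    last atom first, so the queue is supplied in reverse order. *)
Definition tr_step (x : lexeme) (s : seq bool * seq bool) : seq bool * seq bool :=
  let v := tr_fun x.1 (nth false s.2 0) (nth false s.1 0) (nth false s.1 1) in
  (if res_kind x.1 then v :: drop (tr_ar x.1) s.1 else s.1,
   if isatom x.1 then behead s.2 else s.2).

Definition truth g l := foldr tr_step ([::], g) l.

Lemma tr_term t l g : truth g (lterm t ++ l) = truth g l.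
Proof.
rewrite /truth; elim: t l => [v|||t1 IH1 t2 IH2|t1 IH1 t2 IH2|t1 IH1] l /=; rewrite -?catA ?IH1 ?IH2 /tr_step /=;
  by case: (foldr _ _ l).
Qed.

Lemma tr_formula (c : formula -> bool) f l g s : (truth g l).2 = rev [seq c a | a <- atoms f] ++ s ->
  truth g (lformula f ++ l) = (feval c f :: (truth g l).1, s).
Proof.
elim: f l s => [t1 t2|t|f1 IH1 f2 IH2|f1 IH1] l s /= E.
- by rewrite -catA {1}/truth /= -/(truth g _) !tr_term /tr_step /= drop0 E.
- by rewrite {1}/truth /= -/(truth g _) !tr_term /tr_step /= drop0 E.
- move: E; rewrite map_cat rev_cat -catA => /IH2 E.
  rewrite -catA {1}/truth /= -/(truth g _) (IH1 _ s) E //=.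
  by rewrite /tr_step /= drop0.
- by rewrite {1}/truth /= -/(truth g _) (IH1 _ s) // /tr_step /= drop0.
Qed.

Definition conn_kinds (l : seq lexeme) : seq bool :=
  flatten [seq (if isatom x.1 then [:: if x.1 is TIntConn then true else false] else [::]) | x <- l].

Lemma kinds_formula f : conn_kinds (lformula f) = map isconn (atoms f).
Proof.
have kc l l' : conn_kinds (l ++ l') = conn_kinds l ++ conn_kinds l'.
  by rewrite /conn_kinds map_cat flatten_cat.
have kt t : conn_kinds (lterm t) = [::].
  by elim: t => //= t1 IH1 t2 IH2; rewrite /conn_kinds /= -/(conn_kinds _) kc IH1 IH2.
elim: f => [t1 t2|t|f1 IH1 f2 IH2|f1 IH1] /=; rewrite /conn_kinds /= -/(conn_kinds _).
- by rewrite kc !kt.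
- by rewrite kt.
- by rewrite kc IH1 IH2 map_cat.
- by [].
Qed.

(** One sample point of a certificate: a mark for each lexeme of the word, saying whether its name
    is true there, and a side for each atom. Both lengths are determined by the word. *)
Definition row := (seq bool * seq bool)%type.
Definition cert := (seq row * seq bool)%type.

Definition chk (x : seq row * (seq bool * seq bool)) (k : nat) : bool :=
  if nth false x.2.1 k then
    nth false x.2.2 k ||
    [&& has (fun r : row => nth false r.1 k && nth false r.2 k) x.1,
        has (fun r : row => nth false r.1 k && ~~ nth false r.2 k) x.1,
        has (fun r : row => ~~ nth false r.1 k) x.1 &
        all (fun i => (nth false x.2.1 i && nth false x.2.2 i) ==>
           [|| has (fun r : row => nth false r.1 i && ~~ nth false r.1 k) x.1,
               all (fun r : row => nth false r.1 i ==> nth false r.2 k) x.1 |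
               all (fun r : row => nth false r.1 i ==> ~~ nth false r.2 k) x.1])
          (iota 0 (size x.2.1))]
  else nth false x.2.2 k == all (fun r : row => nth false r.1 k) x.1.

Definition sel_step (x : seq bool) (s : seq bool * seq (seq bool)) : seq bool * seq (seq bool) :=
  (behead s.1, if nth false s.1 0 then x :: s.2 else s.2).
(** A name is true if one of its occurrences is marked. Lexemes that are not variables have the
    empty name, which is also that of variable 0; this is harmless, as any marking still defines a
    valuation. *)
Definition sel (m : seq bool) (names : seq (seq bool)) : seq (seq bool) :=
  (foldl (fun s x => sel_step x s) (m, [::]) names).2.

Definition verify (p : cert * seq token) : bool :=
  let l := (lex p.2).2 in
  let kinds := conn_kinds l in
  let names := [seq x.2 | x <- l] in
  let rows := [seq ((evals (sel r.1 names) l).2, r.2) | r : row <- p.1.1] in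
  [&& wf p.2, 0 < size rows,
      all (chk (rows, (kinds, p.1.2))) (iota 0 (size kinds)) &
      nth false (truth (rev [seq nth false p.1.2 k | k <- iota 0 (size kinds)]) l).1 0].

Definition template (w : seq token) : cert :=
  let l := (lex w).2 in let a := size (conn_kinds l) in
  (nseq (a * a + 3 * a + 1) (nseq (size l) false, nseq a false), nseq a false).

(** * The verifier runs in polynomial time *)

Section Ptime.
Variable Sigma : finType.
Local Notation enc := (enc Sigma).
Local Notation ptm := (@ptm Sigma _ _ _ _).
Local Notation esz := (@esz Sigma _ _).

Lemma pt_tok X Y (eX : enc X) (eY : enc Y) (h : token -> Y) (a : X -> token) : ptm a -> ptm (fun x => h (a x)).
Proof. by move=> ha; apply: (pt_comp (g := h)) ha; apply: pt_token. Qed.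

Lemma pt_tok3 X (eX : enc X) (h : token -> bool -> bool -> bool -> bool) (a : X -> token) (b c d : X -> bool) :
  ptm a -> ptm b -> ptm c -> ptm d -> ptm (fun x => h (a x) (b x) (c x) (d x)).
Proof.
move=> ha hb hc hd.
apply: (pt_ext (f := fun x => if b x then
   if c x then if d x then h (a x) true true true else h (a x) true true false
          else if d x then h (a x) true false true else h (a x) true false false
   else if c x then if d x then h (a x) false true true else h (a x) false true false
          else if d x then h (a x) false false true else h (a x) false false false)).
  by move=> x; case: (b x); case: (c x); case: (d x).
by pts; apply: (@pt_tok _ _ _ _ (fun t => h t _ _ _)).
Qed.

Lemma esz_drop X {eX : enc X} k (s : seq X) : esz (drop k s) <= esz s.
Proof.
elim: s k => [|x s IH] [|k] //=; rewrite esz_seq.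
by have := IH k; lia.
Qed.

Lemma pt_lex X (eX : enc X) (w : X -> seq token) : ptm w -> ptm (fun x => lex (w x)).
Proof.
move=> hw; rewrite /lex.
apply: (@pt_foldr _ _ _ _ _ _ _ (fun _ a s => lex_step a s) _ _ (fun n => n + 4)) => //; try by pbd.
- by move=> m n; lia.
- move=> x a [b l]; rewrite /lex_step; case: a => [|c|||||||||] /=;
    rewrite !esz_pair ?esz_seq ?esz_pair ?esz_nil ?esz_bool; lia.
- apply: (pt_ext (f := fun p : token * (X * (seq bool * seq lexeme)) =>
     if isbit p.1 then ((if p.1 is TBit b then b else false) :: p.2.2.1, p.2.2.2)
     else ([::], (p.1, p.2.2.1) :: p.2.2.2))).
    by case=> -[|c|||||||||] [? []].
  pts.
  by apply: (@pt_tok _ _ _ _ isbit); pts.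
  by apply: (@pt_tok _ _ _ _ (fun a => if a is TBit b then b else false)); pts.
- by pts.
Qed.

Lemma pt_wf X (eX : enc X) (w : X -> seq token) : ptm w -> ptm (fun x => wf (w x)).
Proof.
move=> hw.
have h : ptm (fun x => foldr wf_step (true, [::]) (lex (w x)).2).
  apply: (@pt_foldr _ _ _ _ _ _ _ (fun _ a s => wf_step a s) _ _ (fun n => n + 4)) => //; try by pbd.
  - by move=> m n; lia.
  - move=> x [a b] [c s]; rewrite /wf_step /= !esz_pair esz_seq !esz_bool.
    by have := @esz_drop _ (enc_bool Sigma) (arity a) s; lia.
  - rewrite /wf_step; pts.
    + by apply: (@pt_tok _ _ _ _ isbit); pts.
    + by apply: (@pt_tok _ _ _ _ isvar); pts.
    + by apply: (@pt_foldl_bool _ _ _ _ _ (fun _ y _ => y)); pts.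
    + by apply: (@pt_tok _ _ _ _ arity); pts.
    + by apply: (@pt_tok _ _ _ _ arg_kind); pts.
    + by apply: (@pt_tok _ _ _ _ arity); pts.
    + by apply: (@pt_tok _ _ _ _ res_kind); pts.
    + by apply: (@pt_tok _ _ _ _ arity); pts.
  - by pts.
  - by apply: pt_snd; apply: pt_lex.
rewrite /wf; pts.
by apply: pt_lex.
Qed.

Lemma pt_evals X (eX : enc X) (Y : X -> seq (seq bool)) (l : X -> seq lexeme) :
  ptm Y -> ptm l -> ptm (fun x => evals (Y x) (l x)).
Proof.
move=> hY hl; rewrite /evals.
apply: (@pt_foldr _ _ _ _ _ _ _ (fun x a s => ev_step (Y x) a s) _ _ (fun n => n + 4)) => //; try by pbd.
- by move=> m n; lia.
- move=> x [a b] [c s]; rewrite /ev_step /= !esz_pair.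
  have := @esz_drop _ (enc_bool Sigma) (ev_ar a) c; set r := drop _ c.
  by case: (ev_psh a); case: (isatom a); rewrite ?esz_seq ?esz_bool; lia.
- have hv : ptm (fun p : lexeme * (X * (seq bool * seq bool)) =>
      ev_fun p.1.1 (has (fun y => y == p.1.2) (Y p.2.1)) (nth false p.2.2.1 0) (nth false p.2.2.1 1)).
    apply: (@pt_tok3 _ _ ev_fun); pts.
    by apply: (pt_comp hY); pts.
  rewrite /ev_step; pts.
  + by apply: (@pt_tok _ _ _ _ ev_psh); pts.
  + by apply: (@pt_tok _ _ _ _ ev_ar); pts.
  + by apply: (@pt_tok _ _ _ _ ev_ar); pts.
  + by apply: (@pt_tok _ _ _ _ isatom); pts.
- by pts.
Qed.

Lemma pt_truth X (eX : enc X) (g : X -> seq bool) (l : X -> seq lexeme) :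
  ptm g -> ptm l -> ptm (fun x => truth (g x) (l x)).
Proof.
move=> hg hl; rewrite /truth.
apply: (@pt_foldr _ _ _ _ _ _ _ (fun _ a s => tr_step a s) _ _ (fun n => n + 4)) => //; try by pbd.
- by move=> m n; lia.
- move=> x [a b] [c s]; rewrite /tr_step /= !esz_pair.
  have := @esz_drop _ (enc_bool Sigma) (tr_ar a) c; set r := drop _ c; have := @esz_behead Sigma _ (enc_bool Sigma) s.
  by case: (res_kind a); case: (isatom a); rewrite ?esz_seq ?esz_bool; lia.
- rewrite /tr_step; pts.
  + by apply: (@pt_tok _ _ _ _ res_kind); pts.
  + by apply: (@pt_tok3 _ _ tr_fun); pts.
  + by apply: (@pt_tok _ _ _ _ tr_ar); pts.
  + by apply: (@pt_tok _ _ _ _ isatom); pts.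
- by pts.
Qed.

Lemma pt_kinds X (eX : enc X) (l : X -> seq lexeme) : ptm l -> ptm (fun x => conn_kinds (l x)).
Proof.
move=> hl; rewrite /conn_kinds; pts.
- by apply: (@pt_tok _ _ _ _ isatom); pts.
- by apply: (@pt_tok _ _ _ _ (fun a => if a is TIntConn then true else false)); pts.
Qed.

Lemma pt_sel X (eX : enc X) (m : X -> seq bool) (s : X -> seq (seq bool)) :
  ptm m -> ptm s -> ptm (fun x => sel (m x) (s x)).
Proof.
move=> hm hs; rewrite /sel; apply: pt_snd.
apply: (@pt_foldl_add _ _ _ _ _ _ _ (fun _ a s => sel_step a s) _ _ (fun n => n + 4)) => //; try by pbd.
- by move=> a b; lia.
- move=> x a [c t]; rewrite /sel_step /= !esz_pair; have := @esz_behead Sigma _ (enc_bool Sigma) c.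
  by case: (nth false c 0); rewrite ?esz_seq; lia.
- by rewrite /sel_step; pts.
- by pts.
Qed.

Lemma pt_chk : ptm (fun p : (seq row * (seq bool * seq bool)) * nat => chk p.1 p.2).
Proof. by rewrite /chk; pts. Qed.

Lemma pt_verify : ptm verify.
Proof.
have hl : ptm (fun p : cert * seq token => (lex p.2).2).
  by apply: pt_snd; apply: pt_lex; pts.
have hk := pt_kinds hl.
rewrite /verify /=; apply: pt_andb; first by apply: pt_wf; pts.
apply: pt_andb.
  apply: (pt_ext (f := fun p : cert * seq token => if p.1.1 is _ :: _ then true else false)).
    by move=> p; rewrite size_map; case: (p.1.1).
  by apply: (pt_listcase (g := fun _ _ _ => true)); pts.
apply: pt_andb; last first.
  by apply: pt_nth; [apply: pt_fst; apply: pt_truth|]; pts.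
apply: (pt_all (a := fun p => chk _)); last by pts.
apply: (pt_comp2 (g := chk)); [exact: pt_chk| |by pts].
apply: pt_pair; last by apply: pt_pair; [apply: (pt_comp hk)|]; pts.
apply: (pt_map (F := fun (p : cert * seq token * nat) (r : row) => ((evals (sel r.1 [seq x.2 | x <- (lex p.1.2).2]) (lex p.1.2).2).2, r.2))).
  have hl' : ptm (fun p : (cert * seq token * nat) * row => (lex p.1.1.2).2).
    by apply: (pt_comp hl); pts.
  apply: pt_pair; last by pts.
  by apply: pt_snd; apply: pt_evals => //; apply: pt_sel; pts.
by pts.
Qed.

Lemma pt_template : ptm template.
Proof.
have hl : ptm (fun w : seq token => (lex w).2) by apply: pt_snd; apply: pt_lex; pts.
have hk := pt_kinds hl.
by rewrite /template; pts.
Qed.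

End Ptime.

(** * Membership in NP *)

(** The indexing sequence [s] is abstract because soundness starts from the rows of a certificate
    and completeness from the points of a sample. *)
Lemma chk_good (S : Type) (s : seq S) (fr : S -> row) (fp : S -> point) A (g : seq bool) :
  (forall x k, k < size A ->
     nth false (fr x).1 k = aval (fp x) (anth A k) /\ nth false (fr x).2 k = (fp x).2 k) ->
  all (chk (map fr s, (map isconn A, g))) (iota 0 (size A)) <-> good A (map fp s) (nth false g).
Proof.
move=> H.
have hc k : k < size A -> nth false (map isconn A) k = isconn (anth A k).
  by move=> lt; rewrite (nth_map (Equal Zero Zero)).
have h1 k x : k < size A -> nth false (fr x).1 k = aval (fp x) (anth A k) by move/(H x)=> [].
have h2 k x : k < size A -> nth false (fr x).2 k = (fp x).2 k by move/(H x)=> [].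
split.
  move/allP=> C k lt /=; have := C k; rewrite mem_iota => /(_ lt).
  rewrite /chk /= hc //; case: (isconn _); last first.
    by move=> /eqP ->; rewrite !all_map; apply: eq_all => x /=; rewrite h1.
  case/orP=> [->|]; first by left.
  case/and4P=> c1 c2 c3 /allP c4; right; split.
  - by move: c1; rewrite !has_map; congr is_true; apply: eq_has => x /=; rewrite h1 // h2.
  - by move: c2; rewrite !has_map; congr is_true; apply: eq_has => x /=; rewrite h1 // h2.
  - by move: c3; rewrite !has_map; congr is_true; apply: eq_has => x /=; rewrite h1.
  - move=> i li ci gi; have := c4 i; rewrite mem_iota size_map => /(_ li).
    rewrite hc // ci gi /= => /or3P [] c5; [apply: Or31|apply: Or32|apply: Or33]; move: c5.
    + by rewrite !has_map; congr is_true; apply: eq_has => x /=; rewrite !h1.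
    + by rewrite !all_map; congr is_true; apply: eq_all => x /=; rewrite h1 // h2.
    + by rewrite !all_map; congr is_true; apply: eq_all => x /=; rewrite h1 // h2.
move=> G; apply/allP=> k; rewrite mem_iota => /= lt; have := G k lt.
rewrite /chk /= hc //; case: (isconn _); last first.
  by move=> ->; apply/eqP; rewrite !all_map; apply: eq_all => x /=; rewrite h1.
case=> [->//|[c1 c2 c3 c4]]; apply/orP; right; apply/and4P; split.
- by move: c1; rewrite !has_map; congr is_true; apply: eq_has => x /=; rewrite h1 // h2.
- by move: c2; rewrite !has_map; congr is_true; apply: eq_has => x /=; rewrite h1 // h2.
- by move: c3; rewrite !has_map; congr is_true; apply: eq_has => x /=; rewrite h1.
- apply/allP=> i; rewrite mem_iota size_map => /= li; apply/implyP; rewrite hc // => /andP [ci gi].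
  apply/or3P; case: (c4 i li ci gi) => c5; [apply: Or31|apply: Or32|apply: Or33]; move: c5.
  + by rewrite !has_map; congr is_true; apply: eq_has => x /=; rewrite !h1.
  + by rewrite !all_map; congr is_true; apply: eq_all => x /=; rewrite h1 // h2.
  + by rewrite !all_map; congr is_true; apply: eq_all => x /=; rewrite h1 // h2.
Qed.

Lemma evals_formula X f : (evals X (lformula f)).2 = [seq aval (val_of X, fun=> false) a | a <- atoms f].
Proof. by rewrite -[lformula f]cats0 ev_formula /= cats0. Qed.

Lemma truth_formula (c : formula -> bool) f :
  (truth (rev [seq c a | a <- atoms f]) (lformula f)).1 = [:: feval c f].
Proof. by rewrite -[lformula f]cats0 (@tr_formula c _ _ _ [::]) ?cats0. Qed.

Lemma sel_val f (names : seq (seq bool)) v :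
  val_of (sel (map f names) names) v = (f (bits_of_nat v)) && (bits_of_nat v \in names).
Proof.
have key acc : (foldl (fun s x => sel_step x s) (map f names, acc) names).2 = catrev (seq.filter f names) acc.
  by elim: names acc => //= x s IH acc; rewrite /sel_step /= IH; case: (f x).
rewrite /val_of /sel key -/(rev _) has_rev -mem_filter.
by rewrite -has_pred1; apply: eq_has => x.
Qed.

Lemma bev_agree (v1 v2 : nat -> bool) t :
  (forall v, bits_of_nat v \in [seq x.2 | x <- lterm t] -> v1 v = v2 v) -> bev v1 t = bev v2 t.
Proof.
elim: t => [v|||t1 IH1 t2 IH2|t1 IH1 t2 IH2|t1 IH1] H //=.
- by apply: H; rewrite inE.
- by rewrite IH1 ?IH2 // => v hv; apply: H; rewrite /= inE map_cat mem_cat hv ?orbT.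
- by rewrite IH1 ?IH2 // => v hv; apply: H; rewrite /= inE map_cat mem_cat hv ?orbT.
- by rewrite IH1 // => v hv; apply: H; rewrite /= inE hv orbT.
Qed.

Lemma aval_agree (p q : point) f :
  (forall v, bits_of_nat v \in [seq x.2 | x <- lformula f] -> p.1 v = q.1 v) ->
  [seq aval p a | a <- atoms f] = [seq aval q a | a <- atoms f].
Proof.
elim: f => [t1 t2|t|f1 IH1 f2 IH2|f1 IH1] H /=.
- congr [:: _ == _]; apply: bev_agree => v hv; apply: H; rewrite /= inE map_cat mem_cat hv ?orbT //.
- by congr [:: _]; apply: bev_agree => v hv; apply: H; rewrite /= inE hv ?orbT.
- by rewrite !map_cat IH1 ?IH2 // => v hv; apply: H; rewrite /= inE map_cat mem_cat hv ?orbT.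
- by apply: IH1 => v hv; apply: H; rewrite /= inE hv orbT.
Qed.

Section Variants.
Variable Sigma : finType.
Local Notation enc := (enc Sigma).

(** The closure hypothesis of [ptm_NP], established along the structure of the type of
    certificates. *)
Definition bitty (X : Type) {eX : enc X} := forall (x : X) t, variant (toT x) t -> exists y : X, t = toT y.
Arguments bitty X {eX}.

Lemma bitty_bool : bitty bool.
Proof. by move=> b [[[|c]|]|] //= _; exists c. Qed.

Lemma bitty_pair X Y {eX : enc X} {eY : enc Y} : bitty X -> bitty Y -> bitty (X * Y).
Proof.
move=> hX hY [x y] [l|t u] //= [/hX [x' ->] /hY [y' ->]].
by exists (x', y').
Qed.

Lemma bitty_seq X {eX : enc X} : bitty X -> bitty (seq X).
Proof.
move=> hX; elim=> [|x s IH] [l|t u] //=; first by move=> <-; exists [::].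
by case=> /hX [x' ->] /IH [s' ->]; exists (x' :: s').
Qed.

Lemma variant_nseq X {eX : enc X} (x : X) n (s : seq X) : size s = n ->
  (forall y, List.In y s -> variant (toT x : tree (lab Sigma)) (toT y)) -> variant (toT (nseq n x) : tree (lab Sigma)) (toT s).
Proof.
elim: n s => [|n IH] [|y s] //= [sz] H; split; first by apply: H; left.
by apply: IH => // z hz; apply: H; right.
Qed.

Lemma variant_bits n (s : seq bool) : size s = n -> variant (toT (nseq n false) : tree (lab Sigma)) (toT s).
Proof. by move=> h; apply: (@variant_nseq _ (enc_bool Sigma)). Qed.

End Variants.

Lemma in_map_list X Y (f : X -> Y) s y : List.In y (map f s) -> exists x, y = f x.
Proof. by elim: s => //= x s IH [<-|/IH //]; exists x. Qed.

Section Membership.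
Variable R : realType.
Local Notation V := 'rV[R]_3.

Lemma verify_sound c w : verify (c, w) -> Sat_Bc V w.
Proof.
rewrite /verify /= => /and4P [/wfP [phi ->]]; rewrite lex_encode /= kinds_formula size_map.
rewrite (size_map isconn) => P0 C tr; exists phi => //.
set names := [seq x.2 | x <- lformula phi] in C.
pose fp (r : row) : point := (val_of (sel r.1 names), nth false r.2).
have G : good (atoms phi) (map fp c.1) (nth false c.2).
  apply/(@chk_good _ _ (fun r : row => ((evals (sel r.1 names) (lformula phi)).2, r.2))); last exact: C.
  move=> r k lt; split=> //=; rewrite evals_formula (nth_map (Equal Zero Zero)) // -/(anth _ _).
have [|d [hd]] := @sat_of_good R _ _ _ _ G; first by rewrite size_map.
apply; move: tr; rewrite (_ : [seq _ | k <- _] = [seq d a | a <- atoms phi]) ?truth_formula //.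
apply: (@eq_from_nth _ false); rewrite ?size_map ?size_iota // => k lt.
rewrite (nth_map 0) ?size_iota // nth_iota // (nth_map (Equal Zero Zero)) //.
by rewrite add0n -hd.
Qed.

Lemma verify_complete w : Sat_Bc V w -> exists2 c : cert,
  variant (toT (template w) : tree (lab void)) (toT c) & verify (c, w).
Proof.
case=> phi -> /good_of_sat [P [d [sP G F]]].
set a := size (atoms phi) in sP; set names := [seq x.2 | x <- lformula phi].
pose rw (p : point) : row := ([seq `[< exists v, bits_of_nat v = nm /\ p.1 v >] | nm <- names],
   [seq p.2 k | k <- iota 0 a]).
exists (map rw P, [seq d x | x <- atoms phi]).
  rewrite /template lex_encode /= kinds_formula size_map -/a; split; last first.
    by apply: (@variant_bits void); rewrite size_map.
  apply: (@variant_nseq void); first by rewrite size_map.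
  move=> r hr; have [p ->] := in_map_list hr; split; apply: (@variant_bits void); by rewrite !size_map // size_iota.
rewrite /verify /= lex_encode /= kinds_formula size_map (size_map isconn) -/a.
apply/and4P; split.
- exact: wf_encode.
- by rewrite !size_map sP; lia.
- rewrite -map_comp; apply/(@chk_good _ _ _ id).
    move=> p k lt; rewrite /comp /rw /=; split; last first.
      by rewrite (nth_map 0) ?size_iota // nth_iota.
    rewrite evals_formula (aval_agree (q := p)) ?(nth_map (Equal Zero Zero)) // => v hv.
    rewrite /= sel_val hv andbT; apply/asboolP/idP => [[v' [/bits_of_nat_inj ->]]|] //.
    by move=> pv; exists v.
  rewrite map_id => k lt; have := G k lt; rewrite /= (nth_map (Equal Zero Zero)) // -/(anth _ _).
  case: (isconn _) => // -[|[c1 c2 c3 c4]]; [by left|right; split=> // i li ci gi].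
  by apply: c4 => //; move: gi; rewrite (nth_map (Equal Zero Zero)).
- rewrite (_ : [seq _ | k <- _] = [seq d x | x <- atoms phi]) ?truth_formula //.
  by apply: (@eq_from_nth _ false); rewrite ?size_map ?size_iota // => k lt;
     rewrite (nth_map 0) ?size_iota // nth_iota.
Qed.

Lemma Sat_Bc_NP : NP (Sat_Bc V).
Proof.
(* The words decided are token strings, so the alphabet of further input letters is empty. *)
apply: (@ptm_NP void _ cert _ template verify).
- exact: pt_template.
- exact: pt_verify.
- move=> w t; apply: (@bitty_pair void); last exact/bitty_seq/bitty_bool.
  by apply: bitty_seq; apply: bitty_pair; exact/bitty_seq/bitty_bool.
- move=> w; split; first exact: verify_complete.
  by case=> c _; exact: verify_sound.
Qed.

End Membership.

(** * Trajectories of a machine *)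

Definition eqn := (term * term)%type.
Definition holds_all (v : nat -> bool) (es : seq eqn) : bool := all (fun e => bev v e.1 == bev v e.2) es.
Definition cst (b : bool) : term := if b then One else Zero.
Definition sum_terms (ts : seq term) : term := foldr Add Zero ts.

Lemma bev_cst v b : bev v (cst b) = b. Proof. by case: b. Qed.

Lemma bev_sum v C (F : C -> term) s : bev v (sum_terms (map F s)) = has (fun c => bev v (F c)) s.
Proof. by elim: s => //= c s ->. Qed.

Lemma holds_cat v s t : holds_all v (s ++ t) = holds_all v s && holds_all v t.
Proof. exact: all_cat. Qed.

Lemma holds_flat v (C : eqType) (F : C -> seq eqn) s :
  holds_all v (flatten (map F s)) <-> forall c, c \in s -> holds_all v (F c).
Proof.
elim: s => //= c s IH; rewrite holds_cat; split.
  by case/andP=> h /IH H d; rewrite inE => /predU1P [->|/H].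
move=> H; apply/andP; split; first by apply: H; rewrite inE eqxx.
by apply/IH=> d ds; apply: H; rewrite inE ds orbT.
Qed.

Lemma holds_map v (F : nat -> eqn) s :
  holds_all v (map F s) <-> forall k, k \in s -> bev v (F k).1 = bev v (F k).2.
Proof.
rewrite /holds_all all_map; split=> [/allP H k /H /eqP|H] //.
by apply/allP=> k /H /= ->.
Qed.

Section Tapes.
Variable A : finType.
Implicit Type tp : tape A.

(* Positions are relative to the head, which is at position [W]. *)
Definition cell (W : nat) tp (z : nat) : option A :=
  if z < W then nth None (tleft tp) (W - z.+1) else nth None (thead tp :: tright tp) (z - W).

(** The cell at position [z.+1] after a move in direction [d] was at [src d z] before it. Starting
    from [z.+1] avoids negative positions. *)
Definition src (d : direction) (z : nat) : nat :=
  match d with Left => z | Stay => z.+1 | Right => z.+2 end.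

Lemma cell_head W tp : cell W tp W = thead tp.
Proof. by rewrite /cell ltnn subnn. Qed.

Lemma cell_shift W d b tp z :
  cell W (shift d (write b tp)) z.+1 = if src d z == W then b else cell W tp (src d z).
Proof.
have hd s : head None s = nth (None : option A) s 0 by case: s.
have nb s k : nth None (behead s) k = nth (None : option A) s k.+1 by rewrite nth_behead.
rewrite /cell; case: d => /=; case: tp => l h r /=; rewrite ?hd ?nb.
- case: (ltngtP z W) => [zW|zW|->]; last by rewrite ltnNge leqnSn /= (_ : W.+1 - W = 1) //; lia.
    case: ltnP => h1.
      by rewrite (_ : (W - z.+2).+1 = W - z.+1) //; lia.
    have -> : z.+1 - W = 0 by lia.
    by have -> : W - z.+1 = 0 by lia.
  have -> : (z.+1 < W) = false by lia.
  have -> : z.+1 - W = (z - W.+1).+2 by lia.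
  by have -> : z - W = (z - W.+1).+1 by lia.
- case: (ltngtP z.+1 W) => [zW|zW|<-] //; last by rewrite subnn.
  by rewrite (_ : z.+1 - W = (z - W).+1) //; lia.
- case: (ltngtP z.+2 W) => [zW|zW|<-]; last first.
    by rewrite subnn.
  - rewrite (_ : z.+2 - W = (z.+1 - W).+1) /=; last by lia.
    by case E: (z.+1 - W) => [|k] //=; rewrite ?nb.
  - by rewrite (_ : W - z.+2 = (W - z.+3).+1) //; lia.
Qed.

End Tapes.

Section Trajectories.
Variables (A : finType) (M : machine A).
Local Notation K := (tapes M).+1.

(* A state, the symbols under the heads, and the action taken, [None] standing
   for no action, which is possible only when the machine has halted. *)
Definition view : finType :=
  ((state M * {ffun 'I_K -> option A}) *
    option (state M * {ffun 'I_K -> option A * direction}))%type.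

Definition legit (h : view) : bool :=
  if h.2 is Some a then a \in trans h.1.1 h.1.2 else trans h.1.1 h.1.2 == finset.set0.
Definition views : seq view := seq.filter legit (enum view).
Definition next (h : view) : state M := if h.2 is Some a then a.1 else h.1.1.
Definition wr (h : view) (j : 'I_K) : option A := if h.2 is Some a then (a.2 j).1 else h.1.2 j.
Definition dir (h : view) (j : 'I_K) : direction := if h.2 is Some a then (a.2 j).2 else Stay.

Definition succ (h : view) (c : config M) : config M :=
  (next h, [ffun j => shift (dir h j) (write (wr h j) (c.2 j))]).
Definition sees (h : view) (c : config M) : Prop :=
  [/\ h \in views, h.1.1 = c.1 & h.1.2 = [ffun j => thead (c.2 j)]].

Lemma mem_views h : (h \in views) = legit h.
Proof. by rewrite mem_filter mem_enum andbT. Qed.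

Lemma sees_step h c : sees h c -> step c (succ h c) \/ (halted c /\ succ h c = c).
Proof.
case; rewrite mem_views /legit /succ /next /wr /dir => hl h1 h2.
case: h hl h1 h2 => -[q s] [a|] /= hl h1 h2; [left|right].
  by exists a => //; rewrite /enabled -h1 -h2.
split; first by apply/eqP; rewrite /enabled -h1 -h2.
rewrite h1; case: c {h1} h2 => q' tp /= ->; congr (_, _).
by apply/ffunP=> j; rewrite !ffunE /write; case: (tp j).
Qed.

Lemma step_sees c c' : step c c' -> exists2 h, sees h c & succ h c = c'.
Proof.
case=> a ha ->; exists ((c.1, [ffun j => thead (c.2 j)]), Some a) => //.
by split=> //; rewrite mem_views.
Qed.

Lemma halted_sees c : halted c -> exists2 h, sees h c & succ h c = c.
Proof.
move=> hc; pose h : view := ((c.1, [ffun j => thead (c.2 j)]), None).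
have sh : sees h c by split=> //; rewrite mem_views /legit; apply/eqP.
by exists h => //; case: (sees_step sh) => [[a]|[]] //; rewrite hc inE.
Qed.

(** After halting, the trajectory idles forever, so that a tableau of fixed height fits computations
    of any smaller length. *)
Lemma steps_traj k c c' : steps k c c' -> halted c' ->
  exists (f : nat -> config M) (h : nat -> view), [/\ f 0 = c,
    forall t, sees (h t) (f t) /\ f t.+1 = succ (h t) (f t) & forall t, k <= t -> f t = c'].
Proof.
move=> + hc'; elim: k c => [|k IH] c /=.
  by move=> ->; have [h sh eh] := halted_sees hc'; exists (fun=> c'), (fun=> h).
case=> c1 /step_sees [h0 s0 e0] /IH [f [h [f0 fS fk]]].
exists (fun t => if t is t'.+1 then f t' else c), (fun t => if t is t'.+1 then h t' else h0).
split=> //; first by case=> [|t] //; rewrite f0 e0.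
by case=> // t; apply: fk.
Qed.

Lemma steps_rcons k (c c1 c2 : config M) : steps k c c1 -> step c1 c2 -> steps k.+1 c c2.
Proof.
elim: k c => [|k IH] c /=; first by move=> -> s; exists c2.
by case=> d sd /IH H /H ?; exists d.
Qed.

End Trajectories.

(** * The tableau equations *)

Lemma var_of_inj : injective var_of.
Proof.
move=> l l' /(congr1 bits_of_nat); rewrite !bits_var_of => E.
by have := rcons_inj E; case.
Qed.

Lemma nseq_false_inj a b s s' :
  nseq a true ++ false :: s = nseq b true ++ false :: s' -> a = b /\ s = s'.
Proof. by elim: a b => [|a IH] [|b] //= [] // /IH [-> ->]. Qed.

Lemma has_unique (C : eqType) (Y X : pred C) s c : c \in s -> Y c ->
  (forall d, d \in s -> Y d -> d = c) -> has (fun d => Y d && X d) s = X c.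
Proof.
move=> cs Yc U; apply/hasP/idP => [[d ds /andP [/U -> //]]|Xc].
by exists c; rewrite ?Yc.
Qed.

Section CookLevin.
Variables (Sigma A : finType) (i : Sigma -> A) (M : machine A) (p : {poly nat}).
Local Notation K := (tapes M).+1.

Definition kind : finType := (view M + (state M + 'I_K * option A))%type.

(** Unary numbers with separators are easy to write, decode uniquely, and stay polynomial because
    times and positions are. *)
Definition nm (t z : nat) (k : kind) : seq bool :=
  nseq t true ++ false :: nseq z true ++ false :: nseq (enum_rank k) true.

Lemma nm_inj t z k t' z' k' : nm t z k = nm t' z' k' -> [/\ t = t', z = z' & k = k'].
Proof.
case/nseq_false_inj=> -> /nseq_false_inj [-> /(congr1 size)].
by rewrite !size_nseq => /val_inj /enum_rank_inj ->.
Qed.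

Definition nv t z k : nat := var_of (nm t z k).
Definition yn t (h : view M) := nv t 0 (inl h).
Definition qn t (q : state M) := nv t 0 (inr (inl q)).
Definition cn t (j : 'I_K) z (a : option A) := nv t z (inr (inr (j, a))).

(** Positions are compared as unary strings, to which the equality test for bit strings applies. *)
Definition src_cell W t j a z (h : view M) : term :=
  if nseq (src (dir h j) z) true == nseq W true then cst (wr h j == a)
  else Var (cn t j (src (dir h j) z) a).

Definition cell_eq W t j a z : eqn :=
  (Var (cn t.+1 j z.+1 a), sum_terms [seq Mul (Var (yn t h)) (src_cell W t j a z h) | h <- views M]).

Definition step_eqs (W t : nat) : seq eqn :=
  [:: (sum_terms [seq Var (yn t h) | h <- views M], One)] ++
  flatten [seq flatten [seq (if h == h' then [::] else [:: (Mul (Var (yn t h)) (Var (yn t h')), Zero)])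
    | h' <- views M] | h <- views M] ++
  flatten [seq [:: (Mul (Var (yn t h)) (Opp (Var (qn t h.1.1))), Zero)] | h <- views M] ++
  flatten [seq flatten [seq [:: (Mul (Var (yn t h)) (Opp (Var (cn t j W (h.1.2 j)))), Zero)]
    | j <- enum 'I_K] | h <- views M] ++
  flatten [seq [:: (Var (qn t.+1 q),
      sum_terms [seq Mul (Var (yn t h)) (cst (next h == q)) | h <- views M])] | q <- enum (state M)] ++
  flatten [seq flatten [seq [seq cell_eq W t j a z | z <- iota 0 (W + W)]
    | a <- enum {: option A}] | j <- enum 'I_K].

Definition init_cell (j : 'I_K) (a : option A) (l : seq Sigma) : term :=
  if l is x :: _ then cst ((if j == ord0 then Some (i x) else None) == a) else cst (None == a).

Definition init_eqs (W : nat) (w : seq Sigma) : seq eqn :=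
  flatten [seq [:: (Var (qn 0 q), cst (start M == q))] | q <- enum (state M)] ++
  flatten [seq flatten [seq [seq (Var (cn 0 j z a), cst (None == a)) | z <- iota 0 W] ++
     [seq (Var (cn 0 j (W + z) a), init_cell j a (drop z w)) | z <- iota 0 W.+1]
    | a <- enum {: option A}] | j <- enum 'I_K].

Definition accept_view (h : view M) : bool :=
  accepting h.1.1 && (trans h.1.1 h.1.2 == finset.set0).

Definition final_eqs (W : nat) : seq eqn :=
  [:: (sum_terms [seq Mul (Var (yn W h)) (cst (accept_view h)) | h <- views M], One)].

(** Used both as the number of steps and as the radius of the window around the heads. *)
Definition bound (w : seq Sigma) : nat := (p.[size w])%R.

Definition all_eqs (w : seq Sigma) : seq eqn :=
  init_eqs (bound w) w ++
  flatten [seq step_eqs (bound w) t | t <- iota 0 (bound w).+1] ++ final_eqs (bound w).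

Lemma holds_eqs v w : holds_all v (all_eqs w) =
  [&& holds_all v (init_eqs (bound w) w),
      holds_all v (flatten [seq step_eqs (bound w) t | t <- iota 0 (bound w).+1]) &
      holds_all v (final_eqs (bound w))].
Proof. by rewrite holds_cat; congr (_ && _); exact: holds_cat. Qed.

Section Semantics.
Variable v : nat -> bool.
Local Notation Y t h := (v (yn t h)).
Local Notation Q t q := (v (qn t q)).
Local Notation C t j z a := (v (cn t j z a)).

Lemma bev_src W t j a z h : bev v (src_cell W t j a z h) =
  if src (dir h j) z == W then wr h j == a else C t j (src (dir h j) z) a.
Proof.
rewrite /src_cell (_ : (nseq _ _ == nseq _ _) = (src (dir h j) z == W)).
  by case: eqP; rewrite ?bev_cst.
by apply/eqP/eqP => [/(congr1 size)|-> //]; rewrite !size_nseq.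
Qed.

Lemma step_eqsP W t : holds_all v (step_eqs W t) <->
  [/\ has (fun h => Y t h) (views M),
      {in views M &, forall h h', Y t h -> Y t h' -> h = h'},
      {in views M, forall h, Y t h -> Q t h.1.1 /\ forall j, C t j W (h.1.2 j)},
      forall q, Q t.+1 q = has (fun h => Y t h && (next h == q)) (views M) &
      forall j a z, z < W + W -> C t.+1 j z.+1 a = has (fun h => Y t h &&
        (if src (dir h j) z == W then wr h j == a else C t j (src (dir h j) z) a)) (views M)].
Proof.
rewrite /step_eqs !holds_cat; split.
  case/and5P => h1 /holds_flat h2 /holds_flat h3 /holds_flat h4 /andP [/holds_flat h5 /holds_flat h6]; split.
  - by move: h1; rewrite /holds_all /= andbT bev_sum eqb_id.
  - move=> h h' hv hv' yh yh'; have /holds_flat /(_ _ hv') := h2 _ hv.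
    by case: eqP => // _; rewrite /holds_all /= yh yh'.
  - move=> h hv yh; split; first by have := h3 _ hv; rewrite /holds_all /= yh; case: (v _).
    move=> j; have /holds_flat /(_ j) := h4 _ hv; rewrite mem_enum => /(_ isT).
    by rewrite /holds_all /= yh; case: (v _).
  - move=> q; have := h5 q; rewrite mem_enum => /(_ isT); rewrite /holds_all /= andbT bev_sum => /eqP ->.
    by apply: eq_has => h /=; rewrite bev_cst.
  - move=> j a z lt; have := h6 j; rewrite mem_enum => /(_ isT) /holds_flat /(_ a).
    rewrite mem_enum => /(_ isT) /holds_map /(_ z); rewrite mem_iota => /(_ lt) /=.
    by rewrite bev_sum => ->; apply: eq_has => h; rewrite [LHS]/= bev_src.
case=> h1 h2 h3 h4 h5; apply/and5P; split; last (apply/andP; split).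
- by rewrite /holds_all /= andbT bev_sum eqb_id.
- apply/holds_flat=> h hv; apply/holds_flat=> h' hv'; case: eqP => // ne.
  rewrite /holds_all /= andbT; case yh: (Y t h); case yh': (Y t h') => //.
  by case: ne; apply: h2.
- apply/holds_flat=> h hv; rewrite /holds_all /= andbT; case yh: (Y t h) => //.
  by have [-> _] := h3 _ hv yh.
- apply/holds_flat=> h hv; apply/holds_flat=> j _; rewrite /holds_all /= andbT; case yh: (Y t h) => //.
  by have [_ ->] := h3 _ hv yh.
- apply/holds_flat=> q _; rewrite /holds_all /= andbT bev_sum h4; apply/eqP.
  by apply: eq_has => h /=; rewrite bev_cst.
- apply/holds_flat=> j _; apply/holds_flat=> a _; apply/holds_map=> z; rewrite mem_iota => /= lt.
  by rewrite h5 // bev_sum; apply: eq_has => h; rewrite [RHS]/= bev_src.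
Qed.

Lemma cell_blank W z : cell W (blank_tape A) z = None.
Proof. by rewrite /cell /= !nth_nil; case: ltnP => // _; case: (z - W) => //= k; rewrite nth_nil. Qed.

Lemma cell_word_left W (w : seq A) z : z < W -> cell W (tape_of_word w) z = None.
Proof. by rewrite /cell => ->; case: w => [|a w] /=; rewrite nth_nil. Qed.

Lemma cell_word W (w : seq A) z : cell W (tape_of_word w) (W + z) = if drop z w is x :: _ then Some x else None.
Proof.
rewrite /cell ltnNge leq_addr /= addKn; case: w => [|a w] /=; first by case: z => //= k; rewrite nth_nil.
case: z => [|z] //=; elim: w z => [|b w IH] [|z] //=.
Qed.

Lemma init_eqsP W w : holds_all v (init_eqs W w) <->
  (forall q, Q 0 q = ((initial M (map i w)).1 == q)) /\
  (forall j z a, z <= W + W -> C 0 j z a = (cell W ((initial M (map i w)).2 j) z == a)).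
Proof.
have ic j a z : bev v (init_cell j a (drop z w)) = (cell W ((initial M (map i w)).2 j) (W + z) == a).
  rewrite /init_cell /= ffunE; case: ifP => _.
    by rewrite cell_word -map_drop; case: (drop z w) => [|x l] /=; rewrite bev_cst.
  by rewrite cell_blank; case: (drop z w) => [|x l]; rewrite bev_cst.
have il j z : z < W -> cell W ((initial M (map i w)).2 j) z = None.
  by move=> lt; rewrite ffunE; case: ifP => _; rewrite ?cell_blank // cell_word_left.
rewrite /init_eqs holds_cat; split.
  case/andP=> /holds_flat h1 /holds_flat h2; split.
    move=> q; have := h1 q; rewrite mem_enum => /(_ isT).
    by rewrite /holds_all /= andbT bev_cst => /eqP.
  move=> j z a le; have := h2 j; rewrite mem_enum => /(_ isT) /holds_flat /(_ a).
  rewrite mem_enum => /(_ isT); rewrite holds_cat => /andP [/holds_map hl /holds_map hr].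
  case: (ltnP z W) => lt.
    by have := hl z; rewrite mem_iota il //= => /(_ lt) ->; rewrite bev_cst.
  have := hr (z - W); rewrite mem_iota ic subnKC // => /(_ _) /= -> //; lia.
case=> h1 h2; apply/andP; split; first by apply/holds_flat=> q _; rewrite /holds_all /= bev_cst h1 eqxx.
apply/holds_flat=> j _; apply/holds_flat=> a _; rewrite holds_cat; apply/andP; split.
  by apply/holds_map=> z; rewrite mem_iota => /= lt; rewrite bev_cst h2 ?il //; lia.
by apply/holds_map=> z; rewrite mem_iota => /= lt; rewrite ic h2 //; lia.
Qed.

Lemma final_eqsP W : holds_all v (final_eqs W) = has (fun h => Y W h && accept_view h) (views M).
Proof.
rewrite /holds_all /= andbT bev_sum eqb_id.
by apply: eq_has => h /=; rewrite bev_cst.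
Qed.

(* The equations say nothing about the two outermost cells, so one cell is lost
   at either end of the window [0 .. 2 W] at every step. *)
Lemma eqs_sound w : holds_all v (all_eqs w) -> accepts M (map i w).
Proof.
rewrite holds_eqs; set W := bound w => /and3P [/init_eqsP [q0 c0] /holds_flat hs].
rewrite final_eqsP => hf.
have st t : t <= W -> holds_all v (step_eqs W t) by move=> lt; apply: hs; rewrite mem_iota.
have key t : t <= W -> exists (c : config M) k, [/\ steps k (initial M (map i w)) c,
    forall q, Q t q = (c.1 == q) &
    forall j z a, t <= z -> z + t <= W + W -> C t j z a = (cell W (c.2 j) z == a)].
  elim: t => [|t IH] lt.
    exists (initial M (map i w)), 0; split=> // j z a _ le; apply: c0; lia.
  have [c [k [sk Qc Cc]]] := IH (ltnW lt).
  have /step_eqsP [/hasP [h hv yh] un look Qn Cn] := st t (ltnW lt).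
  have U d : d \in views M -> Y t d -> d = h by move=> dv yd; apply: un.
  have [lq lc] := look h hv yh.
  have sh : sees h c.
    split=> //; first by move: lq; rewrite Qc => /eqP.
    apply/ffunP=> j; rewrite ffunE -(cell_head W); have := lc j.
    by rewrite Cc; [move/eqP|lia|lia].
  have [k' sk'] : exists k', steps k' (initial M (map i w)) (succ h c).
    have [sc|[_ e]] := sees_step sh; [exists k.+1|exists k]; last by rewrite e.
    exact: steps_rcons sk sc.
  exists (succ h c), k'; split=> //; first by move=> q; rewrite Qn (has_unique _ hv yh U).
  move=> j [|z] a lz le; first by lia.
  rewrite Cn ?(has_unique _ hv yh U); last by lia.
  rewrite /= ffunE cell_shift; case: eqP => // _.
  by apply: Cc; case: (dir h j) => /=; lia.
(* At time [W] the window has shrunk to the head cell alone, which is all that is needed to see that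
   the machine has halted. *)
have [c [k [sk Qc Cc]]] := key W (leqnn W).
have /step_eqsP [_ un look _ _] := st W (leqnn W).
have /hasP [h hv /andP [yh /andP [ac /eqP tr]]] := hf.
have [lq lc] := look h hv yh.
have Eq : c.1 = h.1.1 by move: lq; rewrite Qc => /eqP.
exists k, c; split=> //; last by rewrite Eq.
rewrite /halted /enabled Eq -tr; congr (trans _ _); apply/ffunP=> j; rewrite ffunE -(cell_head W).
by have := lc j; rewrite Cc; [move/eqP|lia|lia].
Qed.

End Semantics.

Lemma eqs_complete w : runs_in_time M i p -> accepts M (map i w) -> exists v, holds_all v (all_eqs w).
Proof.
move=> rt [k [c [sk hc ac]]]; have kW : k <= bound w := rt _ _ _ sk.
set W := bound w in kW.
have [f [th [f0 fS fk]]] := steps_traj sk hc.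
pose F t z (x : kind) : bool := match x with
  | inl h => h == th t
  | inr (inl q) => (f t).1 == q
  | inr (inr (j, a)) => cell W ((f t).2 j) z == a end.
(* Names determine time, position and kind, so the trajectory prescribes the values of the tableau
   variables consistently. *)
pose v n := `[< exists t z x, n = nv t z x /\ F t z x >].
have vF t z x : v (nv t z x) = F t z x.
  apply/asboolP/idP => [[t' [z' [x' [/var_of_inj /nm_inj [-> -> ->]]]]]|] //.
  by move=> h; exists t, z, x.
exists v; rewrite holds_eqs -/W; apply/and3P; split.
- apply/init_eqsP; rewrite -f0; split=> [q|j z a _]; exact: vF.
- apply/holds_flat=> t _; have [[hv e1 e2] eS] := fS t.
  have yt h : v (yn t h) = (h == th t) by exact: vF.
  have U d : d \in views M -> v (yn t d) -> d = th t by rewrite yt => _ /eqP.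
  have yh : v (yn t (th t)) by rewrite yt.
  apply/step_eqsP; split.
  + by apply/hasP; exists (th t).
  + by move=> h h' _ _; rewrite !yt => /eqP -> /eqP ->.
  + move=> h _; rewrite yt => /eqP ->; rewrite e1 e2 /qn vF /= eqxx; split=> // j.
    by rewrite /cn vF /= cell_head ffunE.
  + by move=> q; rewrite (has_unique _ hv yh U) /qn vF /= eS.
  + move=> j a z _; rewrite (has_unique _ hv yh U) /cn !vF /= eS ffunE cell_shift.
    by case: ifP.
- have [[hv e1 e2] _] := fS W; rewrite final_eqsP; apply/hasP; exists (th W) => //.
  rewrite /yn vF /= eqxx /accept_view e1 e2 fk // ac /=; exact/eqP.
Qed.

End CookLevin.

(** * The reduction *)

Section Generators.
Variable Sigma : finType.
Local Notation enc := (enc Sigma).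
Local Notation ptm := (@ptm Sigma _ _ _ _).
Variables (X : Type) (eX : enc X).

Lemma pt_encode_term (a : X -> term) : ptm a -> ptm (fun x => encode_term (a x)).
Proof. exact: pt_same. Qed.

Lemma pt_var (l : X -> seq bool) : ptm l -> ptm (fun x => Var (var_of (l x))).
Proof.
move=> hl; apply: (pt_same (g := fun x => TVar :: map TBit (l x ++ [:: true]))).
  by move=> x; rewrite /toT /enc_term /= bits_var_of cats1.
apply: pt_cons; first exact: pt_const.
apply: (pt_map (F := fun _ b => TBit b)); last by pts.
by apply: (pt_comp (g := TBit)); [exact: pt_bool|pts].
Qed.

Lemma pt_add (a b : X -> term) : ptm a -> ptm b -> ptm (fun x => Add (a x) (b x)).
Proof.
move=> /pt_encode_term ha /pt_encode_term hb.
apply: (pt_same (g := fun x => TAdd :: encode_term (a x) ++ encode_term (b x))) => //.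
by pts.
Qed.

Lemma pt_mul (a b : X -> term) : ptm a -> ptm b -> ptm (fun x => Mul (a x) (b x)).
Proof.
move=> /pt_encode_term ha /pt_encode_term hb.
apply: (pt_same (g := fun x => TMul :: encode_term (a x) ++ encode_term (b x))) => //.
by pts.
Qed.

Lemma pt_opp (a : X -> term) : ptm a -> ptm (fun x => Opp (a x)).
Proof.
move=> /pt_encode_term ha.
apply: (pt_same (g := fun x => TOpp :: encode_term (a x))) => //.
by pts.
Qed.

(** The index set belongs to the fixed machine and not to the input, so the sum is unrolled in the
    program; only times and positions are looped over. *)
Lemma pt_sum_terms C (cs : seq C) (F : C -> X -> term) :
  (forall c, ptm (F c)) -> ptm (fun x => sum_terms [seq F c x | c <- cs]).
Proof. by move=> hF; elim: cs => [|c cs IH] /=; [exact: pt_const|apply: pt_add]. Qed.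

Lemma pt_flatten_const C Y (eY : enc Y) (cs : seq C) (F : C -> X -> seq Y) :
  (forall c, ptm (F c)) -> ptm (fun x => flatten [seq F c x | c <- cs]).
Proof. by move=> hF; elim: cs => [|c cs IH] /=; [exact: pt_const|apply: pt_cat]. Qed.

Lemma pt_seq1 Y (eY : enc Y) (a : X -> Y) : ptm a -> ptm (fun x => [:: a x]).
Proof. by move=> ha; apply: pt_cons => //; exact: pt_const. Qed.

(** In unary, the value of a fixed polynomial is written out by finitely many additions and
    multiplications. *)
Lemma pt_horner (p : {poly nat}) (n : X -> nat) : ptm n -> ptm (fun x => p.[n x])%R.
Proof.
move=> hn; rewrite /horner; elim: (polyseq p) => [|a s IH] /=; first exact: pt_const.
apply: (pt_addn (b := fun _ => a)); last exact: pt_const.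
exact: pt_muln.
Qed.

End Generators.

Section Reduction.
Variables (Sigma A : finType) (i : Sigma -> A) (M : machine A) (p : {poly nat}).
Local Notation enc := (enc Sigma).
Local Notation ptm := (@ptm Sigma _ _ _ _).

Section Families.
Variables (X : Type) (eX : enc X).

Lemma pt_name (t z : X -> nat) k : ptm t -> ptm z -> ptm (fun x => Var (@nv A M (t x) (z x) k)).
Proof. by move=> ht hz; apply: pt_var; rewrite /nm; pts. Qed.

Lemma pt_yn (t : X -> nat) h : ptm t -> ptm (fun x => Var (@yn A M (t x) h)).
Proof. by move=> ht; apply: pt_name => //; exact: pt_const. Qed.

Lemma pt_qn (t : X -> nat) q : ptm t -> ptm (fun x => Var (@qn A M (t x) q)).
Proof. by move=> ht; apply: pt_name => //; exact: pt_const. Qed.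

Lemma pt_cn (t : X -> nat) j (z : X -> nat) a : ptm t -> ptm z -> ptm (fun x => Var (@cn A M (t x) j (z x) a)).
Proof. exact: pt_name. Qed.

Lemma pt_src d (z : X -> nat) : ptm z -> ptm (fun x => src d (z x)).
Proof. by case: d => hz //=; pts. Qed.

Lemma pt_cell_eq (W t : X -> nat) j a (z : X -> nat) : ptm W -> ptm t -> ptm z ->
  ptm (fun x => @cell_eq A M (W x) (t x) j a (z x)).
Proof.
move=> hW ht hz; apply: pt_pair; first by apply: pt_cn; pts.
apply: pt_sum_terms => h.
apply: pt_mul; first exact: pt_yn.
apply: pt_if; last by apply: pt_cn => //; apply: pt_src.
  by have hs := pt_src (dir h j) hz; pts.
exact: pt_const.
Qed.

End Families.

Lemma pt_step_eqs X (eX : enc X) (W t : X -> nat) : ptm W -> ptm t ->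
  ptm (fun x => @step_eqs A M (W x) (t x)).
Proof.
move=> hW ht; rewrite /step_eqs; do !apply: pt_cat.
- apply: pt_seq1; apply: pt_pair; last exact: pt_const.
  by apply: pt_sum_terms => h; apply: pt_yn.
- apply: pt_flatten_const => h.
  apply: pt_flatten_const => h'.
  case: (h == h'); first exact: pt_const.
  apply: pt_seq1; apply: pt_pair; last exact: pt_const.
  by apply: pt_mul; apply: pt_yn.
- apply: pt_flatten_const => h.
  apply: pt_seq1; apply: pt_pair; last exact: pt_const.
  by apply: pt_mul; [apply: pt_yn|apply: pt_opp; apply: pt_qn].
- apply: pt_flatten_const => h.
  apply: pt_flatten_const => j.
  apply: pt_seq1; apply: pt_pair; last exact: pt_const.
  by apply: pt_mul; [apply: pt_yn|apply: pt_opp; apply: pt_cn].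
- apply: pt_flatten_const => q.
  apply: pt_seq1; apply: pt_pair; first by apply: pt_qn; pts.
  apply: pt_sum_terms => h.
  by apply: pt_mul; [apply: pt_yn|exact: pt_const].
- apply: pt_flatten_const => j.
  apply: pt_flatten_const => a.
  apply: (pt_map (F := fun x z => cell_eq (W x) (t x) j a z)); last by pts.
  by apply: pt_cell_eq; [apply: (pt_comp hW)|apply: (pt_comp ht)|]; pts.
Qed.

Lemma pt_init_eqs X (eX : enc X) (W : X -> nat) (w : X -> seq Sigma) : ptm W -> ptm w ->
  ptm (fun x => @init_eqs _ _ i M (W x) (w x)).
Proof.
move=> hW hw; rewrite /init_eqs; apply: pt_cat.
  apply: pt_flatten_const => q.
  by apply: pt_seq1; apply: pt_pair; [apply: pt_qn|]; exact: pt_const.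
apply: pt_flatten_const => j.
apply: pt_flatten_const => a.
apply: pt_cat.
  apply: (pt_map (F := fun x z => (Var (cn 0 j z a), cst (None == a)))); last by pts.
  by apply: pt_pair; [apply: pt_cn; pts|exact: pt_const].
apply: (pt_map (F := fun x z => (Var (cn 0 j (W x + z) a), init_cell i j a (drop z (w x))))); last by pts.
have hW' : ptm (fun q : X * nat => W q.1) by apply: (pt_comp hW); pts.
have hw' : ptm (fun q : X * nat => w q.1) by apply: (pt_comp hw); pts.
apply: pt_pair; first by apply: pt_cn; pts.
rewrite /init_cell; apply: (pt_listcase (g := fun x _ _ => cst ((if j == ord0 then Some (i x) else None) == a))).
- by pts.
- exact: pt_const.
- apply: (pt_comp (g := fun x => cst ((if j == ord0 then Some (i x) else None) == a))); first exact: pt_input.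
  by pts.
Qed.

Lemma pt_all_eqs : ptm (@all_eqs _ _ i M p).
Proof.
have hb : ptm (@bound Sigma p) by apply: pt_horner; apply: pt_size; exact: pt_id.
rewrite /all_eqs; apply: pt_cat; first by apply: pt_init_eqs; pts.
apply: pt_cat.
- apply: pt_flatten; apply: (pt_map (F := fun x t => step_eqs M (bound p x) t)); last by pts.
  by apply: pt_step_eqs; [apply: (pt_comp hb)|]; pts.
- apply: pt_seq1; apply: pt_pair; last exact: pt_const.
  apply: pt_sum_terms => h.
  by apply: pt_mul; [apply: pt_yn|exact: pt_const].
Qed.

Definition cook (w : seq Sigma) : formula :=
  foldr And (Equal Zero Zero) [seq Equal e.1 e.2 | e <- all_eqs i M p w].

Lemma pt_cook : ptm (fun w => encode (cook w)).
Proof.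
have E (s : seq eqn) : encode (foldr And (Equal Zero Zero) [seq Equal e.1 e.2 | e <- s]) =
    flatten [seq TAnd :: TEqual :: encode_term e.1 ++ encode_term e.2 | e <- s] ++ encode (Equal Zero Zero).
  by elim: s => //= e s ->; rewrite !catA.
apply: (pt_ext (f := fun w => flatten [seq TAnd :: TEqual :: encode_term e.1 ++ encode_term e.2
   | e <- all_eqs i M p w] ++ encode (Equal Zero Zero))); first by move=> w; rewrite -E.
apply: pt_cat; last exact: pt_const.
apply: pt_flatten.
apply: (pt_map (F := fun (w : seq Sigma) (e : eqn) => TAnd :: TEqual :: encode_term e.1 ++ encode_term e.2)).
  have h1 : ptm (fun q : seq Sigma * eqn => encode_term q.2.1) by apply: pt_encode_term; pts.
  have h2 : ptm (fun q : seq Sigma * eqn => encode_term q.2.2) by apply: pt_encode_term; pts.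
  by pts.
exact: pt_all_eqs.
Qed.

End Reduction.

Theorem Sat_Bc_NP_hard (R : realType) : NP_hard (Sat_Bc 'rV[R]_3).
Proof.
move=> Sigma L [A [i [M [p [_ rt HL]]]]].
exists (fun w => encode (cook i M p w)); first exact/ptm_computable/pt_cook.
move=> w; rewrite HL; split=> [/(eqs_complete rt) [v hv]|].
  by exists (cook i M p w) => //; apply/sat_equations; exists v.
case=> phi /encode_inj <- /sat_equations [v hv].
exact: (@eqs_sound _ _ i M p v).
Qed.

Theorem theorem4 (R : realType) : NP_complete (Sat_Bc 'rV[R]_3).
Proof. by split; [exact: Sat_Bc_NP|exact: Sat_Bc_NP_hard]. Qed.
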